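(* Let $N$ be a Cox process directed by a non-decreasing additive process $\eta$ with arrival times $(T_j)$, and let $M(u)=\sum_{j=1}^{N(u)}L_j(u-T_j)$, $u\ge0$, where $(L_j)$ are iid copies of an additive process $L$, independent of $(N,\eta)$. Let $s,t>0$ and let $\mathcal G_s$ be the $\sigma$-field generated by $N(s)$, $(T_j)_{j:T_j\le s}$ and $(L_j(u-T_j))_{u\le s,\ j:T_j\le s}$. Then $$\mathbb E[M(s,s+t]\mid\mathcal G_s]=\sum_{j=1}^{N(s)}\mu(s-T_j,s+t-T_j]+\mathbb E\int_{(s,s+t]}\mu(s+t-x)\,\eta(dx)$$ $$=\sum_{j=1}^{N(s)}\mu(s-T_j,s+t-T_j]+\int_{(s,s+t]\times\mathbb R_+}\mu(s+t-u)\,x\,\rho(d(u,x)),$$ and $$\mathrm{Var}(M(s,s+t]\mid\mathcal G_s)=\sum_{j=1}^{N(s)}\sigma^2(s-T_j,s+t-T_j]+\mathrm{Var}\Big(\int_{(s,s+t]}\mu(s+t-x)\,\eta(dx)\Big)+\mathbb E\int_{(s,s+t]}(\mu^2+\sigma^2)(s+t-x)\,\eta(dx)$$ $$=\sum_{j=1}^{N(s)}\sigma^2(s-T_j,s+t-T_j]+\int_{(s,s+t]\times\mathbb R_+}\mu^2(s+t-u)\,x^2\,\rho(d(u,x))+\int_{(s,s+t]\times\mathbb R_+}(\mu^2+\sigma^2)(s+t-u)\,x\,\rho(d(u,x)).$$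
   Context: $\mathbb R_+=[0,\infty)$. For a process or function $X$ and $a<b$, $X(a,b]:=X(b)-X(a)$ when $X$ is a process. An additive process is a stochastically continuous process with independent increments and càdlàg paths, starting at $0$ a.s.; by the standing convention additive processes $V$ have only a pure jump part, i.e. $\mathbb E[e^{ixV(u)}]=\exp\{\int_{(0,u]\times\mathbb R}(e^{ixv}-1)\rho(d(w,v))\}$ for a measure $\rho$ on $(0,\infty)\times\mathbb R$ (first coordinate time, second jump size) with $\rho((0,\cdot]\times\{0\})=0$, $\rho(\{u\}\times\mathbb R)=0$ and $\int_{(0,u]\times\mathbb R}(|v|\wedge1)\rho(d(w,v))<\infty$ for all $u\ge 0$. In the claim $\rho$ is this measure for $V=\eta$; it is carried by $(0,\infty)\times\mathbb R_+$ as $\eta$ is non-decreasing, and $\eta$ is identified with the random Lebesgue–Stieltjes measure it defines. A Cox process $N$ directed by $\eta$ is a counting process, $N(0)=0$, which conditionally on $\eta$ is a Poisson process with mean measure $\eta$; its arrival times are $T_j=\inf\{u\ge 0:N(u)\ge j\}$. $L_j(u)=0$ a.s. for $u\le0$. For $0\le a<b$: $\mu(a,b]:=\mathbb E\,L(a,b]$, $\sigma^2(a,b]:=\mathbb E[L(a,b]^2]-\mu(a,b]^2$; $\mu(b):=\mu(0,b]$, $\sigma^2(b):=\sigma^2(0,b]$, $\mu^2(b):=(\mu(b))^2$, $(\mu^2+\sigma^2)(b):=\mu^2(b)+\sigma^2(b)$ (all taken to be $0$ at $b=0$). Standing assumption: $L$ has finite second moments and the stochastic integrals $\int_{(0,u]}\mu(u-x)\vee\mu^2(u-x)\,\eta(dx)$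 and $\int_{(0,u]}\sigma^2(u-x)\,\eta(dx)$ exist for $u>0$; moreover the moments in the statement are finite, namely $\mathbb E\int_{(0,u]}(\mu^2+\sigma^2)(u-x)\eta(dx)<\infty$ and $\mathbb E\big(\int_{(0,u]}|\mu(u-x)|\eta(dx)\big)^2<\infty$ for $u>0$. *)

(* Defs.v *)
From HB Require Import structures.
From mathcomp Require Export all_boot all_order all_algebra.
From mathcomp Require Export finmap complex.
From mathcomp Require Export all_classical all_reals all_analysis.
From mathcomp Require Export measurable_realfun.
Set Implicit Arguments.
Unset Strict Implicit.
Unset Printing Implicit Defensive.
Import Order.TTheory GRing.Theory Num.Theory.
Import numFieldNormedType.Exports.
Local Open Scope classical_set_scope.
Local Open Scope ring_scope.

(* Processes are families [V : R -> Omega -> R] whose time axis is the whole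
   real line; those living on [0, +oo[ are extended to negative times, where
   additive processes vanish almost surely. *)

Section complex_exponential.
Context {R : realType}.

Definition cexp (z : R[i]) : R[i] :=
  Complex (expR (complex.Re z) * cos (complex.Im z))
          (expR (complex.Re z) * sin (complex.Im z)).

Definition cintegral d (T : measurableType d) (mu : {measure set T -> \bar R})
    (D : set T) (f : T -> R[i]) : R[i] :=
  Complex (\int[mu]_(x in D) complex.Re (f x))
          (\int[mu]_(x in D) complex.Im (f x)).

End complex_exponential.

Section sigma_fields.
Context d (Omega : measurableType d).

Definition sigma_gen (I : Type) d' (T : measurableType d') (D : set I)
    (X : I -> Omega -> T) : set (set Omega) :=
  <<s [set A | exists i, D i /\
         exists2 B : set T, measurable B & A = X i @^-1` B] >>.

End sigma_fields.

Section independence.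
Context d (Omega : measurableType d) (R : realType) (P : probability Omega R).
Local Open Scope ereal_scope.

Definition mutually_independent (I : choiceType) (D : set I)
    (F : I -> set (set Omega)) : Prop :=
  forall (J : {fset I}) (A : I -> set Omega),
    [set` J] `<=` D -> (forall i, i \in J -> F i (A i)) ->
    P (\bigcap_(i in [set` J]) A i) = \prod_(i <- J) P (A i).

Definition independent (F G : set (set Omega)) : Prop :=
  forall A B, F A -> G B -> P (A `&` B) = P A * P B.

End independence.

Section conditioning.
Context d (Omega : measurableType d) (R : realType) (P : probability Omega R).
Local Open Scope ereal_scope.

(* [Y] is a version of E[X | G] *)
Definition is_cond_expectation (G : set (set Omega)) (X Y : Omega -> \bar R) :
    Prop :=
  [/\ sigma_algebra setT G /\ G `<=` measurable,
      P.-integrable setT X,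
      P.-integrable setT Y,
      forall B : set (\bar R), measurable B -> G (Y @^-1` B) &
      forall A, G A -> \int[P]_(w in A) Y w = \int[P]_(w in A) X w].

(* [V] is a version of Var(X | G) = E[(X - E[X | G])^2 | G] *)
Definition is_cond_variance (G : set (set Omega)) (X : Omega -> R)
    (V : Omega -> \bar R) : Prop :=
  exists Y : Omega -> R,
    is_cond_expectation G (EFin \o X) (EFin \o Y) /\
    is_cond_expectation G (fun w => ((X w - Y w) ^+ 2)%R%:E) V.

End conditioning.

Section additive_processes.
Context {R : realType}.

Definition cadlag (f : R -> R) : Prop :=
  right_continuous f /\ forall u, cvg (f x @[x --> u^'-]).

(* the conditions on the measure of a pure jump additive process; first
   coordinate: time, second coordinate: jump size *)
Definition jump_measure (rho : {measure set (R * R) -> \bar R}) : Prop :=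
  [/\ rho (~` (`]0, +oo[ `*` setT)) = 0%E,
      forall u, rho (`]0, u] `*` [set 0]) = 0%E,
      forall u, rho ([set u] `*` setT) = 0%E &
      forall u, 0 <= u ->
        (\int[rho]_(z in `]0%R, u] `*` setT) (Num.min `|z.2| 1)%:E < +oo)%E].

Context d (Omega : measurableType d) (P : probability Omega R).

Definition independent_increments (V : R -> Omega -> R) : Prop :=
  forall u : nat -> R, 0 <= u 0%N -> {homo u : i j / (i <= j)%N >-> i <= j} ->
    mutually_independent P [set: nat]
      (fun i => sigma_gen [set: unit] (fun=> V (u i.+1) \- V (u i))).

Definition stochastically_continuous (V : R -> Omega -> R) : Prop :=
  forall u e : R, 0 < e ->
    P [set w | e <= `|V v w - V u w|] @[v --> u] --> 0%E.

(* E[e^{i x X}] *)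
Definition char_fun (X : Omega -> R) (x : R) : R[i] :=
  cintegral P setT (fun w => cexp (Complex 0 (x * X w))).

Definition additive_process (V : R -> Omega -> R)
    (rho : {measure set (R * R) -> \bar R}) : Prop :=
  [/\ forall u, measurable_fun setT (V u),
      forall u, u <= 0 -> {ae P, forall w, V u w = 0},
      forall w, cadlag (V ^~ w),
      independent_increments V /\ stochastically_continuous V &
      jump_measure rho /\
      forall u x, 0 <= u -> char_fun (V u) x =
        cexp (cintegral rho (`]0, u] `*` setT)
                (fun z => cexp (Complex 0 (x * z.2)) - 1))].

Definition same_law d' (Omega' : measurableType d') (Q : probability Omega' R)
    (V : R -> Omega -> R) (W : R -> Omega' -> R) : Prop :=
  forall n (u : 'I_n -> R) (B : 'I_n -> set R),
    (forall i, 0 <= u i) -> (forall i, measurable (B i)) ->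
    P [set w | forall i, B i (V (u i) w)] =
    Q [set w | forall i, B i (W (u i) w)].

(* [mean_incr L a b] is mu(a, b] and [var_incr L a b] is sigma^2(a, b] *)
Definition mean_incr (L : R -> Omega -> R) (a b : R) : R :=
  fine 'E_P[L b \- L a].

Definition var_incr (L : R -> Omega -> R) (a b : R) : R :=
  fine 'E_P[(L b \- L a) ^+ 2] - mean_incr L a b ^+ 2.

End additive_processes.

Section cox_processes.
Context {R : realType} d (Omega : measurableType d) (P : probability Omega R).

(* jumps of size larger than one are allowed: the directing measure may have
   atoms *)
Definition counting_process (N : R -> Omega -> nat) : Prop :=
  [/\ forall u, 0 <= u -> measurable_fun setT (N u),
      forall w, N 0 w = 0%N,
      forall w u v, 0 <= u -> u <= v -> (N u w <= N v w)%N &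
      forall w u, 0 <= u -> N v w @[v --> u^'+] --> N u w].

(* Conditionally on [eta], the increments of [N] over consecutive intervals are
   independent Poisson variables with parameters the [eta]-masses of these
   intervals. The library's [poisson_pmf] is 1 at rate 0, so that the
   distribution [poisson_prob] (which is then a Dirac mass at 0) is used; the
   second argument of [poisson_prob] is a dummy one. *)
Definition cox_process (N : R -> Omega -> nat) (eta : R -> Omega -> R) : Prop :=
  counting_process N /\
  forall (n : nat) (u : nat -> R) (k : nat -> nat),
    0 <= u 0%N -> {homo u : i j / (i <= j)%N >-> i <= j} ->
    is_cond_expectation P (sigma_gen `[0, +oo[ eta)
      (fun w => (\1_[set w' | forall i, (i < n)%N ->
                   N (u i.+1) w' = (N (u i) w' + k i)%N] w)%:E)
      (fun w => \prod_(i < n)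
         poisson_prob (eta (u i.+1) w - eta (u i) w) (k i) [set k i])%E.

(* +oo if [N] never reaches [j] *)
Definition arrival (N : R -> Omega -> nat) (j : nat) (w : Omega) : \bar R :=
  ereal_inf [set u%:E | u in [set u : R | 0 <= u /\ (j <= N u w)%N]].

(* M(u); [arrival N j w] is finite for [j <= N u w] *)
Definition cluster_process (N : R -> Omega -> nat) (L : nat -> R -> Omega -> R)
    (u : R) (w : Omega) : R :=
  \sum_(1 <= j < (N u w).+1) L j (u - fine (arrival N j w)) w.

(* The index set {j : T_j <= s} is random: a variable which is only defined for
   T_j <= s contributes the traces on {T_j <= s} of its preimages. *)
Definition past_sigma (N : R -> Omega -> nat) (L : nat -> R -> Omega -> R)
    (s : R) : set (set Omega) :=
  <<s [set A | exists n, A = [set w | N s w = n]]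
      `|` [set A | exists j, (1 <= j)%N /\
             exists2 B : set (\bar R), measurable B &
               A = [set w | (arrival N j w <= s%:E)%E /\ B (arrival N j w)]]
      `|` [set A | exists j u, [/\ (1 <= j)%N, u <= s &
             exists2 B : set R, measurable B &
               A = [set w | (arrival N j w <= s%:E)%E /\
                            B (L j (u - fine (arrival N j w)) w)]]] >>.

End cox_processes.

(* Main.v *)
(* Given the path of N, the marks L_j are independent additive processes, and an
   event of the past constrains, up to a null set, only the marks up to the
   elapsed times s - T_j; it is thus independent of the mark increments over
   (s - T_j, s + t - T_j], whose first two moments are read off the exponent of
   their characteristic functions. The past and the future of N are independent
   since eta has independent increments. For the sum R_f of f(T_j) over the
   arrivals in (s, s + t], the Poisson moments of N on finer and finer grids
   give Campbell's formulas E R_f = E int f deta and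
   E R_f^2 = E (int f deta)^2 + E int f^2 deta. With f = mu(0, s + t - .] this yields
     int_A (M(s, s + t] - Y + k)^2 dP = int_A (V + k^2) dP
   for every past event A and every constant k, where Y and V are the claimed
   conditional mean and variance: k = 0 is the variance formula, and comparing
   k = 0 with k = 1 gives the mean formula.
   The moments of int f deta are also read off its characteristic exponent
   int (e^{i f(u) v} - 1) rho(d(u, v)), once f(u) v is known to be
   rho-integrable; this follows from E int |f| deta < oo by writing |x| as a
   mixture of the functions 1 - cos (th x). *)

From HB Require Import structures.
Require Import Defs.
From mathcomp Require Import all_boot all_order all_algebra.
From mathcomp Require Import all_classical all_reals all_analysis.
From mathcomp Require Import measurable_realfun.
From mathcomp Require Import lra ring.
Set Implicit Arguments.
Unset Strict Implicit.
Unset Printing Implicit Defensive.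
Import Order.TTheory GRing.Theory Num.Theory.
Import numFieldNormedType.Exports.
Local Open Scope classical_set_scope.
Local Open Scope ring_scope.

(** * Independent sigma-fields *)

(** Neither [M] nor [eta] is assumed to have moments; only integrals of mu and sigma^2 against [eta]
    are. Campbell's formulas are therefore proved on events [eta(a, b] <= k], which belong to the
    sigma-field of [eta], and then extended by exhaustion. The identity on past events is stated for
    squares so that it makes sense in [0, +oo]: for the whole space it yields the square
    integrability of M(s, s + t] - Y. The Cox property speaks of finitely many consecutive
    increments only, so each fact about [N] starts on a grid. Grids converge path by path because
    mu(0, .] is continuous, which follows from the absence of fixed jump times. The marks vanish at
    negative times almost surely, not surely; this is where the null sets in the description of the
    past come from. The mixture of the functions 1 - cos is forced by the integral of mu^2 +
    sigma^2: a finite second moment would give rho-integrability by Fatou's lemma, but only its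
    first moment is finite by assumption. The same bound yields the sign of the jumps, which is not
    among the hypotheses on [rho]. *)

Section independence_theory.
Context d (Omega : measurableType d) (R : realType) (P : probability Omega R).
Local Open Scope ereal_scope.
Implicit Types E F : set (set Omega).

(** The pi-system on which independence is checked. The empty list is allowed and contributes
    [setT], the covering set that uniqueness of measures asks for. *)
Definition finI E : set (set Omega) :=
  [set B | exists2 l : seq (set Omega), (forall A, A \in l -> E A) &
           B = \big[setI/setT]_(A <- l) A].

Lemma finI_sub E : E `<=` finI E.
Proof.
move=> A EA; exists [:: A]; last by rewrite big_seq1.
by move=> B; rewrite inE => /eqP ->.
Qed.

Lemma finI_setT E : finI E setT.
Proof. by exists [::] => //; rewrite big_nil. Qed.

Lemma finI_setI E : setI_closed (finI E).
Proof.
move=> _ _ [l El ->] [l' El' ->]; exists (l ++ l'); last by rewrite big_cat.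
by move=> A; rewrite mem_cat => /orP[/El|/El'].
Qed.

Lemma finI_measurable E : E `<=` measurable -> finI E `<=` measurable.
Proof.
move=> mE _ [l lE ->]; elim: l lE => [|A l IH] lE; first by rewrite big_nil.
rewrite big_cons; apply: measurableI.
  by apply/mE/lE; rewrite inE eqxx.
by apply: IH => B Bl; apply: lE; rewrite inE Bl orbT.
Qed.

Lemma sigma_gen_sub E : E `<=` measurable -> <<s E >> `<=` measurable.
Proof. by move=> mE; apply: smallest_sub => //; exact: sigma_algebra_measurable. Qed.

Lemma indep_sub E F E' F' : E' `<=` E -> F' `<=` F -> independent P E F ->
  independent P E' F'.
Proof. by move=> EE FF h A B /EE EA /FF FB; exact: h. Qed.

(** As functions of [A], both sides are finite measures that agree on a pi-system containing [setT],
    hence on the sigma-field it generates. *)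
Let indep_ext1 E B : E `<=` measurable -> setI_closed E -> E setT ->
  measurable B -> (forall A, E A -> P (A `&` B) = P A * P B) ->
  forall A, <<s E >> A -> P (A `&` B) = P A * P B.
Proof.
move=> mE IE ET mB h A EA.
have P0 : (0 <= fine (P B))%R by exact: fine_ge0.
pose m1 := mrestr P mB; pose m2 := mscale (NngNum P0) P.
have m2E X : m2 X = P X * P B.
  rewrite /m2 /mscale /= muleC -[P B in RHS]fineK//.
  exact: fin_num_measure.
rewrite -m2E -[LHS]/(m1 A).
apply: (g_sigma_algebra_measure_unique E mE (fun=> setT)) => //.
- by apply/seteqP; split => // x _; exists 0%N.
- by move=> X EX; rewrite -[RHS]/(m2 X) m2E -h.
- by move=> _; rewrite /m1 /mrestr/= (le_lt_trans (probability_le1 _ _))// ?ltry//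
    setTI.
Qed.

(** The pi-system argument is run twice, freeing one of the two events at a time while the other is
    held fixed. *)
Lemma indep_ext E F : E `<=` measurable -> F `<=` measurable ->
  (forall A B, finI E A -> finI F B -> P (A `&` B) = P A * P B) ->
  independent P <<s E >> <<s F >>.
Proof.
move=> mE mF h.
have gE G : <<s G >> `<=` <<s finI G >>.
  by apply: sub_smallest2r; [exact: smallest_sigma_algebra|exact: finI_sub].
move=> A B /gE EA /gE FB.
have mA := sigma_gen_sub (finI_measurable mE) EA.
rewrite setIC muleC; apply: (indep_ext1 (finI_measurable mF)) => //.
- exact: finI_setI.
- exact: finI_setT.
move=> {FB}B FB; rewrite setIC muleC.
apply: (indep_ext1 (finI_measurable mE)) => //.
- exact: finI_setI.
- exact: finI_setT.
- exact: (finI_measurable mF).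
by move=> {EA mA}A EA; exact: h.
Qed.

End independence_theory.

(** * Freezing one of two independent components *)

Section freezing.
Context d (Omega : measurableType d) (R : realType) (P : probability Omega R).
Local Open Scope ereal_scope.
Variables E F : set (set Omega).
Hypotheses (mE : E `<=` measurable) (mF : F `<=` measurable).
Hypothesis EF : independent P <<s E >> <<s F >>.
Let TE : measurableType E.-sigma := g_sigma_algebraType E.
Let TF : measurableType F.-sigma := g_sigma_algebraType F.

Lemma measurable_sub_id (G : set (set Omega)) : G `<=` measurable ->
  measurable_fun setT (fun w : Omega => w : g_sigma_algebraType G).
Proof. by move=> mG _ A GA; rewrite setTI; exact: (sigma_gen_sub mG GA). Qed.

(** By independence, the law of the diagonal map from [Omega] to [TE * TF], two copies of [Omega]
    carrying the smaller sigma-fields, is the product of the marginal laws, so Tonelli's theorem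
    applies. It replaces conditioning: the second coordinate is frozen while the first is integrated
    out. *)
Lemma frozen_integral (h : Omega * Omega -> \bar R) :
  measurable_fun setT (h : (TE * TF)%type -> \bar R) -> (forall z, 0 <= h z) ->
  [/\ measurable_fun setT (fun w => h (w, w)),
      measurable_fun setT ((fun v => \int[P]_w h (w, v)) : TF -> \bar R) &
      \int[P]_w h (w, w) = \int[P]_v \int[P]_w h (w, v)].
Proof.
move=> mh h0.
pose i1 := fun w : Omega => w : TE; pose i2 := fun w : Omega => w : TF.
have m1 : measurable_fun setT i1 by exact: measurable_sub_id.
have m2 : measurable_fun setT i2 by exact: measurable_sub_id.
pose p1 : probability TE R := distribution P (mfun_Sub (mem_set m1)).
pose p2 : probability TF R := distribution P (mfun_Sub (mem_set m2)).
pose i := fun w : Omega => (i1 w, i2 w).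
have mi : measurable_fun setT i by exact/measurable_fun_pair.
have mhi : measurable_fun setT (fun w => h (w, w)).
  by apply: (measurableT_comp mh mi).
have eP2 (v : TF) : \int[P]_w h (w, v) = \int[p1]_w h (w, v).
  rewrite (ge0_integral_pushforward m1)//.
  by apply: measurableT_comp mh _; exact: pair2_measurable.
split => //.
  under eq_fun do rewrite eP2.
  exact: (@measurable_fun_fubini_tonelli_G _ _ TE TF R p1 h).
have mG : measurable_fun setT (fun v : TF => \int[p1]_w h (w, v)).
  exact: (@measurable_fun_fubini_tonelli_G _ _ TE TF R p1 h).
transitivity (\int[p1 \x p2]_z h z).
  rewrite (eq_measure_integral (distribution P (mfun_Sub (mem_set mi)))).
    by rewrite ge0_integral_pushforward.
  move=> A mA _;
  apply: (@product_measure_unique _ _ TE TF R p1 p2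
    (distribution P (mfun_Sub (mem_set mi)))) => //.
rewrite (@fubini_tonelli2 _ _ TE TF R p1 p2)//.
under [RHS]eq_integral do rewrite eP2.
rewrite (ge0_integral_pushforward m2)// => v _.
exact: integral_ge0.
Qed.

Lemma indep_integralM (X Y : Omega -> \bar R) :
  measurable_fun setT (X : TE -> \bar R) ->
  measurable_fun setT (Y : TF -> \bar R) ->
  (forall w, 0 <= X w) -> (forall w, 0 <= Y w) ->
  \int[P]_w (X w * Y w) = (\int[P]_w X w) * (\int[P]_w Y w).
Proof.
move=> mX mY X0 Y0.
pose h (z : Omega * Omega) := X z.1 * Y z.2.
have mh : measurable_fun setT (h : (TE * TF)%type -> \bar R).
  apply: emeasurable_funM.
    exact: (measurableT_comp mX measurable_fst).
  exact: (measurableT_comp mY measurable_snd).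
have [|_ _ e] := frozen_integral mh.
  by move=> z; exact: mule_ge0.
rewrite /h/= in e; rewrite e.
have mX' : measurable_fun setT X.
  exact: (measurableT_comp mX (measurable_sub_id mE)).
have mY' : measurable_fun setT Y.
  exact: (measurableT_comp mY (measurable_sub_id mF)).
under eq_integral do (rewrite ge0_integralZr//).
by rewrite ge0_integralZl// integral_ge0.
Qed.

(** Splitting both factors into positive and negative parts leaves four nonnegative products, for
    which [indep_integralM] holds. *)
Lemma indep_RintegralM (X Y : Omega -> R) :
  measurable_fun setT (X : TE -> R) -> measurable_fun setT (Y : TF -> R) ->
  P.-integrable setT (EFin \o X) -> P.-integrable setT (EFin \o Y) ->
  P.-integrable setT (EFin \o (fun w => X w * Y w)%R) /\
  (\int[P]_w (X w * Y w) = (\int[P]_w X w) * (\int[P]_w Y w))%R.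
Proof.
move=> mX mY iX iY.
pose h (z : Omega * Omega) := (X z.1 * Y z.2)%:E.
have mX' : measurable_fun setT X.
  exact: (measurableT_comp mX (measurable_sub_id mE)).
have mY' : measurable_fun setT Y.
  exact: (measurableT_comp mY (measurable_sub_id mF)).
have int2 (f g : Omega -> R) : measurable_fun setT (f : TE -> R) ->
    measurable_fun setT (g : TF -> R) ->
    (forall w, 0 <= f w)%R -> (forall w, 0 <= g w)%R ->
    P.-integrable setT (EFin \o f) -> P.-integrable setT (EFin \o g) ->
    P.-integrable setT (EFin \o (fun w => f w * g w)%R) /\
    (\int[P]_w (f w * g w) = (\int[P]_w f w) * (\int[P]_w g w))%R.
  move=> mf mg f0 g0 jf jg.
  have e : \int[P]_w (f w * g w)%:E = \int[P]_w (f w)%:E * \int[P]_w (g w)%:E.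
    under eq_integral do rewrite EFinM.
    rewrite indep_integralM//; exact/measurable_EFinP.
  have mf' : measurable_fun setT f.
    exact: (measurableT_comp mf (measurable_sub_id mE)).
  have mg' : measurable_fun setT g.
    exact: (measurableT_comp mg (measurable_sub_id mF)).
  have Ff := integrable_fin_num measurableT jf.
  have Fg := integrable_fin_num measurableT jg.
  split; last by rewrite /Rintegral e fineM.
  apply/integrableP; split.
    by apply/measurable_EFinP; exact: measurable_funM.
  under eq_integral do rewrite /= ger0_norm ?mulr_ge0//.
  by rewrite e; rewrite ltey_eq fin_numM.
pose pX w : R := Num.max (X w) 0%R; pose nX w : R := Num.max (- X w)%R 0%R.
pose pY w : R := Num.max (Y w) 0%R; pose nY w : R := Num.max (- Y w)%R 0%R.
have decomp (Z : Omega -> R) w : (Z w = Num.max (Z w) 0 - Num.max (- Z w) 0)%R.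
  have [h0|h0] := leP 0%R (Z w).
    by rewrite max_r ?oppr_le0// subr0.
  by rewrite max_l ?oppr_ge0 ?(ltW h0)// sub0r opprK.
have ipart (Z : Omega -> R) : P.-integrable setT (EFin \o Z) ->
    P.-integrable setT (EFin \o (fun w => Num.max (Z w) 0)%R) /\
    P.-integrable setT (EFin \o (fun w => Num.max (- Z w) 0)%R).
  move=> iZ.
  have mZ : measurable_fun setT Z by apply/measurable_EFinP; exact: measurable_int iZ.
  split; apply: (le_integrable _ _ _ iZ) => //.
  - by apply/measurable_EFinP; exact: measurable_maxr.
  - move=> w _ /=; rewrite lee_fin.
    by rewrite ger0_norm ?le_max ?lexx ?orbT// ge_max normr_ge0 ler_norm.
  - by apply/measurable_EFinP; apply: measurable_maxr => //; exact: measurable_funN.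
  - move=> w _ /=; rewrite lee_fin.
    by rewrite ger0_norm ?le_max ?lexx ?orbT// ge_max normr_ge0 -normrN ler_norm.
have [ipX inX] := ipart _ iX; have [ipY inY] := ipart _ iY.
have ge0 (Z : Omega -> R) w : (0 <= Num.max (Z w) 0)%R.
  by rewrite le_max lexx orbT.
have mpX : measurable_fun setT (pX : TE -> R) by exact: measurable_maxr.
have mnX : measurable_fun setT (nX : TE -> R).
  by apply: measurable_maxr => //; exact: measurable_funN.
have mpY : measurable_fun setT (pY : TF -> R) by exact: measurable_maxr.
have mnY : measurable_fun setT (nY : TF -> R).
  by apply: measurable_maxr => //; exact: measurable_funN.
have [i1 e1] := int2 _ _ mpX mpY (ge0 _) (ge0 _) ipX ipY.
have [i2 e2] := int2 _ _ mpX mnY (ge0 _) (ge0 _) ipX inY.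
have [i3 e3] := int2 _ _ mnX mpY (ge0 _) (ge0 _) inX ipY.
have [i4 e4] := int2 _ _ mnX mnY (ge0 _) (ge0 _) inX inY.
have XYE : (fun w => X w * Y w)%R = (fun w => (pX w * pY w - pX w * nY w) -
   (nX w * pY w - nX w * nY w))%R.
  apply/funext => w; have -> : X w = (pX w - nX w)%R by exact: decomp.
  have -> : Y w = (pY w - nY w)%R by exact: decomp.
  ring.
have i5 : P.-integrable setT (EFin \o (fun w => pX w * pY w - pX w * nY w)%R).
  exact: integrableB i1 i2.
have i6 : P.-integrable setT (EFin \o (fun w => nX w * pY w - nX w * nY w)%R).
  exact: integrableB i3 i4.
split; first by rewrite XYE; exact: integrableB i5 i6.
rewrite XYE RintegralB// RintegralB// RintegralB// e1 e2 e3 e4.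
have -> : (\int[P]_w X w = \int[P]_w pX w - \int[P]_w nX w)%R.
  by rewrite -RintegralB//; apply: eq_Rintegral => w _; exact: decomp.
have -> : (\int[P]_w Y w = \int[P]_w pY w - \int[P]_w nY w)%R.
  by rewrite -RintegralB//; apply: eq_Rintegral => w _; exact: decomp.
ring.
Qed.

End freezing.

(** * Families of independent sigma-fields *)

Section independence_families.
Context d (Omega : measurableType d) (R : realType) (P : probability Omega R).
Local Open Scope ereal_scope.

(** Each [A i] is closed under intersection, so the members of the list with a common index merge
    into one set [C i]. The value [setT] off [J] allows two such intersections to be written over a
    common index set. *)
Lemma finI_bigcup (I : choiceType) (D : set I) (A : I -> set (set Omega)) B :
  (forall i, D i -> setI_closed (A i)) -> (forall i, D i -> A i setT) ->
  finI (\bigcup_(i in D) A i) B ->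
  exists (J : {fset I}) (C : I -> set Omega),
    [/\ [set` J] `<=` D, forall i, D i -> A i (C i),
        forall i, i \notin J -> C i = setT & B = \bigcap_(i in [set` J]) C i].
Proof.
move=> AI AT [l lA ->] {B}; elim: l lA => [|B l IH] lA.
  exists fset0, (fun=> setT); split => //.
  by rewrite big_nil; apply/esym/bigcapT.
have [J [C [JD AC CT e]]] : exists (J : {fset I}) (C : I -> set Omega),
    [/\ [set` J] `<=` D, forall i, D i -> A i (C i),
    forall i, i \notin J -> C i = setT &
        \big[setI/setT]_(B <- l) B = \bigcap_(i in [set` J]) C i].
  by apply: IH => X Xl; apply: lA; rewrite inE Xl orbT.
have [i Di ABi] : (\bigcup_(i in D) A i) B by apply: lA; rewrite inE eqxx.
pose C' k := (if k == i then B else setT) `&` C k.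
exists (i |` J)%fset, C'; split.
- by move=> k /=; rewrite !inE => /orP[/eqP->//|/JD].
- move=> k Dk; rewrite /C'; case: eqP => [ki|_]; last by rewrite setTI; exact: AC.
  by apply: AI => //; [rewrite ki|exact: AC].
- move=> k; rewrite !inE negb_or => /andP[/negbTE ki kJ].
  by rewrite /C' ki setTI CT.
rewrite big_cons e; apply/seteqP; split => [w [Bw Cw] k/=|w Cw].
  rewrite /C' !inE => /orP[/eqP->|kJ].
    rewrite eqxx; split => //; have [/Cw//|iJ] := boolP (i \in J).
    by rewrite CT.
  by case: eqP => _; split => //; exact: Cw.
split.
  by have := Cw i; rewrite /C'/= eqxx !inE eqxx => /(_ isT)[].
by move=> k /= kJ; have := Cw k; rewrite /C'/= !inE kJ orbT => /(_ isT)[].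
Qed.

Lemma sigma_algebra_setI (F : set (set Omega)) :
  sigma_algebra setT F -> setI_closed F.
Proof.
move=> [F0 FC FU] A B FA FB.
have -> : A `&` B = setT `\` (\bigcup_k (if k == 0%N then setT `\` A else setT `\` B)).
  rewrite setTD; apply/seteqP; split => [w [Aw Bw] [k _]|w H].
    by case: ifP => _ [].
  split; apply: contrapT => nw; apply: H.
    by exists 0%N.
  by exists 1%N.
by apply: (FC); apply: FU => k; case: ifP => _; exact: FC.
Qed.

Lemma sigma_algebra_setT (F : set (set Omega)) : sigma_algebra setT F -> F setT.
Proof. by move=> [F0 FC _]; rewrite -(setD0 setT); exact: FC. Qed.

(* With [A i] or [B i] trivial this is also the grouping lemma. *)
Lemma independent_bigcup (I : choiceType) (D : set I)
    (F A B : I -> set (set Omega)) :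
  (forall i, D i -> F i `<=` measurable) -> (forall i, D i -> sigma_algebra setT (F i)) ->
  (forall i, D i -> sigma_algebra setT (A i)) -> (forall i, D i -> sigma_algebra setT (B i)) ->
  (forall i, D i -> A i `<=` F i) -> (forall i, D i -> B i `<=` F i) ->
  mutually_independent P D F -> (forall i, D i -> independent P (A i) (B i)) ->
  independent P <<s \bigcup_(i in D) A i >> <<s \bigcup_(i in D) B i >>.
Proof.
move=> mF sF sA sB AF BF indF AB.
apply: indep_ext.
- by move=> X [i Di /(AF _ Di)]; exact: mF.
- by move=> X [i Di /(BF _ Di)]; exact: mF.
move=> X Y /finI_bigcup[i Di|i Di|J1 [C1 [J1D AC1 C1T ->]]].
- by apply: sigma_algebra_setI; exact: sA.
- by apply: sigma_algebra_setT; exact: sA.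
move=> /finI_bigcup[i Di|i Di|J2 [C2 [J2D BC2 C2T ->]]].
- by apply: sigma_algebra_setI; exact: sB.
- by apply: sigma_algebra_setT; exact: sB.
pose J := (J1 `|` J2)%fset.
have JD : [set` J] `<=` D by move=> k /=; rewrite inE => /orP[/J1D|/J2D].
have ext (K : {fset I}) (C : I -> set Omega) : (forall i, i \in K -> i \in J) ->
    (forall i, i \notin K -> C i = setT) ->
    \bigcap_(i in [set` K]) C i = \bigcap_(i in [set` J]) C i.
  move=> KJ CT; apply/seteqP; split => w Cw k /= kJ.
    by have [/Cw//|kK] := boolP (k \in K); rewrite CT.
  by apply: Cw; exact: KJ.
rewrite (ext J1) ?(ext J2)//; [|by move=> i; rewrite inE => ->; rewrite ?orbT..].
rewrite -bigcapI.
rewrite !indF//.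
- rewrite -big_split/=; apply: eq_big_seq => i iJ.
  have Di : D i := JD i iJ.
  by apply: (AB i Di); [exact: AC1|exact: BC2].
- by move=> i /JD Di; apply: BF => //; exact: BC2.
- by move=> i /JD Di; apply: AF => //; exact: AC1.
move=> i /JD Di; apply: sigma_algebra_setI; first exact: sF.
  by apply: AF => //; exact: AC1.
by apply: BF => //; exact: BC2.
Qed.

Lemma measurable_sub_mono d' (T : measurableType d') (E F : set (set Omega)) (X : Omega -> T) :
  <<s E >> `<=` <<s F >> ->
  measurable_fun setT (X : g_sigma_algebraType E -> T) ->
  measurable_fun setT (X : g_sigma_algebraType F -> T).
Proof. by move=> EF mX _ B mB; apply: EF; exact: mX. Qed.

End independence_families.

(** The generating class of [sigma_gen], kept apart so that [g_sigma_algebraType (gen D X)] is a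
    measurable type on [Omega] and measurability with respect to the family [X] can be stated. *)
Definition gen (Omega I : Type) d' (T : measurableType d') (D : set I)
    (X : I -> Omega -> T) : set (set Omega) :=
  [set A | exists i, D i /\ exists2 B : set T, measurable B & A = X i @^-1` B].

Lemma gen_measurable d (Omega : measurableType d) (I : Type) d' (T : measurableType d') (D : set I) (X : I -> Omega -> T) :
  (forall i, D i -> measurable_fun setT (X i)) -> gen D X `<=` measurable.
Proof. by move=> mX _ [i [Di [B mB ->]]]; rewrite -(setTI (_ @^-1` _)); exact: mX. Qed.

Lemma measurable_gen (Omega : pointedType) (I : Type) d' (T : measurableType d') (D : set I) (X : I -> Omega -> T) i :
  D i -> measurable_fun setT (X i : g_sigma_algebraType (gen D X) -> T).
Proof.
move=> Di _ B mB; rewrite setTI; apply: sub_sigma_algebra.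
by exists i; split => //; exists B.
Qed.

Lemma sub_gen (Omega : pointedType) (I : Type) d' (T : measurableType d') (D : set I) (X : I -> Omega -> T) (F : set (set Omega)) :
  (forall i, D i -> measurable_fun setT (X i : g_sigma_algebraType F -> T)) ->
  <<s gen D X >> `<=` <<s F >>.
Proof.
move=> h; apply: smallest_sub; first exact: smallest_sigma_algebra.
by move=> _ [i [Di [B mB ->]]]; have := h _ Di measurableT _ mB; rewrite setTI.
Qed.

(** * Time grids and independent increments *)

Section time_grid.
Context {R : realType}.

(** Sorting [0], [s] and the given times makes each of them a grid point. Past the last one the grid
    is constant, so it is an infinite nondecreasing sequence, the form in which
    [independent_increments] is stated. *)
Lemma time_grid (s : R) (ts : seq R) : 0 <= s -> (forall v, v \in ts -> 0 <= v) ->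
  exists (u : nat -> R) (m : nat), [/\ u 0%N = 0, u m = s,
    {homo u : i j / (i <= j)%N >-> i <= j},
    forall v, v \in ts -> v <= s -> exists2 i, (i <= m)%N & u i = v &
    forall v, v \in ts -> s <= v -> exists2 i, (m <= i)%N & u i = v].
Proof.
move=> s0 ts0.
pose S := sort <=%R [:: 0, s & ts].
have sS : sorted <=%R S by apply: sort_sorted; exact: le_total.
have memS v : (v \in S) = (v \in [:: 0, s & ts]) by rewrite mem_sort.
have szS : size S = (size ts).+2 by rewrite size_sort.
pose u i := nth 0 S (minn i (size S).-1).
have minlt i : (minn i (size S).-1 < size S)%N.
  by rewrite (leq_ltn_trans (geq_minr _ _))// szS.
have nthle i j : (i <= j)%N -> (j < size S)%N -> nth 0 S i <= nth 0 S j.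
  move=> ij jS; apply: (sorted_leq_nth le_trans le_refl) => //.
  by rewrite inE (leq_ltn_trans ij).
have uidx v : v \in S -> u (index v S) = v.
  move=> vS; rewrite /u (minn_idPl _) ?nth_index//.
  by rewrite -ltnS prednK ?index_mem// szS.
have idxle v w : v \in S -> w \in S -> v < w -> (index v S <= index w S)%N.
  move=> vS wS vw; rewrite leqNgt; apply/negP => wv.
  have := nthle _ _ (ltnW wv); rewrite index_mem => /(_ vS).
  by rewrite !nth_index// leNgt vw.
have sinS : s \in S by rewrite memS !inE eqxx orbT.
exists u, (index s S); split.
- apply/eqP; rewrite eq_le; apply/andP; split.
    have zS : 0 \in S by rewrite memS inE eqxx.
    rewrite -[leRHS](uidx _ zS); apply: nthle => //.
    by rewrite min0n.
  have : u 0%N \in S by apply: mem_nth.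
  by rewrite memS !inE => /orP[/eqP->//|/orP[/eqP->//|/ts0]].
- exact: uidx.
- move=> i j ij; apply: nthle => //.
  by rewrite leq_min geq_minr andbT (leq_trans (geq_minl _ _)).
- move=> v vts vs; have vS : v \in S by rewrite memS !inE vts !orbT.
  exists (index v S); last exact: uidx.
  by move: vs; rewrite le_eqVlt => /predU1P[->//|]; exact: idxle.
- move=> v vts vs; have vS : v \in S by rewrite memS !inE vts !orbT.
  exists (index v S); last exact: uidx.
  by move: vs; rewrite le_eqVlt => /predU1P[->//|]; exact: idxle.
Qed.

End time_grid.

(** A finite intersection involves finitely many indices, however large [D] is; this reduces events
    of a whole process to a grid. *)
Lemma finI_times d (Omega : measurableType d) (I : eqType) d' (T : measurableType d')
    (D : set I) (X : I -> Omega -> T) (A : set Omega) :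
  finI (gen D X) A -> exists ts : seq I, (forall v, v \in ts -> D v) /\
    <<s gen [set v | v \in ts] X >> A.
Proof.
move=> [l lA ->] {A}; elim: l lA => [|A l IH] lA.
  exists [::]; split => //; rewrite big_nil.
  exact: (@measurableT _ (g_sigma_algebraType _)).
have [ts [tsD H]] : exists ts : seq I, (forall v, v \in ts -> D v) /\
    <<s gen [set v | v \in ts] X >> (\big[setI/setT]_(A <- l) A).
  by apply: IH => B Bl; apply: lA; rewrite inE Bl orbT.
have [v [Dv [B mB e]]] := lA A (mem_head _ _).
exists (v :: ts); split.
  by move=> w; rewrite inE => /orP[/eqP->//|/tsD].
rewrite big_cons; apply: (@measurableI _ (g_sigma_algebraType _)).
  apply: sub_sigma_algebra; exists v; split; first by rewrite /= inE eqxx.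
  by exists B.
apply: (sub_smallest2r _ _ H); first exact: smallest_sigma_algebra.
move=> _ [w [/= wts [C mC ->]]]; exists w; split; first by rewrite /= inE wts orbT.
by exists C.
Qed.

Lemma trivial_sigma_algebra (T : Type) : sigma_algebra setT [set (set0 : set T); setT].
Proof.
split; first by left.
  by move=> C [->|->]; [right; rewrite setTD setC0|left; rewrite setDv].
move=> C HC; have [[k Ck]|nC] := pselect (exists k, C k = setT).
  right; apply/seteqP; split => // w _; exists k => //.
  by rewrite Ck.
left; apply/seteqP; split => // w [k _].
case: (HC k) => [->//|e]; exfalso; apply: nC; by exists k.
Qed.

Section independent_increments.
Context d (Omega : measurableType d) (R : realType) (P : probability Omega R).
Local Open Scope ereal_scope.
Variable V : R -> Omega -> R.
Hypothesis mV : forall u, measurable_fun setT (V u).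
Hypothesis iV : independent_increments P V.

(** After reduction to finitely many times, a grid through [s] separates the elementary increments
    into those before and those after [s]. The increments from [0] and from [s] are telescoping sums
    of these. *)
Lemma independent_increments_split (s : R) : (0 <= s)%R ->
  independent P (sigma_gen `[0%R, s] (fun v => V v \- V 0)%R)
                (sigma_gen `[s, +oo[ (fun v => V v \- V s)%R).
Proof.
move=> s0.
have mVV u v : measurable_fun setT (V u \- V v)%R by exact: measurable_funB.
apply: indep_ext.
- exact: gen_measurable.
- exact: gen_measurable.
move=> A B /finI_times[ts [tsD HA]] /finI_times[ts' [tsD' HB]].
have [|u [m [u0 um um' H1 H2]]] := @time_grid R s (ts ++ ts') s0.
  move=> v; rewrite mem_cat => /orP[/tsD|/tsD'] /=; rewrite in_itv/=.
    by case/andP.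
  by rewrite andbT; apply: le_trans.
pose F i := sigma_gen [set: unit] (fun=> V (u i.+1) \- V (u i))%R.
have mF i : F i `<=` measurable by apply/sigma_gen_sub/gen_measurable.
have sF i : sigma_algebra setT (F i) by exact: smallest_sigma_algebra.
have indF : mutually_independent P [set: nat] F.
  by apply: iV => //; rewrite u0.
pose T0 := [set (set0 : set Omega); setT].
have sT0 : sigma_algebra setT T0 := trivial_sigma_algebra Omega.
(* Each cell goes entirely to one side and leaves the trivial sigma-field on the other, so the two
   halves of a cell are trivially independent. *)
pose F1 i := if (i < m)%N then F i else T0.
pose F2 i := if (i < m)%N then T0 else F i.
have T0F i : T0 `<=` F i.
  move=> _ [->|->]; first by case: (sF i).
  exact: sigma_algebra_setT.
have ind12 i : independent P (F1 i) (F2 i).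
  rewrite /F1 /F2; case: ifP => _ X Y.
    move=> _ [->|->]; first by rewrite setI0 measure0 mule0.
    by rewrite setIT probability_setT mule1.
  move=> [->|->] _; first by rewrite set0I measure0 mul0e.
  by rewrite setTI probability_setT mul1e.
have sub1 i : F1 i `<=` F i by rewrite /F1; case: ifP => _ //; exact: T0F.
have sub2 i : F2 i `<=` F i by rewrite /F2; case: ifP => _ //; exact: T0F.
have sF1 i : sigma_algebra setT (F1 i) by rewrite /F1; case: ifP.
have sF2 i : sigma_algebra setT (F2 i) by rewrite /F2; case: ifP.
have ind : independent P <<s \bigcup_(i in [set: nat]) F1 i >>
                         <<s \bigcup_(i in [set: nat]) F2 i >>.
  exact: (independent_bigcup (F := F)).
have m1 i : (i < m)%N -> measurable_fun setT
   ((V (u i.+1) \- V (u i))%R : g_sigma_algebraType (\bigcup_(i in [set: nat]) F1 i) -> R).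
  move=> im _ Y mY; rewrite setTI; apply: sub_sigma_algebra.
  exists i => //; rewrite /F1 im; apply: sub_sigma_algebra; exists tt; split => //.
  by exists Y.
have m2 i : (m <= i)%N -> measurable_fun setT
   ((V (u i.+1) \- V (u i))%R : g_sigma_algebraType (\bigcup_(i in [set: nat]) F2 i) -> R).
  move=> im _ Y mY; rewrite setTI; apply: sub_sigma_algebra.
  exists i => //; rewrite /F2 ltnNge im; apply: sub_sigma_algebra; exists tt; split => //.
  by exists Y.
(* The guard repeats the range of the sum; it makes every summand measurable, whatever the index, as
   the rule for sums demands. *)
have tel i j : (i <= j)%N -> (V (u j) \- V (u i) =
    (fun w => \sum_(i <= k < j)
       (if (i <= k < j)%N then (V (u k.+1) \- V (u k)) w else 0)))%R.
  move=> ij; apply/funext => w.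
  by rewrite -big_mkcond/= -big_nat/= (telescope_sumr (fun k => V (u k) w)).
apply: ind.
- apply: (sub_gen _ HA) => v /= vts.
  have [||i im <-] := H1 v; first by rewrite mem_cat vts.
    by have := tsD _ vts; rewrite /= in_itv/= => /andP[].
  rewrite -u0 tel//.
  apply: measurable_sum => k; case ki: (0 <= k < i)%N => //.
  by apply: m1; rewrite (leq_trans _ im).
- apply: (sub_gen _ HB) => v /= vts.
  have [||i im <-] := H2 v; first by rewrite mem_cat vts orbT.
    by have := tsD' _ vts; rewrite /= in_itv/= andbT.
  rewrite -um tel//.
  apply: measurable_sum => k; case mki: (m <= k < i)%N => //.
  by apply: m2; case/andP: mki.
Qed.

End independent_increments.

(** * Moments from characteristic exponents *)

Section real_bounds.
Context {R : realType}.
Implicit Types x y : R.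

Lemma sin_le_norm x : `|sin x| <= `|x|.
Proof.
wlog x0 : x / 0 < x => [H|].
  have [|x0|->] := ltgtP x 0; [move=> x0|exact: H|by rewrite sin0].
  by rewrite -(opprK x) sinN normrN (normrN (- x)); apply: H; rewrite oppr_gt0.
have [c _ e] := @MVT R sin cos 0 x x0 (fun z _ => is_derive_sin z)
  (continuous_subspaceT (@continuous_sin R)).
by move: e; rewrite sin0 !subr0 => ->; rewrite normrM ler_piMl// cos_max.
Qed.

Lemma one_cosE x : 1 - cos x = 2 * sin (x / 2) ^+ 2.
Proof.
rewrite {1}(_ : x = (x / 2) *+ 2); last by rewrite -mulr_natr; field.
by rewrite cos_mulr2n sin2cos2; ring.
Qed.

Lemma one_cos_ge0 x : 0 <= 1 - cos x.
Proof. by rewrite subr_ge0 cos_le1. Qed.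

Lemma one_cos_le2 x : 1 - cos x <= 2.
Proof. by have := cos_geN1 x; lra. Qed.

Lemma one_cos_le_sqr x : 1 - cos x <= x ^+ 2 / 2.
Proof.
rewrite one_cosE.
have : `|sin (x / 2)| ^+ 2 <= `|x / 2| ^+ 2.
  by rewrite lerXn2r ?nnegrE// sin_le_norm.
rewrite !real_normK ?num_real// => h.
have -> : x ^+ 2 / 2 = 2 * (x / 2) ^+ 2 by field.
by rewrite ler_pM2l.
Qed.

(** Mean value theorem: the derivative [cos z - 1] is at most [z ^+ 2 / 2] in absolute value. *)
Lemma sin_sub_le x : `|sin x - x| <= `|x| ^+ 3 / 2.
Proof.
wlog x0 : x / 0 < x => [H|].
  have [|x0|->] := ltgtP x 0; [move=> x0|exact: H|].
    have := H (- x); rewrite oppr_gt0 => /(_ x0).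
    by rewrite sinN -opprD !normrN.
  by rewrite sin0 subrr normr0 expr0n mul0r.
have d (z : R) : is_derive z 1 (fun x : R => sin x - x) (cos z - 1).
  by apply: is_deriveB.
have [c] := @MVT R (fun x : R => sin x - x) (fun z => cos z - 1) 0 x x0 (fun z _ => d z)
  (derivable_within_continuous (fun z _ => @ex_derive _ _ _ _ _ _ _ (d z))).
rewrite in_itv/= => /andP[c0 cx].
rewrite sin0 !subr0 => ->.
rewrite normrM -normrN opprB (ger0_norm (one_cos_ge0 c)) (gtr0_norm x0).
rewrite exprSr -mulrAC ler_pM2r//.
apply: (le_trans (one_cos_le_sqr c)); rewrite ler_pM2r//.
by rewrite lerXn2r ?nnegrE ?ltW// (lt_trans c0).
Qed.

Lemma one_cos_sub_le x : `|1 - cos x - x ^+ 2 / 2| <= x ^+ 4 / 8.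
Proof.
rewrite one_cosE.
(* A difference of two squares: one factor is cubically small by [sin_sub_le], the other is at most
   linear. *)
have -> : 2 * sin (x / 2) ^+ 2 - x ^+ 2 / 2 = 2 * ((sin (x / 2) - x / 2) * (sin (x / 2) + x / 2)).
  by field.
rewrite normrM (@gtr0_norm _ 2)// normrM.
have -> : x ^+ 4 / 8 = 2 * ((`|x / 2| ^+ 3 / 2) * (2 * `|x / 2|)).
  have -> : `|x / 2| ^+ 3 / 2 * (2 * `|x / 2|) = (`|x / 2| ^+ 2) ^+ 2 by field.
  by rewrite real_normK ?num_real//; field.
rewrite ler_pM2l// ler_pM ?sin_sub_le//.
apply: (le_trans (ler_normD _ _)).
by have := sin_le_norm (x / 2); lra.
Qed.

Lemma one_expRN_bounds x : 0 <= x -> `|1 - expR (- x) - x| <= x ^+ 2.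
Proof.
move=> x0.
have h1 : 1 - x <= expR (- x) by apply: le_trans (expR_ge1Dx _).
have h2 : expR (- x) <= 1 - x + x ^+ 2.
  rewrite expRN -[leRHS]mulr1.
  rewrite -(ler_pM2r (expR_gt0 x)) mulVf ?gt_eqF ?expR_gt0// mulr1.
  have := expR_ge1Dx x => h.
  (* Since e^x >= 1 + x, it suffices that (1 - x + x^2)(1 + x) = 1 + x^3 is at least 1. *)
  apply: (@le_trans _ _ ((1 - x + x ^+ 2) * (1 + x))).
    have -> : (1 - x + x ^+ 2) * (1 + x) = 1 + x ^+ 3 by ring.
    by rewrite lerDl exprn_ge0.
  by rewrite ler_wpM2l//; nra.
by rewrite ler_norml; apply/andP; split; nra.
Qed.

Lemma one_cos_le_min x : 1 - cos x <= 2 * Num.min `|x| 1.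
Proof.
have [x1|x1] := lerP `|x| 1.
  apply: (le_trans (one_cos_le_sqr x)).
  by rewrite -(real_normK (num_real x)); have := normr_ge0 x; nra.
by rewrite mulr1 one_cos_le2.
Qed.

Lemma sin_le_min x : `|sin x| <= Num.min `|x| 1.
Proof. by rewrite le_min sin_le_norm sin_max. Qed.

End real_bounds.

Section real_dominated_convergence.
Context d (T : measurableType d) (R : realType) (mu : {measure set T -> \bar R}).
Variables (D : set T) (mD : measurable D).

Lemma Rdominated_convergence (f_ : nat -> T -> R) (f g : T -> R) :
  (forall n, measurable_fun D (f_ n)) ->
  (forall x, D x -> f_ ^~ x @ \oo --> f x) ->
  mu.-integrable D (EFin \o g) ->
  (forall n x, D x -> `|f_ n x| <= g x) ->
  mu.-integrable D (EFin \o f) /\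
  \int[mu]_(x in D) f_ n x @[n --> \oo] --> \int[mu]_(x in D) f x.
Proof.
move=> mf_ f_f ig fg.
have mf : measurable_fun D f.
  exact: (measurable_fun_cvg mf_ f_f).
have [|||||i1 _ c] := @dominated_convergence d T R mu D mD (fun n => EFin \o f_ n) (EFin \o f)
   (EFin \o g).
- by move=> n; exact/measurable_EFinP.
- exact/measurable_EFinP.
- apply: aeW => x Dx; apply: cvg_EFin; last exact: f_f.
  by near=> n.
- by [].
- by apply: aeW => x n Dx /=; rewrite lee_fin fg.
split => //.
by apply: fine_cvg; rewrite fineK ?integrable_fin_num.
Unshelve. all: by end_near. Qed.

End real_dominated_convergence.

Lemma cvg_perturb {R : realType} (u v e : nat -> R) (l : R) :
  v n @[n --> \oo] --> l -> e n @[n --> \oo] --> (0 : R) ->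
  (forall n, `|u n - v n| <= e n) -> u n @[n --> \oo] --> l.
Proof.
move=> vl e0 H.
rewrite (_ : u = (fun n => v n + (u n - v n))); last first.
  by apply/funext => n; rewrite addrC subrK.
rewrite -[l]addr0; apply: cvgD => //.
apply: norm_cvg0; apply: (squeeze_cvgr _ (cvg_cst 0) e0).
by near=> n; rewrite normr_ge0/= H.
Unshelve. all: by end_near. Qed.

Lemma measurable_cos {R : realType} : measurable_fun setT (@cos R).
Proof. by apply: continuous_measurable_fun; exact: continuous_cos. Qed.

Lemma measurable_sin {R : realType} : measurable_fun setT (@sin R).
Proof. by apply: continuous_measurable_fun; exact: continuous_sin. Qed.

Lemma bounded_integrable d (T : measurableType d) (R : realType)
    (mu : {measure set T -> \bar R}) (D : set T) (f : T -> R) (c : R) :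
  measurable D -> (mu D < +oo)%E -> measurable_fun D f ->
  (forall x, D x -> `|f x| <= c) -> mu.-integrable D (EFin \o f).
Proof.
move=> mD muD mf fc; apply: measurable_bounded_integrable => //.
exists c; split; first exact: num_real.
by move=> y cy x Dx /=; rewrite (le_trans (fc x Dx))// ltW.
Qed.

Lemma prob_bounded_integrable d (T : measurableType d) (R : realType)
    (P : probability T R) (f : T -> R) (c : R) :
  measurable_fun setT f -> (forall x, `|f x| <= c) -> P.-integrable setT (EFin \o f).
Proof.
move=> mf fc; apply: (@bounded_integrable _ _ _ _ _ _ c) => //.
exact: (le_lt_trans (probability_le1 P measurableT) (ltry _)).
Qed.

Lemma Rintegral_prob_cst d (T : measurableType d) (R : realType)
    (P : probability T R) (c : R) : \int[P]_w c = c.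
Proof.
have PT : P setT = 1%E by exact: probability_setT.
by rewrite Rintegral_cst// -[RHS]mulr1; congr (_ * _); rewrite [X in fine X]PT.
Qed.

Lemma cvgM0 {R : realType} (u v : nat -> R) (l : R) : u n @[n --> \oo] --> l ->
  v n @[n --> \oo] --> (0 : R) -> u n * v n @[n --> \oo] --> (0 : R).
Proof. by move=> ul v0; rewrite -(mulr0 l); exact: cvgM. Qed.

Section difference_quotients.
Context {R : realType}.
Implicit Types x : R.

Let h n : R := n.+1%:R^-1.
Let h_gt0 n : 0 < h n. Proof. by rewrite invr_gt0. Qed.
Let h_le1 n : h n <= 1. Proof. by rewrite invf_le1// ler1n. Qed.
Let hM_cvg0 x : h n * x @[n --> \oo] --> (0 : R).
Proof. by rewrite -(mul0r x); apply: cvgMl; exact: cvg_harmonic. Qed.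

Lemma cvg_one_cos_quotient x :
  (1 - cos (n.+1%:R^-1 * x)) / n.+1%:R^-1 ^+ 2 @[n --> \oo] --> x ^+ 2 / 2.
Proof.
apply: (@cvg_perturb _ _ (fun=> x ^+ 2 / 2) (fun n => (h n * (x ^+ 4 / 8)))).
- exact: cvg_cst.
- exact: hM_cvg0.
move=> n; have := one_cos_sub_le (h n * x); rewrite -/(h n).
have hn := h_gt0 n; have h1 := h_le1 n.
have -> : (1 - cos (h n * x)) / h n ^+ 2 - x ^+ 2 / 2 =
    (1 - cos (h n * x) - (h n * x) ^+ 2 / 2) / h n ^+ 2.
  by field; rewrite gt_eqF.
rewrite normrM normfV (gtr0_norm (exprn_gt0 _ hn)) ler_pdivrMr ?exprn_gt0//.
move=> /le_trans; apply.
have -> : h n * (x ^+ 4 / 8) * h n ^+ 2 = (x ^+ 4 / 8) * h n ^+ 3 by ring.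
have -> : (h n * x) ^+ 4 / 8 = (x ^+ 4 / 8) * h n ^+ 4 by ring.
apply: ler_wpM2l; first by rewrite divr_ge0// -[4%N]/(2 * 2)%N exprM sqr_ge0.
by rewrite [leLHS]exprS ler_piMl// exprn_ge0// ltW.
Qed.

Lemma cvg_sin_quotient x :
  sin (n.+1%:R^-1 * x) / n.+1%:R^-1 @[n --> \oo] --> x.
Proof.
apply: (@cvg_perturb _ _ (fun=> x) (fun n => (h n * (`|x| ^+ 3 / 2)))).
- exact: cvg_cst.
- exact: hM_cvg0.
move=> n; have := sin_sub_le (h n * x); rewrite -/(h n).
have hn := h_gt0 n; have h1 := h_le1 n.
have -> : sin (h n * x) / h n - x = (sin (h n * x) - h n * x) / h n.
  by field; rewrite gt_eqF.
rewrite normf_div (gtr0_norm hn) ler_pdivrMr//.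
move=> /le_trans; apply.
rewrite normrM exprMn (gtr0_norm hn).
have -> : h n * (`|x| ^+ 3 / 2) * h n = (`|x| ^+ 3 / 2) * h n ^+ 2 by ring.
have -> : h n ^+ 3 * `|x| ^+ 3 / 2 = (`|x| ^+ 3 / 2) * h n ^+ 3 by ring.
apply: ler_wpM2l; first by rewrite divr_ge0// exprn_ge0.
by rewrite [leLHS]exprS ler_piMl// exprn_ge0// ltW.
Qed.

Lemma one_cos_quotient_le n x :
  `|(1 - cos (n.+1%:R^-1 * x)) / n.+1%:R^-1 ^+ 2| <= x ^+ 2 / 2.
Proof.
have hn := h_gt0 n; rewrite -/(h n).
rewrite ger0_norm ?divr_ge0 ?one_cos_ge0 ?exprn_ge0 ?(ltW hn)//.
rewrite ler_pdivrMr ?exprn_gt0// (le_trans (one_cos_le_sqr _))//.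
by rewrite exprMn le_eqVlt; apply/orP; left; apply/eqP; ring.
Qed.

Lemma sin_quotient_le n x : `|sin (n.+1%:R^-1 * x) / n.+1%:R^-1| <= `|x|.
Proof.
have hn := h_gt0 n; rewrite -/(h n).
rewrite normf_div (gtr0_norm hn) ler_pdivrMr// (le_trans (sin_le_norm _))//.
by rewrite normrM (gtr0_norm hn) mulrC.
Qed.

End difference_quotients.

Lemma sqr_integrable_integrable d (Omega : measurableType d) (R : realType)
    (P : probability Omega R) (Y : Omega -> R) : measurable_fun setT Y ->
  P.-integrable setT (fun w => (Y w ^+ 2)%:E) -> P.-integrable setT (EFin \o Y).
Proof.
move=> mY iY.
have i1 : P.-integrable setT (EFin \o (fun w => 1 + Y w ^+ 2)).
  apply: (@integrableD _ _ _ _ _ _ (EFin \o cst 1) _ _ iY) => //.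
  by apply: (@prob_bounded_integrable _ _ _ _ _ 1) => // w; rewrite normr1.
apply: (le_integrable _ _ _ i1) => //.
  exact/measurable_EFinP.
move=> w _ /=; rewrite lee_fin [leRHS]ger0_norm ?addr_ge0 ?sqr_ge0//.
by rewrite -(real_normK (num_real (Y w))); have := normr_ge0 (Y w); nra.
Qed.

Section moments_from_exponent.
Context d (Omega : measurableType d) (R : realType) (P : probability Omega R).
Context d' (T : measurableType d') (nu : {measure set T -> \bar R}).
Variables (D : set T) (mD : measurable D) (g : T -> R) (mg : measurable_fun D g).
Variables (X : Omega -> R) (mX : measurable_fun setT X).

Definition cos_part (th : R) := \int[nu]_(z in D) (1 - cos (th * g z)).
Definition sin_part (th : R) := \int[nu]_(z in D) sin (th * g z).

(* the real and imaginary parts of the identity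
   [E e^{i th X} = exp (\int (e^{i th g} - 1) dnu)] *)
Definition has_exponent (th : R) : Prop :=
  \int[P]_w cos (th * X w) = expR (- cos_part th) * cos (sin_part th) /\
  \int[P]_w sin (th * X w) = expR (- cos_part th) * sin (sin_part th).

Hypothesis imin : nu.-integrable D (fun z => (Num.min `|g z| 1)%:E).
Hypothesis iX : P.-integrable setT (EFin \o X).
Hypothesis expX : forall n : nat, has_exponent n.+1%:R^-1.

Let h n : R := n.+1%:R^-1.
Let h_gt0 n : 0 < h n. Proof. by rewrite invr_gt0. Qed.
Let h_le1 n : h n <= 1. Proof. by rewrite invf_le1// ler1n. Qed.
Let h_cvg0 : h n @[n --> \oo] --> (0 : R).
Proof. exact: cvg_harmonic. Qed.
Let hM_cvg0 (x : R) : h n * x @[n --> \oo] --> (0 : R).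
Proof. by rewrite -(mul0r x); apply: cvgMl; exact: h_cvg0. Qed.

Let lim_sinX : (\int[P]_w sin (h n * X w)) / h n @[n --> \oo] --> \int[P]_w X w.
Proof.
have msin n : measurable_fun setT (fun w => sin (h n * X w)).
  apply: measurableT_comp; last exact: measurable_funM.
  exact: measurable_sin.
have [||||_ c] := @Rdominated_convergence _ _ _ P setT measurableT
  (fun n w => sin (h n * X w) / h n) X (fun w => `|X w|).
- by move=> n; apply: measurable_funM.
- by move=> w _; exact: cvg_sin_quotient.
- exact: (integrable_norm iX).
- by move=> n w _; exact: sin_quotient_le.
apply: cvg_trans c; apply: near_eq_cvg; apply: nearW => n.
rewrite RintegralZr//.
by apply: (@prob_bounded_integrable _ _ _ _ _ 1) => // w; exact: sin_max.
Qed.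

Let A n := cos_part (h n).
Let B n := sin_part (h n).

Let min_le_h n x : Num.min `|h n * x| 1 <= Num.min `|x| 1.
Proof.
have hn := h_gt0 n; have h1 := h_le1 n.
rewrite le_min !ge_min lexx orbT andbT normrM (gtr0_norm hn).
by rewrite ler_piMl.
Qed.

Let mcos th : measurable_fun D (fun z => 1 - cos (th * g z)).
Proof.
apply: measurable_funB => //; apply: measurableT_comp.
  exact: measurable_cos.
exact: measurable_funM.
Qed.

Let msin th : measurable_fun D (fun z => sin (th * g z)).
Proof.
apply: measurableT_comp.
  exact: measurable_sin.
exact: measurable_funM.
Qed.

Let imin2 : nu.-integrable D (EFin \o (fun z => 2 * Num.min `|g z| 1)).
Proof.
rewrite (_ : _ \o _ = (fun z => 2%:E * (Num.min `|g z| 1)%:E)%E).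
  exact: integrableZl.
by apply/funext => z /=; rewrite EFinM.
Qed.

Let icos n : nu.-integrable D (EFin \o (fun z => 1 - cos (h n * g z))).
Proof.
apply: (le_integrable _ _ _ imin2) => //; first exact/measurable_EFinP.
move=> z _ /=; rewrite lee_fin ger0_norm ?one_cos_ge0//.
rewrite ger0_norm ?mulr_ge0 ?le_min ?normr_ge0 ?ler01//.
by rewrite (le_trans (one_cos_le_min _))// ler_pM2l.
Qed.

Let isin n : nu.-integrable D (EFin \o (fun z => sin (h n * g z))).
Proof.
apply: (le_integrable _ _ _ imin) => //; first exact/measurable_EFinP.
move=> z _ /=; rewrite lee_fin.
rewrite [leRHS]ger0_norm; last by rewrite le_min normr_ge0 ler01.
exact: (le_trans (sin_le_min _)).
Qed.

Let A_ge0 n : 0 <= A n.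
Proof. by apply: Rintegral_ge0 => z _; exact: one_cos_ge0. Qed.

Let A_cvg0 : A n @[n --> \oo] --> (0 : R).
Proof.
have [||||_ c] := @Rdominated_convergence _ _ _ nu D mD
  (fun n z => 1 - cos (h n * g z)) (fun=> 0) (fun z => 2 * Num.min `|g z| 1).
- by [].
- move=> z _.
  have c : cos (h n * g z) @[n --> \oo] --> cos (0 : R).
    by apply: continuous_cvg (hM_cvg0 _); exact: continuous_cos.
  have -> : (0 : R) = 1 - cos 0 by rewrite cos0 subrr.
  exact: (cvgB (cvg_cst _) c).
- exact: imin2.
- move=> n z _; rewrite ger0_norm ?one_cos_ge0//.
  by rewrite (le_trans (one_cos_le_min _))// ler_pM2l.
by rewrite Rintegral_cst// mul0r in c.
Qed.

Let B_cvg0 : B n @[n --> \oo] --> (0 : R).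
Proof.
have [||||_ c] := @Rdominated_convergence _ _ _ nu D mD
  (fun n z => sin (h n * g z)) (fun=> 0) (fun z => Num.min `|g z| 1).
- by [].
- move=> z _.
  have c : sin (h n * g z) @[n --> \oo] --> sin (0 : R).
    by apply: continuous_cvg (hM_cvg0 _); exact: continuous_sin.
  by rewrite sin0 in c.
- exact: imin.
- by move=> n z _; exact: (le_trans (sin_le_min _)).
by rewrite Rintegral_cst// mul0r in c.
Qed.

Let B2_cvg0 k : B n ^+ 2 * k @[n --> \oo] --> (0 : R).
Proof.
rewrite -(mul0r k); apply: cvgMl; under eq_fun do rewrite expr2.
exact: (cvgM0 B_cvg0 B_cvg0).
Qed.

Let b_cvg : nu.-integrable D (EFin \o g) ->
  B n / h n @[n --> \oo] --> \int[nu]_(z in D) g z.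
Proof.
move=> ig; have [||||_ c] := @Rdominated_convergence _ _ _ nu D mD
  (fun n z => sin (h n * g z) / h n) g (fun z => `|g z|).
- by move=> n; apply: measurable_funM.
- by move=> w _; exact: cvg_sin_quotient.
- exact: (integrable_norm ig).
- by move=> n w _; exact: sin_quotient_le.
apply: cvg_trans c; apply: near_eq_cvg; apply: nearW => n.
by rewrite RintegralZr//; exact: isin.
Qed.

Let eA_cvg1 : expR (- A n) @[n --> \oo] --> (1 : R).
Proof.
rewrite -(@expR0 R) -oppr0; apply: continuous_cvg; first exact: continuous_expR.
exact: (cvgN A_cvg0).
Qed.

(** The imaginary part of the exponent identity is divided by [h n], which tends to 0. The left side
    tends to the mean of [X]; on the right the damping factor tends to 1, and sin B differs from B
    by a cubic term. *)
Lemma exponent_mean : nu.-integrable D (EFin \o g) ->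
  \int[P]_w X w = \int[nu]_(z in D) g z.
Proof.
move=> ig.
apply: (cvg_unique _ lim_sinX) => //.
have c : expR (- A n) * (sin (B n) / h n) @[n --> \oo] --> 1 * \int[nu]_(z in D) g z.
  apply: cvgM; first exact: eA_cvg1.
  apply: (@cvg_perturb _ _ (fun n => B n / h n)
    (fun n => `|B n / h n| * (`|B n| ^+ 2 / 2))).
  - exact: b_cvg ig.
  - rewrite -(mulr0 `|\int[nu]_(z in D) g z|); apply: cvgM.
      by apply: cvg_norm; exact: b_cvg ig.
    under eq_fun do rewrite real_normK ?num_real//.
    exact: B2_cvg0.
  - move=> n; have hn := h_gt0 n.
    rewrite -mulrBl !normrM normfV (gtr0_norm hn).
    have := sin_sub_le (B n) => H.
    have -> : `|B n| / h n * (`|B n| ^+ 2 / 2) = (`|B n| ^+ 3 / 2) / h n.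
      by field; rewrite gt_eqF.
    by rewrite ler_pM2r// invr_gt0.
rewrite mul1r in c; apply: cvg_trans c; apply: near_eq_cvg; apply: nearW => n.
by rewrite (expX n).2 mulrA.
Qed.

Hypothesis iX2 : P.-integrable setT (fun w => (X w ^+ 2)%:E).

Let lim_cosX : (1 - \int[P]_w cos (h n * X w)) / h n ^+ 2 @[n --> \oo] -->
  \int[P]_w (X w ^+ 2 / 2).
Proof.
have [||||_ c] := @Rdominated_convergence _ _ _ P setT measurableT
  (fun n w => (1 - cos (h n * X w)) / h n ^+ 2) (fun w => X w ^+ 2 / 2)
  (fun w => X w ^+ 2 / 2).
- move=> n; apply: measurable_funM => //; apply: measurable_funB => //.
  apply: measurableT_comp; first exact: measurable_cos.
  exact: measurable_funM.
- by move=> w _; exact: cvg_one_cos_quotient.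
- rewrite (_ : _ \o _ = (fun w => (X w ^+ 2)%:E * (2^-1)%:E)%E); last first.
    by apply/funext => w /=; rewrite EFinM.
  exact: integrableZr.
- by move=> n w _; exact: one_cos_quotient_le.
apply: cvg_trans c; apply: near_eq_cvg; apply: nearW => n.
rewrite RintegralZr//.
  rewrite RintegralB//.
  - by rewrite Rintegral_prob_cst.
  - by apply: (@prob_bounded_integrable _ _ _ _ _ 1) => // w; rewrite normr1.
  apply: (@prob_bounded_integrable _ _ _ _ _ 1) => [|w]; last exact: cos_max.
  by apply: measurableT_comp; [exact: measurable_cos|exact: measurable_funM].
apply: (@prob_bounded_integrable _ _ _ _ _ 2) => [|w]; last first.
  by rewrite ger0_norm ?one_cos_ge0// one_cos_le2.
apply: measurable_funB => //.
by apply: measurableT_comp; [exact: measurable_cos|exact: measurable_funM].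
Qed.

Let c_ n := (1 - expR (- A n) * cos (B n)) / h n ^+ 2.

Let c_cvg : c_ n @[n --> \oo] --> \int[P]_w (X w ^+ 2 / 2).
Proof.
apply: cvg_trans lim_cosX; apply: near_eq_cvg; apply: nearW => n.
by rewrite (expX n).1.
Qed.

(** Once [A n <= 1 / 2], one has 1 - e^{-A} >= A - A^2 >= A / 2, while cos B <= 1. So the quotient
    of [A n] is at most twice [c_ n], which converges because [X] has a second moment. *)
Let a_bound : \forall n \near \oo, A n / h n ^+ 2 <= 2 * (\int[P]_w (X w ^+ 2 / 2) + 1).
Proof.
near=> n.
have A1 : A n <= 1 / 2.
  by near: n; apply: (cvgr_le (0 : R)) => //; exact: A_cvg0.
have c1 : c_ n <= \int[P]_w (X w ^+ 2 / 2) + 1.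
  by near: n; apply: (cvgr_le (\int[P]_w (X w ^+ 2 / 2))) => //; rewrite ltrDl.
have hn := exprn_gt0 2 (h_gt0 n).
apply: (@le_trans _ _ (2 * c_ n)); last by rewrite ler_pM2l.
rewrite /c_ mulrA ler_pM2r ?invr_gt0//.
have h1 := one_expRN_bounds (A_ge0 n).
have h2 : expR (- A n) * cos (B n) <= expR (- A n).
  by rewrite ler_piMr ?expR_ge0// cos_le1.
move: h1; rewrite ler_norml => /andP[h1 _]; have := A_ge0 n; nra.
Unshelve. all: by end_near. Qed.

(** Fatou's lemma along [h n]: the quotients of 1 - cos tend to g^2 / 2, and [a_bound] keeps their
    integrals bounded. *)
Let ig2 : nu.-integrable D (EFin \o (fun z => g z ^+ 2 / 2)).
Proof.
apply/integrableP; split.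
  apply/measurable_EFinP/measurable_funM => //.
  exact: measurable_funX.
under eq_integral do rewrite /= ger0_norm ?divr_ge0 ?sqr_ge0//.
pose f n z := ((1 - cos (h n * g z)) / h n ^+ 2)%:E.
have f0 n z : (0 <= f n z)%E.
  by rewrite lee_fin divr_ge0 ?one_cos_ge0 ?exprn_ge0 ?ltW.
have mf n : measurable_fun D (f n).
  by apply/measurable_EFinP/measurable_funM.
have fE z : (g z ^+ 2 / 2)%:E = limn_einf (f ^~ z).
  have H : f ^~ z @ \oo --> (g z ^+ 2 / 2)%:E.
    by apply: cvg_EFin; [near=> n|exact: cvg_one_cos_quotient].
  rewrite is_cvg_limn_einfE; first exact/esym/cvg_lim.
  by apply/cvg_ex; eexists; exact: H.
under eq_integral do rewrite fE.
apply: (le_lt_trans (fatou _ mD mf (fun n z _ => f0 n z))).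
apply: (@le_lt_trans _ _ (2 * (\int[P]_w (X w ^+ 2 / 2) + 1))%:E); last exact: ltry.
have fA n : (\int[nu]_(z in D) f n z = (A n / h n ^+ 2)%:E)%E.
  rewrite /f; under eq_integral do rewrite EFinM.
  rewrite integralZr//; last exact: icos.
  rewrite EFinM /A /cos_part /Rintegral fineK//.
  by apply: integrable_fin_num => //; exact: icos.
under eq_fun do rewrite fA.
have [N _ HN] := a_bound.
rewrite limn_einf_lim; apply: lime_le.
  exact: is_cvg_einfs.
apply: nearW => n.
(* The bound holds from rank [N] on only, so the infimum over the tail is tested at rank n + N. *)
apply: (@le_trans _ _ (A (n + N)%N / h (n + N)%N ^+ 2)%:E).
  by apply: ereal_inf_lbound; exists (n + N)%N => //=; rewrite leq_addr.
by rewrite lee_fin; apply: HN => /=; rewrite leq_addl.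
Unshelve. all: by end_near. Qed.

Lemma exponent_sqr_integrable : nu.-integrable D (EFin \o (fun z => g z ^+ 2)).
Proof.
rewrite (_ : _ \o _ = (fun z => (2%:E * (g z ^+ 2 / 2)%R%:E)%E)).
  exact: (integrableZl mD _ ig2).
by apply/funext => z /=; rewrite -EFinM; congr EFin; field.
Qed.

(** |g| <= min(|g|, 1) + g^2: the small values are controlled by [imin], the large ones by the
    square. *)
Lemma exponent_integrable : nu.-integrable D (EFin \o g).
Proof.
have := integrableD mD imin exponent_sqr_integrable.
apply: le_integrable => //; first exact/measurable_EFinP.
move=> z _ /=; rewrite lee_fin [leRHS]ger0_norm; last first.
  by rewrite addr_ge0 ?sqr_ge0// le_min normr_ge0 ler01.
have [g1|g1] := lerP `|g z| 1; first by rewrite lerDl sqr_ge0.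
rewrite -(real_normK (num_real (g z))); nra.
Qed.

Let a_cvg : A n / h n ^+ 2 @[n --> \oo] --> \int[nu]_(z in D) (g z ^+ 2 / 2).
Proof.
have [||||_ c] := @Rdominated_convergence _ _ _ nu D mD
  (fun n z => (1 - cos (h n * g z)) / h n ^+ 2) (fun z => g z ^+ 2 / 2)
  (fun z => g z ^+ 2 / 2).
- by move=> n; apply: measurable_funM.
- by move=> z _; exact: cvg_one_cos_quotient.
- exact: ig2.
- by move=> n z _; exact: one_cos_quotient_le.
apply: cvg_trans c; apply: near_eq_cvg; apply: nearW => n.
by rewrite RintegralZr.
Qed.

(** Write 1 - e^{-A} cos B = (1 - e^{-A}) + e^{-A} (1 - cos B) and divide by the square of [h n]:
    the first term tends to half the integral of g^2, the second to half the square of the integral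
    of g. *)
Lemma exponent_second_moment : \int[P]_w (X w ^+ 2) =
  \int[nu]_(z in D) (g z ^+ 2) + (\int[nu]_(z in D) g z) ^+ 2.
Proof.
suff : \int[P]_w (X w ^+ 2 / 2) =
    \int[nu]_(z in D) (g z ^+ 2 / 2) + (\int[nu]_(z in D) g z) ^+ 2 / 2.
  rewrite !RintegralZr//; last exact: exponent_sqr_integrable.
  by move=> H; lra.
apply: (cvg_unique _ c_cvg) => //.
have c1 : (1 - expR (- A n)) / h n ^+ 2 @[n --> \oo] --> \int[nu]_(z in D) (g z ^+ 2 / 2).
  apply: (@cvg_perturb _ _ (fun n => A n / h n ^+ 2) (fun n => A n / h n ^+ 2 * A n)).
  - exact: a_cvg.
  - exact: (cvgM0 a_cvg A_cvg0).
  - move=> n; have hn := exprn_gt0 2 (h_gt0 n).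
    rewrite -mulrBl normf_div (gtr0_norm hn) mulrAC.
    by rewrite ler_pM2r ?invr_gt0// -expr2; exact: one_expRN_bounds.
have b2 : (B n / h n) ^+ 2 @[n --> \oo] --> (\int[nu]_(z in D) g z) ^+ 2.
  have bc := b_cvg exponent_integrable.
  by rewrite expr2; under eq_fun do rewrite expr2; exact: cvgM.
have c2 : (1 - cos (B n)) / h n ^+ 2 @[n --> \oo] --> (\int[nu]_(z in D) g z) ^+ 2 / 2.
  apply: (@cvg_perturb _ _ (fun n => (B n / h n) ^+ 2 / 2)
    (fun n => (B n / h n) ^+ 2 * (B n ^+ 2 / 8))).
  - by apply: cvgMl.
  - apply: (cvgM0 b2); exact: B2_cvg0.
  - move=> n; have hn := exprn_gt0 2 (h_gt0 n).
    have h0 := lt0r_neq0 (h_gt0 n).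
    have -> : (1 - cos (B n)) / h n ^+ 2 - (B n / h n) ^+ 2 / 2 =
       (1 - cos (B n) - B n ^+ 2 / 2) / h n ^+ 2 by field.
    have -> : (B n / h n) ^+ 2 * (B n ^+ 2 / 8) = (B n ^+ 4 / 8) / h n ^+ 2 by field.
    by rewrite normf_div (gtr0_norm hn) ler_pM2r ?invr_gt0// one_cos_sub_le.
have c3 : (1 - expR (- A n)) / h n ^+ 2 + expR (- A n) * ((1 - cos (B n)) / h n ^+ 2)
    @[n --> \oo] --> \int[nu]_(z in D) (g z ^+ 2 / 2) +
                     1 * ((\int[nu]_(z in D) g z) ^+ 2 / 2).
  by apply: cvgD; [exact: c1|exact: cvgM].
rewrite mul1r in c3; apply: cvg_trans c3; apply: near_eq_cvg; apply: nearW => n.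
by rewrite /c_ /=; ring.
Qed.

End moments_from_exponent.

(** * Riemann sums in time *)

Section uniform_grid.
Context {R : realType}.
Variables (a b : R) (ab : a <= b).
Implicit Types (n i : nat) (f : R -> R) (x : R).

Definition gridpt n i : R := a + (b - a) * (i%:R / n.+1%:R).

(** The value on a cell is the one at its left end. For [id] this is the left end itself, so on (a,
    b] [step n f] is [f] composed with [step n id], and convergence needs a proof for [id] only.
    Cells are left-open, like the intervals over which increments are taken. *)
Definition step n f x : R :=
  \sum_(i < n.+1) f (gridpt n i) * \1_(`]gridpt n i, gridpt n i.+1]%classic) x.

Lemma gridpt0 n : gridpt n 0 = a.
Proof. by rewrite /gridpt mul0r mulr0 addr0. Qed.

Lemma gridptS n : gridpt n n.+1 = b.
Proof. by rewrite /gridpt mulfV ?pnatr_eq0// mulr1 addrC subrK. Qed.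

Lemma gridpt_homo n : {homo gridpt n : i j / (i <= j)%N >-> i <= j}.
Proof.
move=> i j ij; rewrite lerD2l ler_wpM2l ?subr_ge0//.
by rewrite ler_pM2r ?invr_gt0// ler_nat.
Qed.

Lemma gridpt_ge n i : a <= gridpt n i.
Proof. by rewrite -{1}(gridpt0 n) gridpt_homo. Qed.

Lemma gridpt_le n i : (i <= n.+1)%N -> gridpt n i <= b.
Proof. by move=> i1; rewrite -[leRHS](gridptS n) gridpt_homo. Qed.

Lemma gridptB n i : gridpt n i.+1 - gridpt n i = (b - a) / n.+1%:R.
Proof. rewrite /gridpt opprD addrACA subrr add0r -mulrBr -mulrBl.
by rewrite -natrB// subSnn mul1r. Qed.

Lemma step_cell n i f x : (i < n.+1)%N -> gridpt n i < x <= gridpt n i.+1 ->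
  step n f x = f (gridpt n i).
Proof.
move=> i1 /andP[ix xi]; rewrite /step (bigD1 (Ordinal i1))//= big1 ?addr0.
  by rewrite indicE mem_set/= ?mulr1// in_itv/= ix.
move=> j ji; rewrite indicE memNset ?mulr0//= in_itv/= => /andP[jx xj].
have [ij|ij|ij] := ltngtP i j.
- by have := le_lt_trans (gridpt_homo n ij) jx; rewrite ltNge xi.
- by have := le_lt_trans (gridpt_homo n ij) ix; rewrite ltNge xj.
- by move/eqP: ji; apply; apply/val_inj.
Qed.

Lemma in_cell n x : a < x <= b ->
  exists2 i, (i < n.+1)%N & gridpt n i < x <= gridpt n i.+1.
Proof.
move=> /andP[ax xb].
have ex : exists i, x <= gridpt n i by exists n.+1; rewrite gridptS.
case: (ex_minnP ex) => -[|i] xi mini; first by rewrite gridpt0 leNgt ax in xi.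
exists i.
  by apply: mini; rewrite gridptS.
by rewrite xi andbT ltNge; apply/negP => /mini; rewrite ltnn.
Qed.

Lemma stepE n f x : a < x <= b -> step n f x = f (step n id x).
Proof. by move=> /(in_cell n)[i i1 xi]; rewrite !(step_cell _ i1). Qed.

Lemma step_id_itv n x : a < x <= b -> a <= step n id x <= b.
Proof.
move=> /(in_cell n)[i i1 xi]; rewrite (step_cell _ i1)// gridpt_ge/=.
by rewrite gridpt_le// ltnW.
Qed.

Lemma step_id_cvg x : a < x <= b -> step n id x @[n --> \oo] --> x.
Proof.
move=> xab; apply: (@cvg_perturb _ _ (fun=> x) (fun n => (b - a) * n.+1%:R^-1)).
- exact: cvg_cst.
- by rewrite -(mulr0 (b - a)); apply: cvgMr; exact: cvg_harmonic.
move=> n; have [i i1 xi] := in_cell n xab; rewrite (step_cell _ i1)//.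
rewrite -(gridptB n i) distrC ger0_norm ?subr_ge0; last by case/andP: xi => /ltW.
by case/andP: xi => _ xi; rewrite lerD2r.
Qed.

Lemma step_cvg f x : continuous f -> a < x <= b -> step n f x @[n --> \oo] --> f x.
Proof.
move=> cf xab; under eq_fun do rewrite stepE//.
by apply: continuous_cvg; [exact: cf|exact: step_id_cvg].
Qed.

Lemma measurable_step n f : measurable_fun setT (step n f).
Proof.
by apply: measurable_sum => i; apply: measurable_funM => //; exact: measurable_indic.
Qed.

End uniform_grid.

(** * Integrals over time slices *)

Section time_slices.
Context d (T : measurableType d) (R : realType) (mu : {measure set T -> \bar R}).
Variables (time : T -> R) (mtime : measurable_fun setT time).

(** The function [time] is abstract because slices are used twice: with [fst] for jump measures, and
    with the identity for Lebesgue-Stieltjes measures. *)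
Definition slice (a b : R) : set T := time @^-1` `]a, b]%classic.

Lemma measurable_slice a b : measurable (slice a b).
Proof. by rewrite -(setTI (slice a b)); exact: mtime. Qed.

Lemma slice_cat a b c : a <= b -> b <= c -> slice a c = slice a b `|` slice b c.
Proof.
move=> ab bc; apply/seteqP; split => x; rewrite /slice/= !in_itv/=.
  by move=> /andP[ax xc]; have [xb|bx] := leP (time x) b; [left; rewrite ax|right].
by case=> /andP[h1 h2]; rewrite ?h1 ?h2 ?andbT/= ?(le_trans h2)// (le_lt_trans ab).
Qed.

Lemma slice_disj a b c : [disjoint slice a b & slice b c].
Proof.
apply/disj_setPS => x []; rewrite /slice/= !in_itv/= => /andP[_ xb] /andP[bx _].
by move: bx; rewrite ltNge xb.
Qed.

Lemma Rintegral_slice_cat a b c (h : T -> R) : a <= b -> b <= c ->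
  mu.-integrable (slice a c) (EFin \o h) ->
  \int[mu]_(x in slice a c) h x =
  \int[mu]_(x in slice a b) h x + \int[mu]_(x in slice b c) h x.
Proof.
move=> ab bc; rewrite (slice_cat ab bc) => ih.
by rewrite Rintegral_setU//; [exact: measurable_slice..|exact: slice_disj].
Qed.

Lemma integrable_slice_sub a b a' b' (h : T -> \bar R) : a <= a' -> b' <= b ->
  mu.-integrable (slice a b) h -> mu.-integrable (slice a' b') h.
Proof.
move=> aa bb; apply: integrableS; [exact: measurable_slice..|].
move=> x; rewrite /slice/= !in_itv/= => /andP[h1 h2].
by rewrite (le_lt_trans aa)//= (le_trans h2).
Qed.

Lemma Rintegral_slice_sum (u : nat -> R) n (h : T -> R) :
  {homo u : i j / (i <= j)%N >-> i <= j} ->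
  mu.-integrable (slice (u 0%N) (u n)) (EFin \o h) ->
  \int[mu]_(x in slice (u 0%N) (u n)) h x =
  \sum_(i < n) \int[mu]_(x in slice (u i) (u i.+1)) h x.
Proof.
move=> hu; elim: n => [|n IH] ih.
  rewrite big_ord0 (_ : slice _ _ = set0) ?Rintegral_set0//.
  by rewrite /slice set_itv_ge ?preimage_set0//= bnd_simp ltxx.
rewrite big_ord_recr/= (@Rintegral_slice_cat _ (u n)) ?hu//.
rewrite IH//; apply: integrable_slice_sub ih => //.
exact: hu.
Qed.

Lemma Rintegral_slice_step a b n (f : R -> R) (G : R -> T -> R) : a <= b ->
  mu.-integrable (slice a b) (EFin \o (fun z => G (step a b n f (time z)) z)) ->
  \int[mu]_(z in slice a b) G (step a b n f (time z)) z =
  \sum_(i < n.+1) \int[mu]_(z in slice (gridpt a b n i) (gridpt a b n i.+1))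
    G (f (gridpt a b n i)) z.
Proof.
move=> ab ih.
have -> : slice a b = slice (gridpt a b n 0) (gridpt a b n n.+1).
  by rewrite gridpt0 gridptS.
rewrite Rintegral_slice_sum; first last.
- by rewrite gridpt0 gridptS.
- exact: gridpt_homo.
apply: eq_bigr => i _; apply: eq_Rintegral => z.
by rewrite inE /slice/= in_itv/= => zi; rewrite (step_cell ab _ (ltn_ord i)).
Qed.

Hypothesis null_times : forall u, mu (time @^-1` [set u]) = 0%E.

(** The level {time = u} is a null set, and off it the indicators of the slices are eventually
    constant along any sequence tending to [u]; dominated convergence does the rest. *)
Lemma Rintegral_slice_continuous (c : R) (h : T -> R) :
  (forall u, mu.-integrable (slice c u) (EFin \o h)) ->
  continuous (fun u => \int[mu]_(x in slice c u) h x).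
Proof.
move=> ih u; apply/continuous_withinNx/cvgr_dnbhsP => v [_ vu].
(* A common upper bound of the sequence and of [u] provides a single domain of integration. *)
have vb : exists U, (forall n, v n <= U) /\ u <= U.
  have /cvg_seq_bounded[M [_ HM]] : cvgn v by apply/cvg_ex; exists u.
  exists (Num.max (M + 1) u); split => [n|]; last by rewrite le_max lexx orbT.
  rewrite le_max; apply/orP; left; apply: (le_trans (ler_norm _)).
  by apply: HM => //; rewrite ltrDl.
have [U [vU uU]] := vb.
have E (x : R) : x <= U -> \int[mu]_(z in slice c x) h z =
    \int[mu]_(z in slice c U `\` time @^-1` [set u]) (h z * \1_(slice c x) z).
  move=> xU.
  transitivity (\int[mu]_(z in slice c U) (h z * \1_(slice c x) z)).
    rewrite (_ : slice c x = slice c U `&` slice c x); last first.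
      apply/seteqP; split => [z|z []//]; rewrite /slice/= !in_itv/= => /andP[h1 h2].
      by rewrite h1 h2 (le_trans h2).
    rewrite Rintegral_mkcondr; apply: eq_Rintegral => z zU.
    rewrite patchE indicE in_setI zU/=.
    by case: ifPn => _; rewrite ?mulr1 ?mulr0.
  rewrite /Rintegral; congr fine.
  apply: negligible_integral => //.
  - by rewrite -(setTI (_ @^-1` _)); exact: mtime.
  - exact: measurable_slice.
  - apply: (le_integrable _ _ _ (ih U)); first exact: measurable_slice.
      apply/measurable_EFinP/measurable_funM; last exact/measurable_funTS/measurable_indic/measurable_slice.
      by apply/measurable_EFinP; exact: (measurable_int _ (ih U)).
    move=> z _ /=; rewrite lee_fin normrM ler_piMr// indicE.
    by case: (_ \in _); rewrite ?normr1 ?normr0 ?ler01.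
rewrite (E u uU); under eq_fun do rewrite (E _ (vU _)).
have mD : measurable (slice c U `\` time @^-1` [set u]).
  apply: measurableD; first exact: measurable_slice.
  by rewrite -(setTI (_ @^-1` _)); exact: mtime.
have ihD : mu.-integrable (slice c U `\` time @^-1` [set u]) (EFin \o h).
  by apply: integrableS (ih U) => //; exact: measurable_slice.
have [||||_ //] := @Rdominated_convergence _ _ _ mu _ mD
   (fun n z => h z * \1_(slice c (v n)) z) (fun z => h z * \1_(slice c u) z)
   (fun z => `|h z|).
- move=> n; apply: measurable_funM; last exact/measurable_funTS/measurable_indic/measurable_slice.
  by apply/measurable_EFinP; exact: (measurable_int _ ihD).
- move=> z [zU zu]; apply: cvgMr.
  apply: cvg_near_cst.
  have [zu'|uz|/zu//] := ltgtP (time z) u.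
    have : \forall n \near \oo, time z < v n by apply: (cvgr_gt u).
    apply: filterS => n zn; rewrite !indicE.
    suff -> : (z \in slice c (v n)) = (z \in slice c u) by [].
    by apply/idP/idP; rewrite !inE /slice/= !in_itv/= => /andP[-> _]/=; rewrite ltW.
  have : \forall n \near \oo, v n < time z by apply: (cvgr_lt u).
  apply: filterS => n zn; rewrite !indicE.
  suff -> : (z \in slice c (v n)) = (z \in slice c u) by [].
  by apply/idP/idP; rewrite !inE /slice/= !in_itv/= => /andP[_]; rewrite leNgt ?zn ?uz.
- exact: (integrable_norm ihD).
- move=> n z _; rewrite normrM ler_piMr// indicE.
  by case: (_ \in _); rewrite ?normr1 ?normr0 ?ler01.
Qed.

End time_slices.

(** * Increments of additive processes *)

Section characteristic_pairs.
Context d (Omega : measurableType d) (R : realType) (P : probability Omega R).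

(* [E e^{iX} = e^{-a + ib}], in real and imaginary parts *)
Definition char_pair (X : Omega -> R) (a b : R) : Prop :=
  \int[P]_w cos (X w) = expR (- a) * cos b /\
  \int[P]_w sin (X w) = expR (- a) * sin b.

Lemma prob_integrable_cos (X : Omega -> R) : measurable_fun setT X ->
  P.-integrable setT (EFin \o (fun w => cos (X w))).
Proof.
move=> mX; apply: (@prob_bounded_integrable _ _ _ _ _ 1) => [|w]; last exact: cos_max.
by apply: measurableT_comp => //; exact: measurable_cos.
Qed.

Lemma prob_integrable_sin (X : Omega -> R) : measurable_fun setT X ->
  P.-integrable setT (EFin \o (fun w => sin (X w))).
Proof.
move=> mX; apply: (@prob_bounded_integrable _ _ _ _ _ 1) => [|w]; last exact: sin_max.
by apply: measurableT_comp => //; exact: measurable_sin.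
Qed.

Lemma ae_eq_Rintegral (X Y : Omega -> R) :
  measurable_fun setT X -> measurable_fun setT Y ->
  {ae P, forall w, X w = Y w} -> \int[P]_w X w = \int[P]_w Y w.
Proof.
move=> mX mY XY; rewrite /Rintegral; congr fine; apply: ae_eq_integral => //.
- exact/measurable_EFinP.
- exact/measurable_EFinP.
- by apply: filterS XY => w /= -> _.
Qed.

Lemma char_pair_ae (X Y : Omega -> R) a b :
  measurable_fun setT X -> measurable_fun setT Y ->
  {ae P, forall w, X w = Y w} -> char_pair X a b -> char_pair Y a b.
Proof.
move=> mX mY XY [h1 h2]; split.
- rewrite -h1; apply: ae_eq_Rintegral.
  + exact: (measurableT_comp (@measurable_cos R)).
  + exact: (measurableT_comp (@measurable_cos R)).
  + by apply: filterS XY => w ->.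
- rewrite -h2; apply: ae_eq_Rintegral.
  + exact: (measurableT_comp (@measurable_sin R)).
  + exact: (measurableT_comp (@measurable_sin R)).
  + by apply: filterS XY => w ->.
Qed.

Variables E F : set (set Omega).
Hypotheses (mE : E `<=` measurable) (mF : F `<=` measurable).
Hypothesis EF : independent P <<s E >> <<s F >>.
Variables X Y : Omega -> R.
Hypothesis mX : measurable_fun setT (X : g_sigma_algebraType E -> R).
Hypothesis mY : measurable_fun setT (Y : g_sigma_algebraType F -> R).

Let mcX : measurable_fun setT ((fun w => cos (X w)) : g_sigma_algebraType E -> R).
Proof. exact: (measurableT_comp (@measurable_cos R)). Qed.
Let msX : measurable_fun setT ((fun w => sin (X w)) : g_sigma_algebraType E -> R).
Proof. exact: (measurableT_comp (@measurable_sin R)). Qed.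
Let mcY : measurable_fun setT ((fun w => cos (Y w)) : g_sigma_algebraType F -> R).
Proof. exact: (measurableT_comp (@measurable_cos R)). Qed.
Let msY : measurable_fun setT ((fun w => sin (Y w)) : g_sigma_algebraType F -> R).
Proof. exact: (measurableT_comp (@measurable_sin R)). Qed.
Let mX' : measurable_fun setT X.
Proof. exact: (measurableT_comp mX (measurable_sub_id mE)). Qed.
Let mY' : measurable_fun setT Y.
Proof. exact: (measurableT_comp mY (measurable_sub_id mF)). Qed.

Let icX := prob_integrable_cos mX'.
Let isX := prob_integrable_sin mX'.
Let icY := prob_integrable_cos mY'.
Let isY := prob_integrable_sin mY'.

Lemma Rintegral_cosD : \int[P]_w cos (X w + Y w) =
  (\int[P]_w cos (X w)) * (\int[P]_w cos (Y w)) -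
  (\int[P]_w sin (X w)) * (\int[P]_w sin (Y w)).
Proof.
have [i1 e1] := indep_RintegralM mE mF EF mcX mcY icX icY.
have [i2 e2] := indep_RintegralM mE mF EF msX msY isX isY.
by under eq_Rintegral do rewrite cosD; rewrite RintegralB// e1 e2.
Qed.

Lemma Rintegral_sinD : \int[P]_w sin (X w + Y w) =
  (\int[P]_w sin (X w)) * (\int[P]_w cos (Y w)) +
  (\int[P]_w cos (X w)) * (\int[P]_w sin (Y w)).
Proof.
have [i1 e1] := indep_RintegralM mE mF EF msX mcY isX icY.
have [i2 e2] := indep_RintegralM mE mF EF mcX msY icX isY.
by under eq_Rintegral do rewrite sinD; rewrite RintegralD// e1 e2.
Qed.

Lemma char_pairD a b a' b' : char_pair X a b -> char_pair Y a' b' ->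
  char_pair (fun w => X w + Y w) (a + a') (b + b').
Proof.
move=> [cX sX] [cY sY]; split; rewrite ?(Rintegral_cosD, Rintegral_sinD) cX sX cY sY.
  by rewrite opprD expRD cosD; ring.
by rewrite opprD expRD sinD; ring.
Qed.

(** The characteristic function of [X] has no zero, so that of [Y] is a quotient. In real terms a
    rotation by [b] is inverted, by inserting cos^2 b + sin^2 b = 1 and cancelling e^{-a}. *)
Lemma char_pair_cancel a b a' b' : char_pair X a b ->
  char_pair (fun w => X w + Y w) a' b' -> char_pair Y (a' - a) (b' - b).
Proof.
move=> [cX sX] [cXY sXY]; rewrite Rintegral_cosD cX sX in cXY.
rewrite Rintegral_sinD cX sX in sXY.
set c := \int[P]_w cos (Y w) in cXY sXY *; set s := \int[P]_w sin (Y w) in cXY sXY *.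
have ea := expR_gt0 (- a).
have cs := cos2Dsin2 b.
have H : expR (- (a' - a)) * expR (- a) = expR (- a').
  by rewrite -expRD; congr expR; ring.
have cE : expR (- a) * c = expR (- a) * (expR (- (a' - a)) * cos (b' - b)).
  rewrite [RHS]mulrA [expR (- a) * expR _]mulrC H cosB.
  have -> : expR (- a) * c = (cos b ^+ 2 + sin b ^+ 2) * (expR (- a) * c).
    by rewrite cs mul1r.
  have -> : (cos b ^+ 2 + sin b ^+ 2) * (expR (- a) * c) =
    cos b * (expR (- a) * cos b * c - expR (- a) * sin b * s) +
    sin b * (expR (- a) * sin b * c + expR (- a) * cos b * s) by ring.
  by rewrite cXY sXY; ring.
have sE : expR (- a) * s = expR (- a) * (expR (- (a' - a)) * sin (b' - b)).
  rewrite [RHS]mulrA [expR (- a) * expR _]mulrC H sinB.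
  have -> : expR (- a) * s = (cos b ^+ 2 + sin b ^+ 2) * (expR (- a) * s).
    by rewrite cs mul1r.
  have -> : (cos b ^+ 2 + sin b ^+ 2) * (expR (- a) * s) =
    cos b * (expR (- a) * sin b * c + expR (- a) * cos b * s) -
    sin b * (expR (- a) * cos b * c - expR (- a) * sin b * s) by ring.
  by rewrite cXY sXY; ring.
by split; [apply: (mulfI _ cE)|apply: (mulfI _ sE)]; rewrite gt_eqF.
Qed.

End characteristic_pairs.

Section additive_exponents.
Context d (Omega : measurableType d) (R : realType) (P : probability Omega R).
Variables (V : R -> Omega -> R) (rho : {measure set (R * R) -> \bar R}).
Hypothesis addV : additive_process P V rho.

Let mV u : measurable_fun setT (V u). Proof. by case: addV. Qed.

Let jm : jump_measure rho. Proof. by case: addV => ? ? ? ? []. Qed.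

Definition strip (a b : R) : set (R * R) := slice fst a b.

Lemma measurable_strip (a b : R) : measurable (strip a b).
Proof. exact: measurable_slice. Qed.

Lemma strip_setX (a b : R) : `]a, b] `*` setT = strip a b :> set (R * R).
Proof. by apply/seteqP; split => z //= []. Qed.

Lemma jump_null_time (u : R) : rho (fst @^-1` [set u]) = 0%E.
Proof.
case: jm => _ _ /(_ u) <- _; congr (rho _).
by apply/seteqP; split => z //= [].
Qed.

Lemma integrable_min_jump (a b : R) : 0 <= a ->
  rho.-integrable (strip a b) (fun z => (Num.min `|z.2| 1)%:E).
Proof.
move=> a0.
have m2 (D : set (R * R)) : measurable_fun D (fun z : R * R => Num.min `|z.2| 1).
  apply: measurable_funTS; apply: measurable_minr => //.
  by apply: measurableT_comp => //; exact: measurable_snd.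
have [b0|b0] := leP 0 b; last first.
  rewrite (_ : strip a b = set0); first exact: integrable_set0.
  rewrite /strip /slice set_itv_ge ?preimage_set0//= bnd_simp -leNgt ltW//.
  by rewrite (lt_le_trans b0).
apply: (@integrable_slice_sub _ _ _ _ fst _ 0 b) => //.
apply/integrableP; split; first exact/measurable_EFinP.
case: jm => _ _ _ /(_ b b0); rewrite strip_setX; apply: le_lt_trans.
rewrite le_eqVlt; apply/orP; left; apply/eqP.
apply: eq_integral => z _ /=; rewrite ger0_norm// le_min normr_ge0 ler01//.
Qed.

Let mcos_snd (D : set (R * R)) (c : R) :
  measurable_fun D (fun z : R * R => 1 - cos (c * z.2)).
Proof.
apply: measurable_funTS; apply: measurable_funB => //.
apply: (measurableT_comp (@measurable_cos R)).
by apply: measurable_funM => //; exact: measurable_snd.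
Qed.

Let msin_snd (D : set (R * R)) (c : R) :
  measurable_fun D (fun z : R * R => sin (c * z.2)).
Proof.
apply: measurable_funTS; apply: (measurableT_comp (@measurable_sin R)).
by apply: measurable_funM => //; exact: measurable_snd.
Qed.

Lemma min_scale (c x : R) : Num.min `|c * x| 1 <= (`|c| + 1) * Num.min `|x| 1.
Proof.
have c0 := normr_ge0 c; have x0 := normr_ge0 x.
rewrite normrM.
have [x1|x1] := lerP `|x| 1.
  apply: (@le_trans _ _ (`|c| * `|x|)); first by rewrite ge_min lexx.
  by rewrite ler_wpM2r// lerDl.
apply: (@le_trans _ _ 1); first by rewrite ge_min lexx orbT.
by rewrite mulr1 lerDr.
Qed.

Lemma integrable_cos_jump (a b c : R) : 0 <= a ->
  rho.-integrable (strip a b) (EFin \o (fun z => 1 - cos (c * z.2))).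
Proof.
move=> a0.
have := integrableZl (measurable_strip a b) (2 * (`|c| + 1)) (integrable_min_jump b a0).
apply: le_integrable; [exact: measurable_strip|exact/measurable_EFinP|].
move=> z _ /=; rewrite lee_fin ger0_norm ?one_cos_ge0//.
rewrite ger0_norm; last by rewrite !mulr_ge0 ?addr_ge0// le_min normr_ge0 ler01.
by rewrite -mulrA (le_trans (one_cos_le_min _))// ler_pM2l// min_scale.
Qed.

Lemma integrable_sin_jump (a b c : R) : 0 <= a ->
  rho.-integrable (strip a b) (EFin \o (fun z => sin (c * z.2))).
Proof.
move=> a0.
have := integrableZl (measurable_strip a b) (`|c| + 1) (integrable_min_jump b a0).
apply: le_integrable; [exact: measurable_strip|exact/measurable_EFinP|].
move=> z _ /=; rewrite lee_fin.
rewrite [leRHS]ger0_norm; last by rewrite mulr_ge0 ?addr_ge0// le_min normr_ge0 ler01.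
by rewrite (le_trans (sin_le_min _))// min_scale.
Qed.

Lemma additive_char_pair0 (u c : R) : 0 <= u -> char_pair P (fun w => c * V u w)
  (\int[rho]_(z in strip 0 u) (1 - cos (c * z.2)))
  (\int[rho]_(z in strip 0 u) sin (c * z.2)).
Proof.
move=> u0; case: addV => _ _ _ _ [_ /(_ u c u0)].
rewrite /char_fun /cintegral strip_setX /cexp/=.
under eq_Rintegral do rewrite expR0 mul1r.
under [X in Complex _ X]eq_Rintegral do rewrite expR0 mul1r.
have -> : \int[rho]_(x in strip 0 u)
    complex.Re (Complex (expR 0 * cos (c * x.2)) (expR 0 * sin (c * x.2)) - 1) =
    - \int[rho]_(z in strip 0 u) (1 - cos (c * z.2)).
  rewrite -[RHS]mulN1r -RintegralZl; first last.
  - exact: integrable_cos_jump.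
  - exact: measurable_strip.
  by apply: eq_Rintegral => z _ /=; rewrite expR0; ring.
have -> : \int[rho]_(x in strip 0 u)
    complex.Im (Complex (expR 0 * cos (c * x.2)) (expR 0 * sin (c * x.2)) - 1) =
    \int[rho]_(z in strip 0 u) sin (c * z.2).
  by apply: eq_Rintegral => z _ /=; rewrite expR0; ring.
by move=> [h1 h2]; split.
Qed.

Let past (s : R) := gen `[0, s] (fun v => V v \- V 0).
Let future (s : R) := gen `[s, +oo[ (fun v => V v \- V s).

Let mpast s : past s `<=` measurable.
Proof. by apply: gen_measurable => v _; exact: measurable_funB. Qed.
Let mfuture s : future s `<=` measurable.
Proof. by apply: gen_measurable => v _; exact: measurable_funB. Qed.
Let split s : 0 <= s -> independent P <<s past s >> <<s future s >>.
Proof.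
move=> s0; apply: independent_increments_split => //.
by case: addV => _ _ _ [].
Qed.

Lemma additive_at0 : {ae P, forall w, V 0 w = 0}.
Proof. by case: addV => _ /(_ 0 (lexx _)). Qed.

Let char0 (u c : R) : 0 <= u -> char_pair P (fun w => c * (V u w - V 0 w))
  (\int[rho]_(z in strip 0 u) (1 - cos (c * z.2)))
  (\int[rho]_(z in strip 0 u) sin (c * z.2)).
Proof.
move=> u0; apply: char_pair_ae (additive_char_pair0 c u0).
- exact: measurable_funM.
- by apply: measurable_funM => //; exact: measurable_funB.
- by apply: filterS additive_at0 => w ->; rewrite subr0.
Qed.

(** The definition of an additive process gives only the characteristic functions of the variables
    [V u]. That of an increment follows by cancelling the independent increment over (0, a] from the
    one over (0, b]; the exponents are additive over strips. *)
Lemma additive_char_pair (a b c : R) : 0 <= a -> a <= b ->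
  char_pair P (fun w => c * (V b w - V a w))
  (\int[rho]_(z in strip a b) (1 - cos (c * z.2)))
  (\int[rho]_(z in strip a b) sin (c * z.2)).
Proof.
move=> a0 ab; have b0 := le_trans a0 ab.
have e1 : \int[rho]_(z in strip 0 b) (1 - cos (c * z.2)) =
    \int[rho]_(z in strip 0 a) (1 - cos (c * z.2)) +
    \int[rho]_(z in strip a b) (1 - cos (c * z.2)).
  by apply: Rintegral_slice_cat => //; exact: integrable_cos_jump.
have e2 : \int[rho]_(z in strip 0 b) sin (c * z.2) =
    \int[rho]_(z in strip 0 a) sin (c * z.2) +
    \int[rho]_(z in strip a b) sin (c * z.2).
  by apply: Rintegral_slice_cat => //; exact: integrable_sin_jump.
have ca := char0 c a0.
have cb := char0 c b0.
rewrite e1 e2 in cb.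
have := @char_pair_cancel _ _ _ P _ _ (@mpast a) (@mfuture a) (split a0)
  (fun w => c * (V a w - V 0 w)) (fun w => c * (V b w - V a w)) _ _ _ _ _ _ ca.
rewrite -[X in char_pair P (fun w => c * (V b w - V a w)) X _](addrK
   (\int[rho]_(z in strip 0 a) (1 - cos (c * z.2)))).
rewrite -[X in char_pair P (fun w => c * (V b w - V a w)) _ X](addrK
   (\int[rho]_(z in strip 0 a) sin (c * z.2))).
rewrite [\int[rho]_(z in strip a b) (1 - cos (c * z.2)) + _]addrC.
rewrite [\int[rho]_(z in strip a b) sin (c * z.2) + _]addrC.
apply.
- apply: measurable_funM => //.
  by apply: (measurable_gen (i := a)); rewrite /= in_itv/= a0 lexx.
- apply: measurable_funM => //.
  by apply: (measurable_gen (i := b)); rewrite /= in_itv/= ab.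
have -> : (fun w => c * (V a w - V 0 w) + c * (V b w - V a w)) =
  (fun w => c * (V b w - V 0 w)) by apply/funext => w; ring.
exact: cb.
Qed.

(** Induction on [n]: the last increment is independent of the past of its left end. With [c i] the
    value of a function at the i-th grid point, this is the law of a Riemann sum against [V]. *)
Lemma additive_sum_char_pair (u c : nat -> R) n : 0 <= u 0%N ->
  {homo u : i j / (i <= j)%N >-> i <= j} ->
  char_pair P (fun w => \sum_(i < n) c i * (V (u i.+1) w - V (u i) w))
    (\sum_(i < n) \int[rho]_(z in strip (u i) (u i.+1)) (1 - cos (c i * z.2)))
    (\sum_(i < n) \int[rho]_(z in strip (u i) (u i.+1)) sin (c i * z.2)).
Proof.
move=> u0 hu; have u0i i : 0 <= u i by apply: (le_trans u0); exact: hu.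
elim: n => [|n IH].
  rewrite !big_ord0 /char_pair oppr0 expR0 cos0 sin0 !mul1r.
  split; [rewrite -[RHS](Rintegral_prob_cst P 1)|rewrite -[RHS](Rintegral_prob_cst P 0)];
    by apply: eq_Rintegral => w _; rewrite big_ord0 ?cos0 ?sin0.
rewrite !big_ord_recr/=.
have -> : (fun w => \sum_(i < n.+1) c i * (V (u i.+1) w - V (u i) w)) =
  (fun w => \sum_(i < n) c i * (V (u i.+1) w - V (u i) w) +
            c n * (V (u n.+1) w - V (u n) w)).
  by apply/funext => w; rewrite big_ord_recr.
apply: (char_pairD (@mpast (u n)) (@mfuture (u n)) (split (u0i n))) => //.
- apply: measurable_sum => i; apply: measurable_funM => //.
  have -> : (fun w => V (u i.+1) w - V (u i) w) =
    (fun w => (V (u i.+1) w - V 0 w) - (V (u i) w - V 0 w)).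
    by apply/funext => w; ring.
  apply: measurable_funB; (apply: measurable_gen; rewrite /= in_itv/= u0i/= hu//).
  by rewrite ltnW.
- apply: measurable_funM => //.
  by apply: (measurable_gen (i := u n.+1)); rewrite /= in_itv/= hu.
- by apply: additive_char_pair => //; exact: hu.
Qed.

End additive_exponents.

(** * Bounding the first absolute moment of the jump measure *)

Section abs_kernel.
Context {R : realType}.
Notation leb := (@lebesgue_measure R).

(* [\int (1 - cos (e^y w)) e^{-y} dy = kernel_cst * |w|]: the substitution
   [y := y - ln |w|] makes this a translation, and it writes [|w|] as a mixture
   of the functions [1 - cos (th w)]. *)
Definition abs_kernel (w y : R) : R := (1 - cos (expR y * w)) * expR (- y).

Definition kernel_cst : \bar R := (\int[leb]_y (abs_kernel 1 y)%:E)%E.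

Lemma abs_kernel_ge0 w y : 0 <= abs_kernel w y.
Proof. by rewrite mulr_ge0 ?one_cos_ge0 ?expR_ge0. Qed.

Lemma continuous_abs_kernel w : continuous (abs_kernel w).
Proof.
move=> y; apply: cvgM.
  apply: cvgB; first exact: cvg_cst.
  apply: continuous_comp; last exact: continuous_cos.
  by apply: cvgMl; exact: continuous_expR.
apply: continuous_comp; last exact: continuous_expR.
exact: opp_continuous.
Qed.

Lemma measurable_abs_kernel d (T : measurableType d) (D : set T) (f g : T -> R) :
  measurable_fun D f -> measurable_fun D g ->
  measurable_fun D (fun z => abs_kernel (f z) (g z)).
Proof.
move=> mf mg; apply: measurable_funM.
  apply: measurable_funB => //; apply: (measurableT_comp (@measurable_cos R)).
  by apply: measurable_funM => //; apply: measurableT_comp => //.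
by apply: measurableT_comp => //; exact: measurableT_comp.
Qed.

Lemma integral_abs_kernel w :
  (\int[leb]_y (abs_kernel w y)%:E = `|w|%:E * kernel_cst)%E.
Proof.
wlog w0 : w / 0 < w => [H|].
  have [|w0|->] := ltgtP w 0; [move=> w0|exact: H|].
    rewrite -normrN -H ?oppr_gt0//; apply: eq_integral => y _.
    by rewrite /abs_kernel mulrN cosN.
  rewrite normr0 mul0e integral0_eq// => y _.
  by rewrite /abs_kernel mulr0 cos0 subrr mul0r.
have D (x : R) : is_derive x 1 (fun y : R => y + ln w) 1.
  by rewrite -[X in is_derive _ _ _ X]addr0; apply: is_deriveD.
have D1 : derive1 (fun y : R => y + ln w) = cst 1.
  by apply/funext => x; rewrite derive1E; have := D x => /@derive_val.
rewrite /kernel_cst.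
rewrite (@increasing_ge0_integration_by_substitutionT R (fun y => y + ln w) (abs_kernel 1)).
- rewrite (_ : ((_ \o _) * _) = (fun y => abs_kernel 1 (y + ln w))); last first.
    by apply/funext => y; rewrite D1 /= [LHS]mulr1.
  rewrite -ge0_integralZl//=; last 2 first.
  - by apply/measurable_EFinP/measurable_abs_kernel => //; exact: measurable_funD.
  - by move=> y _; rewrite lee_fin abs_kernel_ge0.
  apply: eq_integral => y _ /=; rewrite /abs_kernel /= !mulr1 expRD lnK ?posrE//.
  rewrite opprD expRD [expR (- ln w)]expRN lnK ?posrE//.
  rewrite gtr0_norm// -EFinM; congr EFin.
  by field; rewrite gt_eqF.
- by move=> x y; rewrite ltrD2r.
- by rewrite D1; exact: cst_continuous.
- by rewrite D1; exact: is_cvg_cst.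
- by rewrite D1; exact: is_cvg_cst.
- by move=> x; apply: ex_derive.
- apply/cvgrNyPle => A; near=> x; rewrite -lerBrDr; near: x.
  exact: nbhs_ninfty_le (num_real _).
- apply/cvgryPge => A; near=> x; rewrite -lerBlDr; near: x.
  exact: nbhs_pinfty_ge (num_real _).
- exact: continuous_abs_kernel.
- exact: abs_kernel_ge0.
Unshelve. all: by end_near. Qed.

Lemma kernel_cst_gt0 : (0 < kernel_cst)%E.
Proof.
(* For 0 <= x <= 1, 1 - cos x >= x^2 / 2 - x^4 / 8 >= 3 x^2 / 8. With x = e^y and the weight e^{-y}
   this leaves 3 e^y / 8, which is at least [c] on [-1, 0]. *)
pose c : R := 3 / 8 * expR (- 1).
have c0 : 0 < c by rewrite mulr_gt0 ?expR_gt0// divr_gt0.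
apply: (@lt_le_trans _ _ c%:E); first by rewrite lte_fin.
have : (\int[leb]_(y in `[(-1)%R, 0%R]) c%:E <= kernel_cst)%E.
  apply: (@le_trans _ _ (\int[leb]_(y in `[(-1)%R, 0%R]) (abs_kernel 1 y)%:E)%E).
    apply: ge0_le_integral => //.
    - by move=> y _; rewrite lee_fin ltW.
    - by apply/measurable_EFinP/measurable_abs_kernel.
    move=> y; rewrite /= in_itv/= => /andP[y1 y0]; rewrite lee_fin /abs_kernel mulr1.
    have u0 := expR_gt0 y.
    have u1 : expR y <= 1 by rewrite -(@expR0 R) ler_expR.
    have u2 : expR (- 1) <= expR y by rewrite ler_expR.
    rewrite expRN ler_pdivlMr//.
    have := one_cos_sub_le (expR y); rewrite ler_norml => /andP[H _].
    have h2 : expR y ^+ 2 * (3 / 8) <= 1 - cos (expR y).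
      have : expR y ^+ 4 <= expR y ^+ 2.
        rewrite (_ : 4%N = (2 + 2)%N)// exprD ler_piMr ?exprn_ge0 ?expR_ge0//.
        by rewrite expr2 mulr_ile1 ?expR_ge0.
      by lra.
    apply: le_trans h2; have := ler_wpM2r (ltW u0) u2.
    by rewrite /c expr2; lra.
  apply: ge0_subset_integral => //.
    by apply/measurable_EFinP/measurable_abs_kernel.
  by move=> y _; rewrite lee_fin abs_kernel_ge0.
rewrite integral_cst//= lebesgue_measure_itv/= lte_fin ltrN10 -EFinD.
by rewrite sub0r opprK -EFinM mulr1.
Qed.

Lemma kernel_cst_lty : (kernel_cst < +oo)%E.
Proof.
have expint : (\int[leb]_(y in `[0%R, +oo[) (expR (- y))%:E = 1)%E.
  have := @integral_exponential_pdf R 1 ltr01; rewrite /exponential_pdf => <-.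
  rewrite integral_mkcond; apply: eq_integral => y _ /=.
  by rewrite restrict_EFin/= !patchE; case: ifP => // _; rewrite mul1r mulN1r.
(* For y >= 0 the bound 1 - cos <= 2 is used; for y < 0 the bound 1 - cos x <= x^2 / 2 at x = e^y,
   which the weight e^{-y} turns into e^y / 2. *)
pose g (y : R) := 2 * expR (- `|y|).
have cg : continuous g.
  move=> y; apply: cvgMr; apply: continuous_comp; last exact: continuous_expR.
  by apply: continuous_comp; [exact: norm_continuous|exact: opp_continuous].
have g0 y : 0 <= g y by rewrite mulr_ge0 ?expR_ge0.
have kg (y : R) : abs_kernel 1 y <= g y.
  rewrite /abs_kernel /g mulr1; have [y0|y0] := lerP 0 y.
    by rewrite ger0_norm// ler_pM2r ?expR_gt0// one_cos_le2.
  rewrite ltr0_norm// opprK expRN ler_pdivrMr ?expR_gt0//.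
  by have := one_cos_le_sqr (expR y); have := sqr_ge0 (expR y); lra.
apply: (@le_lt_trans _ _ (\int[leb]_y (g y)%:E)%E).
  apply: ge0_le_integral => //.
  - by move=> y _; rewrite lee_fin abs_kernel_ge0.
  - by apply/measurable_EFinP/measurable_abs_kernel.
  - by apply/measurable_EFinP; exact: (continuous_measurable_fun cg).
  by move=> y _; rewrite lee_fin; exact: kg.
rewrite ge0_symfun_integralT//; last by move=> y; rewrite /g /= normrN.
have -> : (\int[leb]_(x in [set x | (0 <= x)%R]) (g x)%:E = 2%:E)%E.
  rewrite -set_itvcy -[RHS]mule1 -expint -ge0_integralZl//.
  - apply: eq_integral => y; rewrite inE/= in_itv/= andbT => y0.
    by rewrite /g ger0_norm// EFinM.
  - apply/measurable_EFinP/measurable_funTS; apply: continuous_measurable_fun => y.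
    by apply: continuous_comp; [exact: opp_continuous|exact: continuous_expR].
by rewrite -EFinM ltry.
Qed.

End abs_kernel.

Section mean_lower_bound.
Context d (Omega : measurableType d) (R : realType) (P : probability Omega R).
Context d' (T : measurableType d').
Notation leb := (@lebesgue_measure R).
Local Open Scope ereal_scope.

(* Superposing [1 - cos (th X_i)] with the weights of [abs_kernel] recovers
   [|X_i|], while [1 - E cos (th X_i) >= 1 - e^{-A_i}], which sums up to the full
   exponent as the pieces get small. *)
Lemma exponent_abs_mean_le (nu : {sigma_finite_measure set T -> \bar R})
    (g : T -> R) (X : Omega -> R) (Xi : nat -> nat -> Omega -> R)
    (A : nat -> nat -> R -> R) :
  measurable_fun setT g ->
  (forall n i, measurable_fun setT (Xi n i)) -> (forall n i w, (0 <= Xi n i w)%R) ->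
  (forall n w, X w = \sum_(i < n.+1) Xi n i w)%R ->
  (forall n i th, \int[P]_w cos (th * Xi n i w) <= expR (- A n i th))%R ->
  (forall th, (\sum_(i < n.+1) (1 - expR (- A n i th)))%:E @[n --> \oo] -->
     \int[nu]_z (1 - cos (th * g z))%:E) ->
  \int[nu]_z `|g z|%:E <= \int[P]_w (X w)%:E.
Proof.
move=> mg mXi Xi0 XE cosX limA.
pose h n (w : Omega) (y : R) := (\sum_(i < n.+1) abs_kernel (Xi n i w) y)%R.
have h0 n w y : (0 <= h n w y)%R by apply: sumr_ge0 => i _; exact: abs_kernel_ge0.
pose a (y : R) := \int[nu]_z (abs_kernel (g z) y)%:E.
pose Phi n (y : R) := \int[P]_w (h n w y)%:E.
have mXiw n : measurable_fun setT (fun z : Omega * R => (h n z.1 z.2)%:E).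
  apply/measurable_EFinP; apply: measurable_sum => i.
  apply: measurable_abs_kernel; last exact: measurable_snd.
  exact: (measurableT_comp (mXi n i) measurable_fst).
have mPhi n : measurable_fun setT (Phi n).
  apply: (@measurable_fun_fubini_tonelli_G _ _ _ _ R P (fun z => (h n z.1 z.2)%:E)) => //.
  by move=> z; rewrite lee_fin.
(* The value is the same for all [n]: the [Xi n i] are nonnegative, so their absolute values add up
   to [X]. *)
have PhiE n : \int[leb]_y Phi n y = kernel_cst * \int[P]_w (X w)%:E.
  rewrite /Phi -(@fubini_tonelli _ _ _ _ R P leb (fun z => (h n z.1 z.2)%:E))//=; last 2 first.
  - exact: mXiw.
  - by move=> z; rewrite lee_fin.
  rewrite muleC -ge0_integralZr//; last 3 first.
  - apply/measurable_EFinP; rewrite (_ : X = fun w => \sum_(i < n.+1) Xi n i w)%R.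
      by apply: measurable_sum => i.
    by apply/funext => w.
  - by move=> w _; rewrite (XE n) lee_fin; apply: sumr_ge0.
  - exact/ltW/kernel_cst_gt0.
  apply: eq_integral => w _; rewrite /h.
  under eq_integral do rewrite -sumEFin.
  rewrite ge0_integral_sum//; last 2 first.
  - by move=> i; apply/measurable_EFinP/measurable_abs_kernel.
  - by move=> i y _; rewrite lee_fin abs_kernel_ge0.
  under eq_bigr do rewrite integral_abs_kernel ger0_norm//.
  by rewrite -ge0_sume_distrl// ?sumEFin ?(XE n)// => i _; rewrite lee_fin.
have mgy : measurable_fun setT (fun z : T * R => (abs_kernel (g z.1) z.2)%:E).
  apply/measurable_EFinP/measurable_abs_kernel; last exact: measurable_snd.
  exact: (measurableT_comp mg measurable_fst).
have aE : \int[leb]_y a y = kernel_cst * \int[nu]_z `|g z|%:E.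
  rewrite /a -(@fubini_tonelli _ _ _ _ R nu leb (fun z => (abs_kernel (g z.1) z.2)%:E))//=; last first.
    by move=> z; rewrite lee_fin abs_kernel_ge0.
  under eq_integral do rewrite integral_abs_kernel.
  rewrite ge0_integralZr// 1?muleC//.
  - by apply/measurable_EFinP; exact: measurableT_comp.
  - exact/ltW/kernel_cst_gt0.
(* Here th = e^y, where the mean of cos (th X_i) is at most e^{-A}; the factor e^{-y} is the weight
   in [abs_kernel]. *)
have Phi_ge n y : (expR (- y) * \sum_(i < n.+1) (1 - expR (- A n i (expR y))))%:E <= Phi n y.
  rewrite /Phi /h.
  have icos i : P.-integrable setT (EFin \o (fun w => abs_kernel (Xi n i w) y)).
    apply: (@prob_bounded_integrable _ _ _ _ _ (2 * expR (- y))).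
      exact: measurable_abs_kernel.
    move=> w; rewrite ger0_norm ?abs_kernel_ge0// ler_pM2r ?expR_gt0//.
    exact: one_cos_le2.
  under eq_integral do rewrite -sumEFin.
  rewrite integral_sum//; last by move=> i; exact: icos.
  have -> : (expR (- y) * \sum_(i < n.+1) (1 - expR (- A n i (expR y))) =
    \sum_(i < n.+1) expR (- y) * (1 - expR (- A n i (expR y))))%R by rewrite mulr_sumr.
  rewrite -sumEFin; apply: lee_sum => i _.
  rewrite /abs_kernel; under eq_integral do rewrite EFinM.
  rewrite integralZr//; last first.
    apply: (@prob_bounded_integrable _ _ _ _ _ 2).
      apply: measurable_funB => //; apply: (measurableT_comp (@measurable_cos R)).
      exact: measurable_funM.
    by move=> w; rewrite ger0_norm ?one_cos_ge0// one_cos_le2.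
  rewrite mulrC EFinM lee_wpmul2r ?lee_fin ?expR_ge0//.
  have ic := prob_integrable_cos P (measurable_funM (@measurable_cst _ _ _ _ setT (expR y)) (mXi n i)).
  have -> : \int[P]_w (1 - cos (expR y * Xi n i w))%:E =
      ((\int[P]_w (1 - cos (expR y * Xi n i w)))%R)%:E.
    rewrite /Rintegral fineK//; apply: integrable_fin_num => //.
    apply: (@prob_bounded_integrable _ _ _ _ _ 2).
      apply: measurable_funB => //; apply: (measurableT_comp (@measurable_cos R)).
      exact: measurable_funM.
    by move=> w; rewrite ger0_norm ?one_cos_ge0// one_cos_le2.
  rewrite lee_fin RintegralB//.
    by rewrite Rintegral_prob_cst lerD2l lerN2.
  by apply: (@prob_bounded_integrable _ _ _ _ _ 1) => // w; rewrite normr1.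
have a_lim y : (expR (- y) * \sum_(i < n.+1) (1 - expR (- A n i (expR y))))%:E
    @[n --> \oo] --> a y.
  rewrite /a /abs_kernel; under eq_integral do rewrite EFinM.
  rewrite ge0_integralZr//; last first.
    apply/measurable_EFinP/measurable_funB => //.
    by apply: (measurableT_comp (@measurable_cos R)); exact: measurable_funM.
  rewrite muleC (_ : (fun n => _) = (fun n => (expR (- y))%:E *
      (\sum_(i < n.+1) (1 - expR (- A n i (expR y))))%R%:E)); last first.
    by apply/funext => n; rewrite EFinM.
  by apply: cvgeZl => //; exact: limA.
rewrite -(@lee_pmul2l _ kernel_cst); last 2 first.
- by rewrite ge0_fin_numE ?kernel_cst_lty// ltW// kernel_cst_gt0.
- exact: kernel_cst_gt0.
rewrite -aE.
(* Both sides carry the positive finite factor [kernel_cst] by now. For each [y], [a y] is the limit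
   of the lower bounds in [Phi_ge], hence at most the lower limit of [Phi n y]; Fatou's lemma in [y]
   then meets the constant value in [PhiE]. *)
apply: (@le_trans _ _ (\int[leb]_y limn_einf (Phi ^~ y))).
  apply: ge0_le_integral => //.
  - by move=> y _; apply: integral_ge0 => z _; rewrite lee_fin abs_kernel_ge0.
  - apply: (@measurable_fun_fubini_tonelli_G _ _ _ _ R nu
      (fun z => (abs_kernel (g z.1) z.2)%:E)) => // z.
    by rewrite lee_fin abs_kernel_ge0.
  - rewrite /limn_einf; apply: measurableT_comp => //.
    by apply: measurable_fun_limn_esup => n; apply: measurableT_comp => //; exact: mPhi.
  move=> y _; rewrite -(cvg_limn_einf_sup (a_lim y)).1.
  rewrite !limn_einf_lim; apply: lee_lim; [exact: is_cvg_einfs..|].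
  apply: nearW => n; apply: le_ereal_inf_tmp => _ [k /= nk <-].
  by apply: le_trans (Phi_ge k y); apply: ereal_inf_lbound; exists k.
apply: (le_trans (fatou leb measurableT mPhi _)).
  by move=> n y _; apply: integral_ge0 => w _; rewrite lee_fin.
under eq_fun do rewrite PhiE.
by rewrite (cvg_limn_einf_sup (cvg_cst _)).1.
Qed.

End mean_lower_bound.

(** * Integrals against the directing process *)

Lemma lebesgue_stieltjes_itv (R : realType) (f : cumulative R R) (a b : R) : a <= b ->
  lebesgue_stieltjes_measure f `]a, b]%classic = (f b - f a)%:E.
Proof.
move=> ab; rewrite /lebesgue_stieltjes_measure /measure_extension/=.
by rewrite measurable_mu_extE/= ?wlength_itv_bnd//; exact: is_ocitv.
Qed.

Lemma continuous_bounded_itv (R : realType) (f : R -> R) (a b : R) : continuous f ->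
  exists2 C : R, 0 <= C & forall x, a <= x <= b -> `|f x| <= C.
Proof.
move=> cf.
have [M [_ HM]] := compact_bounded (continuous_compact
  (continuous_subspaceT (A := `[a, b]) cf) (@segment_compact R a b)).
exists (Num.max (M + 1) 0); first by rewrite le_max lexx orbT.
move=> x xab; rewrite le_max; apply/orP; left.
apply: (HM (M + 1)); first by rewrite ltrDl.
by exists x => //; rewrite /= in_itv/=.
Qed.

(** An alias of [mu] whose type records the proof [h], so that the sigma-finite structure demanded
    by Fubini's theorem can be attached to a measure given without it. *)
Definition sigma_finite_of d (T : measurableType d) (R : realType)
  (mu : {measure set T -> \bar R}) (h : sigma_finite setT mu) : set T -> \bar R := mu.

HB.instance Definition _ d (T : measurableType d) (R : realType)
  (mu : {measure set T -> \bar R}) (h : sigma_finite setT mu) :=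
  Measure.on (sigma_finite_of h).

HB.instance Definition _ d (T : measurableType d) (R : realType)
  (mu : {measure set T -> \bar R}) (h : sigma_finite setT mu) :=
  Measure_isSigmaFinite.Build _ _ _ (sigma_finite_of h) h.

Section integral_against_additive.
Context d (Omega : measurableType d) (R : realType) (P : probability Omega R).
Variables (eta : Omega -> cumulative R R) (rho : {measure set (R * R) -> \bar R}).
Let etap := fun u w => eta w u.
Hypothesis addE : additive_process P etap rho.

Definition Leta w : {measure set (measurableTypeR R) -> \bar R} :=
  lebesgue_stieltjes_measure (eta w).

Definition int_eta (f : R -> R) (a b : R) (w : Omega) : R :=
  \int[Leta w]_(x in `]a, b]) f x.

Let meta u : measurable_fun setT (fun w => eta w u).
Proof. by have [m _ _ _ _] := addE; exact: (m u). Qed.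

Lemma Leta_itv_lty w a b : (Leta w `]a, b]%classic < +oo)%E.
Proof.
have [ab|ba] := leP a b; first by rewrite [X in (X < _)%E]lebesgue_stieltjes_itv// ltry.
by rewrite set_itv_ge ?measure0// bnd_simp -leNgt ltW.
Qed.

Lemma measurable_continuous_itv (f : R -> R) (D : set (measurableTypeR R)) :
  continuous f -> measurable_fun D f.
Proof. by move=> cf; apply: measurable_funTS; exact: (continuous_measurable_fun cf). Qed.

Lemma integrable_Leta (f : R -> R) w a b : continuous f ->
  (Leta w).-integrable `]a, b] (EFin \o f).
Proof.
move=> cf; have [C _ fC] := continuous_bounded_itv a b cf.
apply: (@bounded_integrable _ _ _ _ _ _ C).
- exact: measurable_itv.
- exact: Leta_itv_lty.
- exact: measurable_continuous_itv.
- by move=> x /=; rewrite in_itv/= => /andP[ax xb]; apply: fC; rewrite ltW.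
Qed.

Lemma step_bounded (f : R -> R) a b n C : a <= b -> (forall x, a <= x <= b -> `|f x| <= C) ->
  forall x, `]a, b]%classic x -> `|step a b n f x| <= C.
Proof.
move=> ab fC x; rewrite /= in_itv/= => xab; rewrite stepE//.
exact/fC/step_id_itv.
Qed.

Lemma int_eta_step (f : R -> R) a b n w : a <= b -> continuous f ->
  \int[Leta w]_(x in `]a, b]) step a b n f x =
  \sum_(i < n.+1) f (gridpt a b n i) * (eta w (gridpt a b n i.+1) - eta w (gridpt a b n i)).
Proof.
move=> ab cf; have [C _ fC] := continuous_bounded_itv a b cf.
have := @Rintegral_slice_step _ _ _ (Leta w) (@idfun (measurableTypeR R) : measurableTypeR R -> R)
  (@measurable_id _ _ setT) a b n f (fun r _ => r) ab.
rewrite /slice preimage_id /= => ->.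
  apply: eq_bigr => i _; rewrite preimage_id Rintegral_cst; last exact: measurable_itv.
  by rewrite [X in fine X](@lebesgue_stieltjes_itv R (eta w))// gridpt_homo.
apply: (@bounded_integrable _ _ _ _ _ _ C).
- exact: measurable_itv.
- exact: Leta_itv_lty.
- apply: measurable_funTS; exact: measurable_step.
- exact: step_bounded.
Qed.

(** On each path (a, b] has finite mass and [f] is bounded there, so dominated convergence applies.
    Measurability in [w] and the characteristic function of [int_eta] are both inherited from these
    Riemann sums. *)
Lemma int_eta_cvg (f : R -> R) a b w : a <= b -> continuous f ->
  \sum_(i < n.+1) f (gridpt a b n i) *
    (eta w (gridpt a b n i.+1) - eta w (gridpt a b n i)) @[n --> \oo] -->
  int_eta f a b w.
Proof.
move=> ab cf; have [C C0 fC] := continuous_bounded_itv a b cf.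
under eq_fun do rewrite -(int_eta_step _ _ ab cf).
have [||||_ //] := @Rdominated_convergence _ _ _ (Leta w) `]a, b]%classic
  (measurable_itv _) (fun n x => step a b n f x) f (fun=> C).
- by move=> n; apply: measurable_funTS; exact: measurable_step.
- by move=> x /=; rewrite in_itv/= => xab; exact: step_cvg.
- apply: (@bounded_integrable _ _ _ _ _ _ C) => //.
  + exact: Leta_itv_lty.
  + by move=> x _; rewrite ger0_norm.
- by move=> n x; exact: step_bounded.
Qed.

Lemma measurable_int_eta (f : R -> R) a b : a <= b -> continuous f ->
  measurable_fun setT (int_eta f a b).
Proof.
move=> ab cf.
apply: (@measurable_fun_cvg _ _ _ _ (fun n w => \sum_(i < n.+1) f (gridpt a b n i) *
    (eta w (gridpt a b n i.+1) - eta w (gridpt a b n i)))).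
- by move=> n; apply: measurable_sum => i; apply: measurable_funM => //; exact: measurable_funB.
- by move=> w _; exact: int_eta_cvg.
Qed.

Lemma int_etaZ (c : R) (f : R -> R) a b w : continuous f ->
  int_eta (fun x => c * f x) a b w = c * int_eta f a b w.
Proof.
by move=> cf; rewrite /int_eta RintegralZl//; exact: integrable_Leta.
Qed.

Lemma int_eta_ge0 (f : R -> R) a b w : (forall x, 0 <= f x) -> 0 <= int_eta f a b w.
Proof. by move=> f0; apply: Rintegral_ge0. Qed.

Lemma int_eta_le_norm (f : R -> R) a b w : continuous f ->
  `|int_eta f a b w| <= int_eta (fun x => `|f x|) a b w.
Proof.
by move=> cf; apply: le_normr_Rintegral; [exact: measurable_itv|exact: integrable_Leta].
Qed.

Let m1 : measurable_fun setT (fst : R * R -> R). Proof. exact: measurable_fst. Qed.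
Let m2 : measurable_fun setT (snd : R * R -> R). Proof. exact: measurable_snd. Qed.

Lemma measurable_jump_weight (f : R -> R) (D : set (R * R)) : continuous f ->
  measurable_fun D (fun z : R * R => f z.1 * z.2).
Proof.
move=> cf; apply: measurable_funTS; apply: measurable_funM => //.
exact: (measurableT_comp (continuous_measurable_fun cf)).
Qed.

Lemma integrable_min_weight (f : R -> R) a b : 0 <= a -> continuous f ->
  rho.-integrable (strip a b) (fun z => (Num.min `|f z.1 * z.2| 1)%:E).
Proof.
move=> a0 cf; have [C C0 fC] := continuous_bounded_itv a b cf.
have := integrableZl (measurable_strip a b) (C + 1) (integrable_min_jump addE b a0).
apply: le_integrable; first exact: measurable_strip.
  apply/measurable_EFinP/measurable_minr => //; apply: measurableT_comp => //.
  exact: measurable_jump_weight.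
move=> z zab /=; rewrite lee_fin.
have mn (x : R) : 0 <= Num.min `|x| 1 by rewrite le_min normr_ge0 ler01.
rewrite [leLHS]ger0_norm// [leRHS]ger0_norm ?mulr_ge0 ?addr_ge0//.
apply: (le_trans (min_scale _ _)); rewrite ler_wpM2r// lerD2r fC//.
by move: zab; rewrite /strip /slice/= in_itv/= => /andP[/ltW-> ->].
Qed.

Let wcos_le (f : R -> R) a b C n z : a <= b -> (forall x, a <= x <= b -> `|f x| <= C) ->
  strip a b z -> Num.min `|step a b n f z.1 * z.2| 1 <= (C + 1) * Num.min `|z.2| 1.
Proof.
move=> ab fC zab; apply: (le_trans (min_scale _ _)).
rewrite ler_wpM2r ?le_min ?normr_ge0 ?ler01// lerD2r.
exact: (step_bounded n ab fC).
Qed.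

Let mstepw (f : R -> R) a b n : measurable_fun setT (fun z : R * R => step a b n f z.1 * z.2).
Proof. by apply: measurable_funM => //; exact: (measurableT_comp (measurable_step a b n f)). Qed.

Let iminC (a b C : R) : 0 <= a ->
  rho.-integrable (strip a b) (EFin \o (fun z : R * R => 2 * ((C + 1) * Num.min `|z.2| 1))).
Proof.
move=> a0; rewrite (_ : _ \o _ = (fun z : R * R => (2 * (C + 1))%:E * (Num.min `|z.2| 1)%:E)%E).
  exact: (integrableZl (measurable_strip a b) _ (integrable_min_jump addE b a0)).
by apply/funext => z /=; rewrite -EFinM mulrA.
Qed.

(** Both sides are limits along the grids. The Riemann sums have the exponents with [f] replaced by
    [step], and these are dominated by a multiple of min(|v|, 1), which is rho-integrable on the
    strip. *)
Lemma int_eta_char_pair (f : R -> R) a b : 0 <= a -> a <= b -> continuous f ->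
  char_pair P (int_eta f a b)
    (\int[rho]_(z in strip a b) (1 - cos (f z.1 * z.2)))
    (\int[rho]_(z in strip a b) sin (f z.1 * z.2)).
Proof.
move=> a0 ab cf; have [C C0 fC] := continuous_bounded_itv a b cf.
pose X n w := \sum_(i < n.+1) f (gridpt a b n i) *
    (eta w (gridpt a b n i.+1) - eta w (gridpt a b n i)).
have mX n : measurable_fun setT (X n).
  by apply: measurable_sum => i; apply: measurable_funM => //; exact: measurable_funB.
have mn (x : R) : 0 <= Num.min `|x| 1 by rewrite le_min normr_ge0 ler01.
pose Ac n := \int[rho]_(z in strip a b) (1 - cos (step a b n f z.1 * z.2)).
pose Bc n := \int[rho]_(z in strip a b) sin (step a b n f z.1 * z.2).
have icos n : rho.-integrable (strip a b)
    (EFin \o (fun z => 1 - cos (step a b n f z.1 * z.2))).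
  have := iminC b C a0; apply: le_integrable; first exact: measurable_strip.
    apply/measurable_EFinP/measurable_funTS/measurable_funB => //.
    exact: (measurableT_comp (@measurable_cos R)).
  move=> z zab /=; rewrite lee_fin [leLHS]ger0_norm ?one_cos_ge0//.
  rewrite [leRHS]ger0_norm ?mulr_ge0 ?addr_ge0//.
  by apply: (le_trans (one_cos_le_min _)); rewrite ler_pM2l// wcos_le.
have isin n : rho.-integrable (strip a b)
    (EFin \o (fun z => sin (step a b n f z.1 * z.2))).
  have := iminC b C a0; apply: le_integrable; first exact: measurable_strip.
    apply/measurable_EFinP/measurable_funTS.
    exact: (measurableT_comp (@measurable_sin R)).
  move=> z zab /=; rewrite lee_fin [leRHS]ger0_norm ?mulr_ge0 ?addr_ge0//.
  apply: (le_trans (sin_le_min _)); apply: (le_trans (wcos_le n ab fC zab)).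
  by rewrite ler_peMl// ?mulr_ge0 ?addr_ge0// ler1n.
have cpX n : char_pair P (X n) (Ac n) (Bc n).
  have := @additive_sum_char_pair _ _ _ P _ _ addE (gridpt a b n)
    (fun i => f (gridpt a b n i)) n.+1; rewrite gridpt0 => /(_ a0 (gridpt_homo ab n)).
  rewrite /Ac (Rintegral_slice_step m1 (G := fun r z => 1 - cos (r * z.2)) ab (icos n)).
  by rewrite /Bc (Rintegral_slice_step m1 (G := fun r z => sin (r * z.2)) ab (isin n)).
have XX w : X n w @[n --> \oo] --> int_eta f a b w by exact: int_eta_cvg.
have stepw z : strip a b z -> step a b n f z.1 * z.2 @[n --> \oo] --> f z.1 * z.2.
  by move=> zab; apply: cvgMl; apply: step_cvg.
have AcA : Ac n @[n --> \oo] --> \int[rho]_(z in strip a b) (1 - cos (f z.1 * z.2)).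
  have [||||_ //] := @Rdominated_convergence _ _ _ rho _ (measurable_strip a b)
    (fun n z => 1 - cos (step a b n f z.1 * z.2)) (fun z => 1 - cos (f z.1 * z.2))
    (fun z => 2 * ((C + 1) * Num.min `|z.2| 1)).
  - move=> n; apply: measurable_funTS; apply: measurable_funB => //.
    exact: (measurableT_comp (@measurable_cos R)).
  - move=> z zab; apply: cvgB; first exact: cvg_cst.
    by apply: continuous_cvg; [exact: continuous_cos|exact: stepw].
  - exact: iminC.
  - move=> n z zab; rewrite ger0_norm ?one_cos_ge0//.
    by apply: (le_trans (one_cos_le_min _)); rewrite ler_pM2l// wcos_le.
have BcB : Bc n @[n --> \oo] --> \int[rho]_(z in strip a b) sin (f z.1 * z.2).
  have [||||_ //] := @Rdominated_convergence _ _ _ rho _ (measurable_strip a b)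
    (fun n z => sin (step a b n f z.1 * z.2)) (fun z => sin (f z.1 * z.2))
    (fun z => 2 * ((C + 1) * Num.min `|z.2| 1)).
  - move=> n; apply: measurable_funTS.
    exact: (measurableT_comp (@measurable_sin R)).
  - by move=> z zab; apply: continuous_cvg; [exact: continuous_sin|exact: stepw].
  - exact: iminC.
  - move=> n z zab; apply: (le_trans (sin_le_min _)); apply: (le_trans (wcos_le n ab fC zab)).
    by rewrite ler_peMl// ?mulr_ge0 ?addr_ge0// ler1n.
have i1 : P.-integrable setT (EFin \o (fun=> 1 : R)).
  by apply: (@prob_bounded_integrable _ _ _ _ _ 1) => // w; rewrite normr1.
have eA : expR (- Ac n) @[n --> \oo] -->
    expR (- \int[rho]_(z in strip a b) (1 - cos (f z.1 * z.2))).
  by apply: continuous_cvg; [exact: continuous_expR|exact: (cvgN AcA)].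
split.
- have [||||_ c] := @Rdominated_convergence _ _ _ P _ measurableT
    (fun n w => cos (X n w)) (fun w => cos (int_eta f a b w)) (fun=> 1) => //.
  + by move=> n; exact: (measurableT_comp (@measurable_cos R)).
  + by move=> w _; apply: continuous_cvg; [exact: continuous_cos|exact: XX].
  + by move=> n w _; exact: cos_max.
  have c' : \int[P]_w cos (X n w) @[n --> \oo] -->
      expR (- \int[rho]_(z in strip a b) (1 - cos (f z.1 * z.2))) *
      cos (\int[rho]_(z in strip a b) sin (f z.1 * z.2)).
    rewrite (_ : (fun n => \int[P]_w cos (X n w)) = (fun n => expR (- Ac n) * cos (Bc n))); last first.
      by apply/funext => n; exact: (cpX n).1.
    by apply: cvgM => //; apply: continuous_cvg; [exact: continuous_cos|exact: BcB].
  exact: (cvg_unique _ c c').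
- have [||||_ c] := @Rdominated_convergence _ _ _ P _ measurableT
    (fun n w => sin (X n w)) (fun w => sin (int_eta f a b w)) (fun=> 1) => //.
  + by move=> n; exact: (measurableT_comp (@measurable_sin R)).
  + by move=> w _; apply: continuous_cvg; [exact: continuous_sin|exact: XX].
  + by move=> n w _; exact: sin_max.
  have c' : \int[P]_w sin (X n w) @[n --> \oo] -->
      expR (- \int[rho]_(z in strip a b) (1 - cos (f z.1 * z.2))) *
      sin (\int[rho]_(z in strip a b) sin (f z.1 * z.2)).
    rewrite (_ : (fun n => \int[P]_w sin (X n w)) = (fun n => expR (- Ac n) * sin (Bc n))); last first.
      by apply/funext => n; exact: (cpX n).2.
    by apply: cvgM => //; apply: continuous_cvg; [exact: continuous_sin|exact: BcB].
  exact: (cvg_unique _ c c').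
Qed.

Lemma int_eta_exponent (f : R -> R) a b (th : R) : 0 <= a -> a <= b -> continuous f ->
  has_exponent P rho (strip a b) (fun z => f z.1 * z.2) (int_eta f a b) th.
Proof.
move=> a0 ab cf.
have cthf : continuous (fun x => th * f x).
  by move=> x; apply: cvgMr; exact: cf.
have [h1 h2] := int_eta_char_pair a0 ab cthf.
split.
- under eq_Rintegral do rewrite -int_etaZ//.
  rewrite h1 /cos_part /sin_part; congr (expR (- _) * cos _).
    by apply: eq_Rintegral => z _; rewrite mulrA.
  by apply: eq_Rintegral => z _; rewrite mulrA.
- under eq_Rintegral do rewrite -int_etaZ//.
  rewrite h2 /cos_part /sin_part; congr (expR (- _) * sin _).
    by apply: eq_Rintegral => z _; rewrite mulrA.
  by apply: eq_Rintegral => z _; rewrite mulrA.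
Qed.

(** Up to time [k], the jumps with min(|v|, 1) >= 1 / (k + 1) have finite mass by Markov's
    inequality. Jumps of size 0 and times outside (0, +oo) form null sets. *)
Lemma jump_sigma_finite : sigma_finite setT rho.
Proof.
have jm : jump_measure rho by have [_ _ _ _ []] := addE.
have [j1 j2 j3 j4] := jm.
pose f (z : R * R) := (Num.min `|z.2| 1)%:E.
have mf (D : set (R * R)) : measurable_fun D f.
  by apply/measurable_EFinP/measurable_funTS/measurable_minr => //; exact: measurableT_comp.
pose F1 k : set (R * R) := strip 0 k%:R `&` [set z | (k.+1%:R^-1%:E <= `|f z|)%E].
pose F2 k : set (R * R) := `]0, k%:R] `*` [set 0].
pose F3 : set (R * R) := ~` (`]0, +oo[ `*` setT).
have mF1 k : measurable (F1 k).
  apply: emeasurable_fun_c_infty; first exact: measurable_strip.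
  exact: measurableT_comp.
have mF2 k : measurable (F2 k) by apply: measurableX.
have mF3 : measurable F3 by apply: measurableC; apply: measurableX.
exists (fun k => F1 k `|` F2 k `|` F3).
  apply/esym/seteqP; split => // -[x v] _.
  have [x0|x0] := ltP 0 x; last first.
    by exists 0%N => //; right; rewrite /F3/= in_itv/= => -[]; rewrite andbT ltNge x0.
  have [v0|v0] := eqVneq v 0.
    exists (Num.truncn x).+1 => //; left; right; split => //=; rewrite in_itv/= x0/=.
    exact/ltW/truncnS_gt.
  have mv : 0 < Num.min `|v| 1 by rewrite lt_min normr_gt0 v0 ltr01.
  exists (maxn (Num.truncn x).+1 (Num.truncn (Num.min `|v| 1)^-1)) => //; left; left; split.
    rewrite /strip /slice/= in_itv/= x0/=; apply: ltW; apply: (lt_le_trans (truncnS_gt x)).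
    by rewrite ler_nat leq_maxl.
  rewrite /mkset /f abse_EFin lee_fin gtr0_norm// -[leRHS]invrK lef_pV2 ?posrE ?invr_gt0//.
  by apply: ltW; apply: (lt_le_trans (truncnS_gt _)); rewrite ler_nat ltnS leq_maxr.
move=> k; split; first by apply: measurableU => //; exact: measurableU.
apply: (@le_lt_trans _ _ (rho (F1 k))).
  apply: (le_trans (measureU2 _ _ _)) => //; first exact: measurableU.
  rewrite [X in (_ + X)%E]j1 adde0; apply: (le_trans (measureU2 _ _ _)) => //.
  by rewrite [X in (_ + X)%E]j2 adde0.
have k0 : 0 < k.+1%:R^-1 :> R by rewrite invr_gt0.
have := @le_integral_abse _ _ _ rho _ (measurable_strip 0 k%:R) f k.+1%:R^-1 (mf _) k0.
move=> /le_lt_trans H; have {}H : (k.+1%:R^-1%:E * rho (F1 k) < +oo)%E.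
  apply: H; rewrite -strip_setX; under eq_integral.
    move=> z _; rewrite /f abse_EFin ger0_norm ?le_min ?normr_ge0 ?ler01//; over.
  exact: j4.
have : (0 <= rho (F1 k))%E by [].
move: H; case: (rho (F1 k)) => [r||]//; first by rewrite !ltry.
by rewrite mulry gtr0_sg// mul1e.
Qed.

(** 1 - e^{-A} differs from A by at most A^2. *)
Lemma cvg_sum_one_expRN (A : nat -> nat -> R) (S : R) :
  (forall n i, 0 <= A n i) ->
  \sum_(i < n.+1) A n i @[n --> \oo] --> S ->
  \sum_(i < n.+1) A n i ^+ 2 @[n --> \oo] --> 0 ->
  \sum_(i < n.+1) (1 - expR (- A n i)) @[n --> \oo] --> S.
Proof.
move=> A0 AS A2; apply: (cvg_perturb AS A2) => n.
rewrite -sumrB; apply: (le_trans (ler_norm_sum _ _ _)).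
by apply: ler_sum => i _; exact: one_expRN_bounds.
Qed.

(** The integrals over the grid cells serve as the pieces in [exponent_abs_mean_le]. What has to be
    checked is that the sum of 1 - e^{-A} over the cells tends to the full exponent, that is, that
    the sum of A^2 tends to 0. *)
Lemma int_eta_abs_le (f : R -> R) a b : 0 <= a -> a <= b -> continuous f ->
  (forall x, 0 <= f x) ->
  (\int[rho]_(z in strip a b) `|f z.1 * z.2|%:E <= \int[P]_w (int_eta f a b w)%:E)%E.
Proof.
move=> a0 ab cf f0.
pose s := strip a b.
pose g (z : R * R) := f z.1 * z.2 * \1_s z.
pose nu := sigma_finite_of jump_sigma_finite : {sigma_finite_measure set _ -> \bar R}.
have ms : measurable s := measurable_strip a b.
have mg : measurable_fun setT g.
  apply: measurable_funM; first exact: measurable_jump_weight.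
  exact: measurable_indic.
pose h th (z : R * R) := 1 - cos (th * (f z.1 * z.2)).
pose A n i th := \int[rho]_(z in strip (gridpt a b n i) (gridpt a b n i.+1)) h th z.
have ih th u v : 0 <= u -> rho.-integrable (strip u v) (EFin \o h th).
  move=> u0; have cthf : continuous (fun x => th * f x) by move=> x; apply: cvgMr; exact: cf.
  have := integrableZl (measurable_strip u v) 2 (integrable_min_weight v u0 cthf).
  apply: le_integrable; first exact: measurable_strip.
    apply/measurable_EFinP/measurable_funB => //.
    apply: (measurableT_comp (@measurable_cos R)); apply: measurable_funM => //.
    exact: measurable_jump_weight.
  move=> z _ /=; rewrite lee_fin ger0_norm ?one_cos_ge0//.
  rewrite ger0_norm ?mulr_ge0 ?le_min ?normr_ge0 ?ler01// -mulrA.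
  exact: one_cos_le_min.
have -> : (\int[rho]_(z in s) `|f z.1 * z.2|%:E = \int[nu]_z `|g z|%:E)%E.
  rewrite integral_mkcond; apply: eq_integral => z _; rewrite patchE /g indicE.
  by case: ifPn => _; rewrite ?mulr1// mulr0 normr0.
apply: (@exponent_abs_mean_le _ _ _ P _ _ nu g (int_eta f a b)
  (fun n i => int_eta f (gridpt a b n i) (gridpt a b n i.+1)) A) => //.
- by move=> n i; apply: measurable_int_eta => //; exact: gridpt_homo.
- by move=> n i w; exact: int_eta_ge0.
- move=> n w.
  have := @Rintegral_slice_sum _ _ _ (Leta w) (@idfun (measurableTypeR R) : measurableTypeR R -> R)
    (@measurable_id _ _ setT) (gridpt a b n) n.+1 f (gridpt_homo ab n).
  rewrite /slice preimage_id gridpt0 gridptS /int_eta => -> //.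
  exact: integrable_Leta.
- move=> n i th; have gn : gridpt a b n i <= gridpt a b n i.+1 by exact: gridpt_homo.
  have [-> _] := int_eta_exponent th (le_trans a0 (gridpt_ge ab n i)) gn cf.
  by rewrite ler_piMr ?expR_ge0// (le_trans (ler_norm _))// cos_max.
- move=> th.
  have A0 n i : 0 <= A n i th by apply: Rintegral_ge0 => z _; exact: one_cos_ge0.
  have SA n : \sum_(i < n.+1) A n i th = \int[rho]_(z in s) h th z.
    rewrite /s -(gridptS a b n) -{1}(gridpt0 a b n) Rintegral_slice_sum//; first exact: gridpt_homo.
    by apply: ih; rewrite gridpt0.
  have -> : (\int[nu]_z (1 - cos (th * g z))%:E = (\int[rho]_(z in s) h th z)%:E)%E.
    rewrite fineK; last exact: (integrable_fin_num ms (ih _ _ _ a0)).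
    rewrite [in RHS]integral_mkcond; apply: eq_integral => z _; rewrite patchE /g indicE.
    by case: ifPn => _; rewrite ?mulr1// !mulr0 cos0 subrr.
  apply: cvg_EFin; first exact: nearW.
  apply: (cvg_sum_one_expRN (fun n i => A0 n i)); first by under eq_fun do rewrite SA; exact: cvg_cst.
  pose H u := \int[rho]_(z in strip a u) h th z.
  have cH : continuous H.
    apply: (@Rintegral_slice_continuous _ _ _ rho _ measurable_fst (jump_null_time addE)) => u.
    exact: ih.
  (* At a grid point, [phi n] is the exponent of the cell to its right. The sum of A^2 is thus the
     integral of [h th] weighted at each jump with the exponent of the cell it falls into, and this
     weight tends to 0 by continuity of [H]. *)
  pose dl n := (b - a) / n.+1%:R.
  pose phi n x := H (x + dl n) - H x.
  have phiE n i : (i < n.+1)%N -> phi n (gridpt a b n i) = A n i th.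
    move=> _; have -> : phi n (gridpt a b n i) = H (gridpt a b n i.+1) - H (gridpt a b n i).
      by rewrite /phi /dl -(gridptB a b n i) subrKC.
    rewrite /H (@Rintegral_slice_cat _ _ _ rho _ measurable_fst a (gridpt a b n i))//.
    + by rewrite addrC addrA addNr add0r.
    + exact: gridpt_ge.
    + exact: gridpt_homo.
    + exact: ih.
  have mphi n : measurable_fun setT (fun z : R * R => step a b n (phi n) z.1).
    exact: (measurableT_comp (measurable_step a b n (phi n))).
  have phib n z : s z -> `|step a b n (phi n) z.1 * h th z| <= H b * h th z.
    move=> sz; rewrite normrM [X in _ * X]ger0_norm ?one_cos_ge0// ler_wpM2r ?one_cos_ge0//.
    have sz' : a < z.1 <= b by move: sz; rewrite /s /strip /slice/= in_itv.
    have [i i1 zi] := in_cell n sz'; rewrite (step_cell ab _ i1 zi) phiE//.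
    rewrite ger0_norm// -[leRHS](SA n) (bigD1 (Ordinal i1))//= lerDl sumr_ge0//.
  have iphi n : rho.-integrable s (EFin \o (fun z => step a b n (phi n) z.1 * h th z)).
    have := integrableZl ms (H b) (ih th a b a0); apply: le_integrable => //.
      apply/measurable_EFinP/measurable_funM; first exact: measurable_funTS.
      by have := ih th a b a0 => /integrableP[/measurable_EFinP].
    move=> z sz /=; rewrite lee_fin [leRHS]ger0_norm ?mulr_ge0 ?one_cos_ge0//; first exact: phib.
    by apply: Rintegral_ge0 => ? _; exact: one_cos_ge0.
  have -> : (fun n => \sum_(i < n.+1) A n i th ^+ 2) =
            (fun n => \int[rho]_(z in s) (step a b n (phi n) z.1 * h th z)).
    apply/funext => n; rewrite (@Rintegral_slice_step _ _ _ rho _ measurable_fst a b n (phi n)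
      (fun y z => y * h th z) ab (iphi n)).
    apply: eq_bigr => i _; rewrite RintegralZl//; first by rewrite phiE// expr2.
    - exact: measurable_strip.
    - apply: ih; exact: (le_trans a0 (gridpt_ge ab n i)).
  have [||||_ c] := @Rdominated_convergence _ _ _ rho s ms
    (fun n z => step a b n (phi n) z.1 * h th z) (fun=> 0) (fun z => H b * h th z).
  + by move=> n; have /integrableP[/measurable_EFinP] := iphi n.
  + move=> z sz; rewrite -(mul0r (h th z)); apply: cvgMl.
    have sz' : a < z.1 <= b by move: sz; rewrite /s /strip /slice/= in_itv.
    under eq_fun do rewrite (stepE ab _ _ sz').
    rewrite /phi -(subrr (H z.1)); apply: cvgB.
      apply: continuous_cvg; first exact: cH.
      rewrite -[z.1 in X in _ --> X]addr0; apply: cvgD; first exact: step_id_cvg.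
      by rewrite /dl -(mulr0 (b - a)); apply: cvgMr; exact: cvg_harmonic.
    by apply: continuous_cvg; [exact: cH|exact: step_id_cvg].
  + exact: (integrableZl ms (H b) (ih th a b a0)).
  + by move=> n z; exact: phib.
  by rewrite Rintegral_cst// mul0r in c.
Qed.

Section weighted_moments.
Variables (f : R -> R) (a b : R).
Hypotheses (a0 : 0 <= a) (ab : a <= b) (cf : continuous f).
Hypothesis iX : P.-integrable setT (EFin \o int_eta (fun x => `|f x|) a b).

Let cnf : continuous (fun x => `|f x|).
Proof. by move=> x; apply: cvg_norm; exact: cf. Qed.

Let ms : measurable (strip a b). Proof. exact: measurable_strip. Qed.

Lemma integrable_jump_weight : rho.-integrable (strip a b) (EFin \o (fun z => f z.1 * z.2)).
Proof.
apply/integrableP; split; first by apply/measurable_EFinP; exact: measurable_jump_weight.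
have := int_eta_abs_le a0 ab cnf (fun x => normr_ge0 (f x)).
under eq_integral do rewrite normrM normr_id -normrM.
move=> /le_lt_trans; apply.
have [mX] := integrableP _ _ _ iX; apply: le_lt_trans; apply: ge0_le_integral => //.
- by move=> w _; rewrite lee_fin int_eta_ge0.
- exact: measurableT_comp.
- by move=> w _; exact: lee_abs.
Qed.

Lemma integrable_int_eta : P.-integrable setT (EFin \o int_eta f a b).
Proof.
apply: le_integrable iX => //; first exact/measurable_EFinP/measurable_int_eta.
by move=> w _ /=; rewrite lee_fin (le_trans (int_eta_le_norm _ _ _ cf))// ler_norm.
Qed.

Lemma int_eta_mean : \int[P]_w int_eta f a b w = \int[rho]_(z in strip a b) (f z.1 * z.2).
Proof.
apply: exponent_mean => //.
- exact: measurable_jump_weight.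
- exact: measurable_int_eta.
- exact: integrable_min_weight.
- exact: integrable_int_eta.
- by move=> n; exact: int_eta_exponent.
- exact: integrable_jump_weight.
Qed.

End weighted_moments.

Section nonnegative_jumps.
Variables (f : R -> R) (a b : R).
Hypotheses (a0 : 0 <= a) (ab : a <= b) (cf : continuous f).
Hypothesis iX : P.-integrable setT (EFin \o int_eta (fun x => `|f x|) a b).

Let cnf : continuous (fun x => `|f x|).
Proof. by move=> x; apply: cvg_norm; exact: cf. Qed.

Let ms : measurable (strip a b). Proof. exact: measurable_strip. Qed.

Let g (z : R * R) := `|f z.1| * z.2.

Let mg : measurable_fun (strip a b) g.
Proof. exact: (measurable_jump_weight cnf). Qed.

(* [int |f| |v| drho <= E int |f| deta = int |f| v drho], hence [|f| v >= 0]. *)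
Lemma ae_jump_weight_ge0 : {ae rho, forall z, strip a b z -> 0 <= g z}.
Proof.
have iX' : P.-integrable setT (EFin \o int_eta (fun x => `| `|f x| |) a b).
  rewrite (_ : (fun x => `| `|f x| |) = (fun x => `|f x|))//.
  by apply/funext => x; rewrite normr_id.
have ig : rho.-integrable (strip a b) (EFin \o g) := integrable_jump_weight a0 ab cnf iX'.
have ing := integrable_norm ig.
have le0 : \int[rho]_(z in strip a b) (`|g z| - g z) <= 0.
  rewrite RintegralB// subr_le0 -(int_eta_mean a0 ab cnf iX').
  apply: fine_le.
  - exact: (integrable_fin_num ms ing).
  - exact: (integrable_fin_num measurableT (integrable_int_eta ab cnf iX')).
  - exact: (int_eta_abs_le a0 ab cnf).
have iB : rho.-integrable (strip a b) (EFin \o (fun z => `|g z| - g z)).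
  exact: (integrableB ms ing ig).
have eq0 : (\int[rho]_(z in strip a b) `|(`|g z| - g z)%:E| = 0)%E.
  under eq_integral do rewrite abse_EFin ger0_norm ?subr_ge0 ?ler_norm//.
  rewrite -[LHS]fineK; last exact: (integrable_fin_num ms iB).
  congr (_%:E); apply/eqP; rewrite eq_le le0/=.
  by apply: Rintegral_ge0 => z _; rewrite subr_ge0 ler_norm.
have /(ae_eq_integral_abs rho ms) : measurable_fun (strip a b) (EFin \o (fun z => `|g z| - g z)).
  by have [] := integrableP _ _ _ iB.
case=> /(_ eq0) + _; apply: filterS => z /= zz sz.
by have /eqP := zz sz; rewrite eqe subr_eq0 => /eqP <-.
Qed.

(** [ae_jump_weight_ge0] tells the sign of a jump only where [f] does not vanish; the condition on
    [G] covers the other times. *)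
Lemma integral_nonneg_jumps (G : R * R -> \bar R) : measurable_fun setT G ->
  (forall z, f z.1 * z.2 = 0 -> G z = 0%E) ->
  (\int[rho]_(z in strip a b) G z = \int[rho]_(z in `]a, b]%classic `*` `[0%R, +oo[%classic) G z)%E.
Proof.
move=> mG G0; have mD : measurable (`]a, b] `*` `[0, +oo[ : set (R * R)) by exact: measurableX.
have -> : `]a, b] `*` `[0, +oo[ = strip a b `&` (setT `*` `[0, +oo[) :> set (R * R).
  by apply/seteqP; split => z [] //= ? [].
have mT : measurable (setT `*` `[0, +oo[ : set (R * R)) by exact: measurableX.
rewrite [RHS]integral_mkcondr; apply: ae_eq_integral => //.
- exact: measurable_funTS.
- by apply: measurable_funTS; apply/(measurable_restrictT _ _).1 => //; exact: measurable_funTS.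
apply: filterS ae_jump_weight_ge0 => z gz sz; rewrite patchE; case: ifPn => // /negP zn.
have [fz|fz] := eqVneq (f z.1) 0; first by rewrite G0// fz mul0r.
case: zn; rewrite inE; split => //=; rewrite in_itv/= andbT.
by have := gz sz; rewrite /g pmulr_rge0// normr_gt0.
Qed.

Lemma int_eta_mean_jumps : (\int[P]_w (int_eta f a b w)%:E =
  \int[rho]_(z in `]a, b]%classic `*` `[0%R, +oo[%classic) (f z.1 * z.2)%:E)%E.
Proof.
rewrite -integral_nonneg_jumps; first last.
- by move=> z ->.
- by apply/measurable_EFinP; exact: measurable_jump_weight.
rewrite -[LHS]fineK; last exact: (integrable_fin_num measurableT (integrable_int_eta ab cf iX)).
rewrite -[RHS]fineK; last exact: (integrable_fin_num ms (integrable_jump_weight a0 ab cf iX)).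
by congr (_%:E); exact: (int_eta_mean a0 ab cf iX).
Qed.

Hypothesis iX2 : P.-integrable setT (EFin \o (fun w => int_eta f a b w ^+ 2)).

Lemma int_eta_second_moment_jumps : (\int[P]_w (int_eta f a b w ^+ 2)%:E =
  \int[rho]_(z in `]a, b]%classic `*` `[0%R, +oo[%classic) (f z.1 ^+ 2 * z.2 ^+ 2)%:E +
  ((\int[P]_w int_eta f a b w) ^+ 2)%:E)%E.
Proof.
have mX := measurable_int_eta ab cf.
have mw := measurable_jump_weight (D := strip a b) cf.
have imin := integrable_min_weight b a0 cf.
have ex n := int_eta_exponent n.+1%:R^-1 a0 ab cf.
rewrite -integral_nonneg_jumps; first last.
- by move=> z; rewrite -exprMn => ->; rewrite expr0n.
- apply/measurable_EFinP; under eq_fun do rewrite -exprMn.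
  by apply: measurable_funX; exact: measurable_jump_weight.
rewrite -[LHS]fineK; last exact: (integrable_fin_num measurableT iX2).
have -> : (fun z : R * R => (f z.1 ^+ 2 * z.2 ^+ 2)%:E) = (fun z => ((f z.1 * z.2) ^+ 2)%:E).
  by apply/funext => z; rewrite exprMn.
rewrite -[X in (X + _)%E]fineK; last first.
  have := exponent_sqr_integrable ms mw mX imin ex iX2.
  exact: integrable_fin_num.
rewrite -EFinD; congr (_%:E); rewrite (int_eta_mean a0 ab cf iX).
exact: (exponent_second_moment ms mw mX imin ex iX2).
Qed.

End nonnegative_jumps.

End integral_against_additive.

(** * Moments of additive processes through the jump measure *)

Section additive_moments.
Context d (Omega : measurableType d) (R : realType) (P : probability Omega R).
Variables (V : R -> Omega -> R) (rho : {measure set (R * R) -> \bar R}).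
Hypothesis addV : additive_process P V rho.
Hypothesis V2 : forall u, 0 <= u -> ('E_P[V u ^+ 2] < +oo)%E.

Let mV u : measurable_fun setT (V u). Proof. by case: addV. Qed.

(** This will be mu(0, u]; see [mean_incr0]. Through the jump measure, continuity and additivity in
    [u] and the value 0 for [u <= 0] are within reach. *)
Definition jump_mean (r : {measure set (R * R) -> \bar R}) (u : R) : R :=
  \int[r]_(z in strip 0 u) z.2.

(** This is the variance sigma^2(0, u], not the second moment: the variance of a pure jump additive
    process integrates the squared jumps; see [var_incr0]. *)
Definition jump_sqr (r : {measure set (R * R) -> \bar R}) (u : R) : R :=
  \int[r]_(z in strip 0 u) z.2 ^+ 2.

Let iV2 u : 0 <= u -> P.-integrable setT (EFin \o (fun w => V u w ^+ 2)).
Proof.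
move=> u0; apply/integrableP; split; first exact/measurable_EFinP/measurable_funX.
have := V2 u0; rewrite unlock; congr (_ < _)%E; apply: eq_integral => w _.
by rewrite /= ger0_norm ?sqr_ge0.
Qed.

Lemma integrable_increment_sqr a b : 0 <= a -> 0 <= b ->
  P.-integrable setT (fun w => ((V b w - V a w) ^+ 2)%:E).
Proof.
move=> a0 b0.
have := integrableZl measurableT 2 (integrableD measurableT (iV2 a0) (iV2 b0)).
apply: le_integrable => //; first exact/measurable_EFinP/measurable_funX/measurable_funB.
move=> w _ /=; rewrite lee_fin !ger0_norm ?sqr_ge0 ?mulr_ge0 ?addr_ge0 ?sqr_ge0//.
have := sqr_ge0 (V b w + V a w); nra.
Qed.

Lemma integrable_increment a b : 0 <= a -> 0 <= b ->
  P.-integrable setT (EFin \o (fun w => V b w - V a w)).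
Proof.
move=> a0 b0; apply: sqr_integrable_integrable; first exact: measurable_funB.
exact: integrable_increment_sqr.
Qed.

Let m2 (D : set (R * R)) : measurable_fun D (snd : R * R -> R).
Proof. by apply: measurable_funTS; exact: measurable_snd. Qed.

Let ms (a b : R) : measurable (strip a b). Proof. exact: measurable_strip. Qed.

Let mX a b : measurable_fun setT (fun w => V b w - V a w).
Proof. exact: measurable_funB. Qed.

Let imin a b (a0 : 0 <= a) := integrable_min_jump addV b a0.

Let ex a b (th : R) : 0 <= a -> a <= b ->
  has_exponent P rho (strip a b) snd (fun w => V b w - V a w) th.
Proof. by move=> a0 ab; exact: (additive_char_pair addV th a0 ab). Qed.

Let strip_empty (a b : R) : b <= a -> strip a b = set0.
Proof.
move=> ba; apply/seteqP; split => // z; rewrite /strip /slice/= in_itv/=.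
by move=> /andP[h1 h2]; move: (lt_le_trans h1 h2); rewrite ltNge ba.
Qed.

Lemma integrable_jump_sqr a b : 0 <= a ->
  rho.-integrable (strip a b) (EFin \o (fun z => z.2 ^+ 2)).
Proof.
move=> a0; have [ab|ba] := leP a b; last by rewrite strip_empty ?ltW//; exact: integrable_set0.
have b0 := le_trans a0 ab.
exact: (exponent_sqr_integrable (ms a b) (@m2 _) (mX a b) (imin b a0)
  (fun n => ex _ a0 ab) (integrable_increment_sqr a0 b0)).
Qed.

Lemma integrable_jump a b : 0 <= a ->
  rho.-integrable (strip a b) (EFin \o snd).
Proof.
move=> a0; have [ab|ba] := leP a b; last by rewrite strip_empty ?ltW//; exact: integrable_set0.
have b0 := le_trans a0 ab.
exact: (exponent_integrable (ms a b) (@m2 _) (mX a b) (imin b a0)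
  (fun n => ex _ a0 ab) (integrable_increment_sqr a0 b0)).
Qed.

Lemma continuous_jump_mean : continuous (jump_mean rho).
Proof.
apply: (@Rintegral_slice_continuous _ _ _ rho _ measurable_fst (jump_null_time addV)) => u.
exact: integrable_jump.
Qed.

Lemma continuous_jump_sqr : continuous (jump_sqr rho).
Proof.
apply: (@Rintegral_slice_continuous _ _ _ rho _ measurable_fst (jump_null_time addV)) => u.
exact: integrable_jump_sqr.
Qed.

Lemma jump_meanB a b : 0 <= a -> a <= b ->
  jump_mean rho b - jump_mean rho a = \int[rho]_(z in strip a b) z.2.
Proof.
move=> a0 ab; rewrite /jump_mean (@Rintegral_slice_cat _ _ _ rho _ measurable_fst 0 a b)//.
  by rewrite addrC addrA addNr add0r.
exact: integrable_jump.
Qed.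

Lemma jump_sqrB a b : 0 <= a -> a <= b ->
  jump_sqr rho b - jump_sqr rho a = \int[rho]_(z in strip a b) z.2 ^+ 2.
Proof.
move=> a0 ab; rewrite /jump_sqr (@Rintegral_slice_cat _ _ _ rho _ measurable_fst 0 a b)//.
  by rewrite addrC addrA addNr add0r.
exact: integrable_jump_sqr.
Qed.

Lemma jump_sqr_homo a b : 0 <= a -> a <= b -> jump_sqr rho a <= jump_sqr rho b.
Proof.
move=> a0 ab; rewrite -subr_ge0 jump_sqrB//.
by apply: Rintegral_ge0 => z _; exact: sqr_ge0.
Qed.

Lemma increment_mean a b : 0 <= a -> a <= b ->
  \int[P]_w (V b w - V a w) = jump_mean rho b - jump_mean rho a.
Proof.
move=> a0 ab; have b0 := le_trans a0 ab; rewrite jump_meanB//.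
exact: (exponent_mean (ms a b) (@m2 _) (mX a b) (imin b a0) (integrable_increment a0 b0)
  (fun n => ex _ a0 ab) (integrable_jump _ a0)).
Qed.

Lemma increment_second_moment a b : 0 <= a -> a <= b ->
  \int[P]_w (V b w - V a w) ^+ 2 = jump_sqr rho b - jump_sqr rho a +
    (jump_mean rho b - jump_mean rho a) ^+ 2.
Proof.
move=> a0 ab; have b0 := le_trans a0 ab; rewrite jump_meanB// jump_sqrB//.
exact: (exponent_second_moment (ms a b) (@m2 _) (mX a b) (imin b a0)
  (fun n => ex _ a0 ab) (integrable_increment_sqr a0 b0)).
Qed.

Lemma mean_incrE a b : 0 <= a -> a <= b ->
  mean_incr P V a b = jump_mean rho b - jump_mean rho a.
Proof. by move=> a0 ab; rewrite -increment_mean// /mean_incr unlock. Qed.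

Lemma var_incrE a b : 0 <= a -> a <= b ->
  var_incr P V a b = jump_sqr rho b - jump_sqr rho a.
Proof.
move=> a0 ab; have := increment_second_moment a0 ab.
by rewrite /var_incr mean_incrE// unlock /Rintegral/= => ->; rewrite addrK.
Qed.

Lemma jump_mean_neg u : u <= 0 -> jump_mean rho u = 0.
Proof. by move=> u0; rewrite /jump_mean strip_empty// Rintegral_set0. Qed.

Lemma jump_sqr_neg u : u <= 0 -> jump_sqr rho u = 0.
Proof. by move=> u0; rewrite /jump_sqr strip_empty// Rintegral_set0. Qed.

Let ae_neg u : u <= 0 -> {ae P, forall w, V u w - V 0 w = 0}.
Proof.
move=> u0; have [_ h _ _ _] := addV.
by apply: filterS2 (h _ u0) (additive_at0 addV) => w -> ->; rewrite subrr.
Qed.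

(** Negative [u] are included, where [V] vanishes almost surely; so [mean_incr P V 0] can be
    replaced as a function, by one that is continuous on the whole line. *)
Lemma mean_incr0 u : mean_incr P V 0 u = jump_mean rho u.
Proof.
have [u0|u0] := leP 0 u; first by rewrite mean_incrE// (jump_mean_neg (lexx 0)) subr0.
rewrite jump_mean_neg ?ltW// /mean_incr unlock.
transitivity (\int[P]_w (V u w - V 0 w)) => //.
rewrite (@ae_eq_Rintegral _ _ _ P _ (fun=> 0))//; last by apply: ae_neg; exact: ltW.
by rewrite Rintegral_prob_cst.
Qed.

Lemma var_incr0 u : var_incr P V 0 u = jump_sqr rho u.
Proof.
have [u0|u0] := leP 0 u; first by rewrite var_incrE// (jump_sqr_neg (lexx 0)) subr0.
rewrite jump_sqr_neg ?ltW// /var_incr mean_incr0 jump_mean_neg ?ltW// expr0n/= subr0 unlock.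
transitivity (\int[P]_w (V u w - V 0 w) ^+ 2) => //.
rewrite (@ae_eq_Rintegral _ _ _ P _ (fun=> 0))//.
- by rewrite Rintegral_prob_cst.
- by apply: measurable_funX; exact: mX.
- by apply: filterS (ae_neg (ltW u0)) => w ->; rewrite expr0n.
Qed.

End additive_moments.

Lemma same_law_sqr_lty d (Omega : measurableType d) d' (Omega' : measurableType d')
    (R : realType) (P : probability Omega R) (Q : probability Omega' R)
    (V : R -> Omega -> R) (W : R -> Omega' -> R) (u : R) :
  measurable_fun setT (V u) -> measurable_fun setT (W u) -> 0 <= u -> same_law P Q V W ->
  ('E_Q[W u ^+ 2] < +oo)%E -> ('E_P[V u ^+ 2] < +oo)%E.
Proof.
move=> mV mW u0 sl.
have e B : measurable B -> P (V u @^-1` B) = Q (W u @^-1` B).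
  move=> mB; have := sl 1%N (fun=> u) (fun=> B) (fun=> u0) (fun=> mB).
  have -> : [set w | 'I_1 -> B (V u w)] = V u @^-1` B.
    by apply/seteqP; split => w /= h; [exact: (h ord0)|].
  have -> // : [set w | 'I_1 -> B (W u w)] = W u @^-1` B.
  by apply/seteqP; split => w /= h; [exact: (h ord0)|].
have ms : measurable_fun setT (fun x : R => (x ^+ 2)%:E).
  by apply/measurable_EFinP; exact: measurable_funX.
suff -> : ('E_P[V u ^+ 2] = 'E_Q[W u ^+ 2])%E by [].
rewrite unlock.
transitivity (\int[pushforward P (V u)]_x (x ^+ 2)%:E)%E.
  by rewrite ge0_integral_pushforward//= => x _; rewrite lee_fin sqr_ge0.
transitivity (\int[pushforward Q (W u)]_x (x ^+ 2)%:E)%E; last first.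
  by rewrite ge0_integral_pushforward//= => x _; rewrite lee_fin sqr_ge0.
by apply: eq_measure_integral => A mA _; exact: e.
Qed.

(** * Campbell's formulas *)

(** The Poisson mass function, correct also at rate 0, where [0 ^+ 0 = 1] makes it the Dirac mass at
    0. *)
Definition poisson_weight (R : realType) (r : R) (k : nat) : R :=
  r ^+ k * k`!%:R^-1 * expR (- r).

Lemma measurable_poisson_weight (R : realType) k :
  measurable_fun setT (fun r : R => poisson_weight r k).
Proof.
apply: measurable_funM; first by apply: measurable_funM => //; exact: measurable_funX.
by apply: (measurableT_comp (@measurable_expR R)); exact: measurable_funN.
Qed.

Section poisson_moments.
Context {R : realType}.
Local Open Scope ereal_scope.
Variables (r : R) (r0 : (0 <= r)%R).

Let p (k : nat) : R := poisson_weight r k.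

Lemma poisson_weight_ge0 k : (0 <= poisson_weight r k)%R.
Proof. by rewrite /poisson_weight !mulr_ge0 ?exprn_ge0 ?expR_ge0. Qed.
Let p0 := poisson_weight_ge0.

Lemma poisson_prob_set1 c k : poisson_prob r c [set k] = (poisson_weight r k)%:E.
Proof.
rewrite /poisson_prob /poisson_weight; case: ifPn => [rp|].
  by rewrite esum_set1 ?lee_fin ?poisson_pmf_ge0// /poisson_pmf rp.
rewrite -leNgt => rn; have -> : r = 0%R by apply/eqP; rewrite eq_le rn r0.
rewrite oppr0 expR0 mulr1 diracE; case: k => [|k].
  by rewrite expr0 fact0 invr1 mulr1 mem_set.
by rewrite expr0n/= mul0r memNset.
Qed.

Let sum_p : \sum_(k <oo) (p k)%:E = 1.
Proof.
rewrite (_ : 1 = (expR (- r))%:E * (expR r)%:E); last first.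
  by rewrite -EFinM expRN mulVf ?gt_eqF ?expR_gt0.
under eq_eseriesr => n _ do rewrite /p /poisson_weight EFinM muleC.
rewrite nneseriesZl/=; last by move=> n _; rewrite lee_fin divr_ge0// exprn_ge0.
congr *%E; rewrite expRE -EFin_lim; last first.
  rewrite /pseries/=; under eq_fun do rewrite mulrC.
  exact: is_cvg_series_exp_coeff.
apply/congr_lim/funext => n/=; rewrite /pseries/= /series/= -sumEFin//.
by under eq_bigr do rewrite mulrC.
Qed.

Let pS k : (k.+1%:R * p k.+1 = r * p k)%R.
Proof.
rewrite /p /poisson_weight exprS factS natrM invfM.
have k0 : (k.+1%:R != 0 :> R)%R by rewrite pnatr_eq0.
have f0 : (k`!%:R != 0 :> R)%R by rewrite pnatr_eq0 -lt0n fact_gt0.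
by move: k0 f0; move: (k.+1%:R : R) (k`!%:R : R) => x y x0 y0; field; rewrite x0 y0.
Qed.

(** From k p(k) = r p(k - 1): a factor [k] is traded for a factor [r] and a shift of the index. Both
    Poisson moments come from this. *)
Let shift (g : nat -> R) : (forall k, 0 <= g k)%R ->
  \sum_(k <oo) (g k * (k%:R * p k))%R%:E = \sum_(k <oo) (g k.+1 * (r * p k))%R%:E.
Proof.
move=> g0; rewrite nneseries_recl//; last first.
  by move=> k _; rewrite lee_fin mulr_ge0// mulr_ge0.
rewrite mul0r mulr0 add0e -(@nneseries_addn _ (fun k => (g k * (k%:R * p k))%R%:E) 1); last first.
  by move=> k; rewrite lee_fin mulr_ge0// mulr_ge0.
by apply: eq_eseriesr => k _; rewrite addn1 pS.
Qed.

Lemma poisson_mean : \sum_(k <oo) (k%:R * poisson_weight r k)%:E = r%:E.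
Proof.
under eq_eseriesr => k _ do rewrite -/(p k) -[(k%:R * _)%R]mul1r.
rewrite (shift (fun=> ler01)); under eq_eseriesr => k _ do rewrite mul1r EFinM.
by rewrite nneseriesZl ?sum_p ?mule1// => k _; rewrite lee_fin.
Qed.

Lemma poisson_second_moment :
  \sum_(k <oo) (k%:R ^+ 2 * poisson_weight r k)%:E = (r ^+ 2 + r)%:E.
Proof.
under eq_eseriesr => k _ do rewrite -/(p k) expr2 -mulrA.
rewrite shift//.
have E k : (k.+1%:R * (r * p k))%:E = r%:E * (k%:R * p k)%:E + r%:E * (p k)%:E.
  by rewrite -!EFinM -EFinD -natr1; congr EFin; ring.
under eq_eseriesr => k _ do rewrite E.
rewrite nneseriesD; first last.
- by move=> k _ _; rewrite -EFinM lee_fin mulr_ge0.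
- by move=> k _ _; rewrite -EFinM lee_fin mulr_ge0// mulr_ge0.
rewrite !nneseriesZl//; first last.
- by move=> k _; rewrite lee_fin mulr_ge0.
- by move=> k _; rewrite lee_fin.
by rewrite sum_p poisson_mean mule1 -EFinM -EFinD expr2.
Qed.

End poisson_moments.

Section null_means.
Context d (T : measurableType d) (R : realType) (mu : {measure set T -> \bar R}).
Variables (A : set T) (mA : measurable A).

(** Integrability is included, so these functions form a vector space and moment identities can be
    combined linearly without side conditions. *)
Definition null_mean (f : T -> R) : Prop :=
  mu.-integrable A (EFin \o f) /\ \int[mu]_(w in A) f w = 0.

Lemma null_mean0 : null_mean (fun=> 0).
Proof. by split; [exact: integrable0|rewrite /Rintegral integral0_eq]. Qed.

Lemma null_meanD f g : null_mean f -> null_mean g -> null_mean (fun w => f w + g w).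
Proof.
move=> [iF f0] [ig g0]; split; first exact: (integrableD mA iF ig).
by rewrite RintegralD// f0 g0 addr0.
Qed.

Lemma null_meanZ c f : null_mean f -> null_mean (fun w => c * f w).
Proof.
move=> [iF f0]; split; last by rewrite RintegralZl// f0 mulr0.
by rewrite (_ : _ \o _ = (fun w => c%:E * (f w)%:E)%E)//; exact: integrableZl.
Qed.

Lemma null_mean_sum (I : Type) (s : seq I) (Q : pred I) (f : I -> T -> R) :
  (forall i, Q i -> null_mean (f i)) -> null_mean (fun w => \sum_(i <- s | Q i) f i w).
Proof.
move=> h; elim: s => [|i s IH].
  by under eq_fun do rewrite big_nil; exact: null_mean0.
under eq_fun do rewrite big_cons; have [Qi|//] := boolP (Q i).
by apply: null_meanD => //; exact: h.
Qed.

Lemma null_mean_eq f g : (forall w, f w = g w) -> null_mean f -> null_mean g.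
Proof. by move=> /funext ->. Qed.

End null_means.

Section cox_increments.
Context d (Omega : measurableType d) (R : realType) (P : probability Omega R).
Variables (eta : Omega -> cumulative R R) (rho : {measure set (R * R) -> \bar R}).
Variable N : R -> Omega -> nat.
Let etap := fun u w => eta w u.
Hypothesis addE : additive_process P etap rho.
Hypothesis coxN : cox_process P N etap.

Let meta u : measurable_fun setT (etap u).
Proof. by have [m _ _ _ _] := addE; exact: (m u). Qed.

Lemma measurable_cox u : 0 <= u -> measurable_fun setT (N u).
Proof. by case: coxN => -[m _ _ _] _; exact: m. Qed.

Lemma cox_homo w u v : 0 <= u -> u <= v -> (N u w <= N v w)%N.
Proof. by case: coxN => -[_ _ h _] _; exact: h. Qed.

Let etaB_ge0 w a b : a <= b -> 0 <= eta w b - eta w a.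
Proof. by move=> ab; rewrite subr_ge0; exact: cumulative_is_nondecreasing. Qed.

Let count (a b : R) (w : Omega) : R := (N b w)%:R - (N a w)%:R.
Let mass (a b : R) (w : Omega) : R := eta w b - eta w a.

Let sig_sub : sigma_gen `[0, +oo[ etap `<=` measurable.
Proof. by apply: sigma_gen_sub; apply: gen_measurable => i _; exact: meta. Qed.

Let mmass a b : measurable_fun setT (mass a b).
Proof. by apply: measurable_funB; exact: meta. Qed.

Let mcount a b : 0 <= a -> 0 <= b -> measurable_fun setT (count a b).
Proof.
move=> a0 b0; have h u : 0 <= u -> measurable_fun setT (fun w => (N u w)%:R : R).
  by move=> u0; apply: (measurableT_comp (f := (fun n : nat => n%:R : R))) => //; exact: measurable_cox.
by apply: measurable_funB; exact: h.
Qed.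

(** The Cox property for the single interval (a, b], summed over the values [k] of the increment.
    The event [A] belongs to [eta], since conditional probabilities given [eta] can be integrated
    over such events only. *)
Lemma cox_increment_sum (A : set Omega) (a b : R) (g : nat -> R) :
  sigma_gen `[0, +oo[ etap A -> 0 <= a -> a <= b -> (forall k, 0 <= g k) ->
  (\int[P]_(w in A) (g (N b w - N a w)%N)%:E =
   \int[P]_(w in A) \sum_(k <oo) (g k * poisson_weight (mass a b w) k)%:E)%E.
Proof.
move=> sA a0 ab g0; have mA := sig_sub sA; have b0 := le_trans a0 ab.
pose u i : R := if i is 0%N then a else b.
have hu : {homo u : i j / (i <= j)%N >-> i <= j} by case=> [|i] [|j].
pose C k := [set w | forall i, (i < 1)%N -> N (u i.+1) w = (N (u i) w + k)%N].
have CE k w : C k w <-> (N b w - N a w)%N = k.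
  split=> [/(_ 0%N isT)/= ->|<- [|//] _ /=]; first by rewrite addKn.
  by rewrite subnKC//; exact: cox_homo.
have mC k : measurable (C k).
  have -> : C k = (count a b) @^-1` [set k%:R].
    apply/seteqP; split => w /=.
      move/CE => <-; rewrite /count natrB//; exact: cox_homo.
    rewrite /count -natrB; last exact: cox_homo.
    by move=> /eqP; rewrite eqr_nat => /eqP h; exact/CE.
  by rewrite -(setTI (_ @^-1` _)); exact: mcount.
have IC k : (\int[P]_(w in A) (\1_(C k) w)%:E = \int[P]_(w in A) (poisson_weight (mass a b w) k)%:E)%E.
  case: coxN => _ /(_ 1%N u (fun=> k) a0 hu)[_ _ _ _ /(_ A sA)] <-.
  by apply: eq_integral => w _; rewrite big_ord1 poisson_prob_set1//; exact: etaB_ge0.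
transitivity (\int[P]_(w in A) \sum_(k <oo) ((g k)%:E * (\1_(C k) w)%:E))%E.
  apply: eq_integral => w _.
  rewrite (@nneseriesD1 _ _ (N b w - N a w)%N)//; last by move=> k _; rewrite -EFinM lee_fin mulr_ge0.
  rewrite eseries0 ?adde0; first by rewrite indicE mem_set ?mule1//; exact/CE.
  move=> k _ /= kn; rewrite indicE memNset ?mule0// => /CE kE.
  by rewrite kE eqxx in kn.
rewrite integral_nneseries//; first last.
- by move=> k w _; rewrite -EFinM lee_fin mulr_ge0.
- move=> k; apply/measurable_EFinP; apply: measurable_funM => //.
have mw k : measurable_fun A (fun w => poisson_weight (mass a b w) k).
  by apply: measurable_funTS; exact: (measurableT_comp (measurable_poisson_weight k) (mmass a b)).
have w0 k w : 0 <= poisson_weight (mass a b w) k by apply: poisson_weight_ge0; exact: etaB_ge0.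
rewrite integral_nneseries//; first last.
- by move=> k w _; rewrite lee_fin mulr_ge0.
- by move=> k; apply/measurable_EFinP; exact: measurable_funM.
apply: eq_eseriesr => k _; rewrite ge0_integralZl//;
  [|by apply/measurable_EFinP; apply: measurable_funTS; exact: measurable_indic|by rewrite lee_fin].
rewrite IC; under [RHS]eq_integral do rewrite EFinM.
by rewrite ge0_integralZl//; [exact/measurable_EFinP|move=> w _; rewrite lee_fin|rewrite lee_fin].
Qed.

Variables (A : set Omega) (a b K : R).
Hypothesis sA : sigma_gen `[0, +oo[ etap A.

Let mA : measurable A. Proof. exact: sig_sub. Qed.

Let bounded_int (f : Omega -> R) C : (forall w, A w -> `|f w| <= C ) -> measurable_fun setT f ->
  P.-integrable A (EFin \o f).
Proof.
move=> fC mf; apply: (@bounded_integrable _ _ _ _ _ _ C) => //.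
- by rewrite (le_lt_trans (probability_le1 _ _))// ltry.
- exact: measurable_funTS.
Qed.

Hypothesis AK : forall w, A w -> eta w b - eta w a <= K.

Let massK u v w : a <= u -> u <= v -> v <= b -> A w -> `|mass u v w| <= K.
Proof.
move=> au uv vb /AK; apply: le_trans; rewrite ger0_norm ?etaB_ge0//.
by apply: lerB; exact: cumulative_is_nondecreasing.
Qed.

Let imass u v : a <= u -> u <= v -> v <= b -> P.-integrable A (EFin \o mass u v).
Proof. by move=> au uv vb; apply: (@bounded_int _ K) => // w; exact: massK. Qed.

Let imass2 u v : a <= u -> u <= v -> v <= b ->
  P.-integrable A (EFin \o (fun w => mass u v w ^+ 2)).
Proof.
move=> au uv vb; apply: (@bounded_int _ (K ^+ 2)).
  move=> w Aw; rewrite normrX; apply: lerXn2r; rewrite ?nnegrE//; last exact: massK.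
  exact: le_trans (massK au uv vb Aw).
exact: measurable_funX.
Qed.

Hypothesis a0 : 0 <= a.

Let countE u v w : 0 <= u -> u <= v -> count u v w = (N v w - N u w)%:R.
Proof. by move=> u0 uv; rewrite /count natrB//; exact: cox_homo. Qed.

(** The bound [K] on the mass over [A] makes the moments finite, so the Poisson second moment r^2 +
    r can be subtracted. *)
Lemma cox_sqr u v : a <= u -> u <= v -> v <= b ->
  P.-integrable A (EFin \o (fun w => count u v w ^+ 2)) /\
  null_mean P A (fun w => count u v w ^+ 2 - mass u v w ^+ 2 - mass u v w).
Proof.
move=> au uv vb; have u0 := le_trans a0 au; have v0 := le_trans u0 uv.
have H := cox_increment_sum sA u0 uv (fun k => sqr_ge0 (k%:R : R)).
have E : (\int[P]_(w in A) (count u v w ^+ 2)%:E =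
          \int[P]_(w in A) (mass u v w ^+ 2 + mass u v w)%:E)%E.
  under eq_integral do rewrite countE//.
  rewrite H; apply: eq_integral => w _; apply: poisson_second_moment; exact: etaB_ge0.
have im := integrableD mA (imass2 au uv vb) (imass au uv vb).
have ic : P.-integrable A (EFin \o (fun w => count u v w ^+ 2)).
  apply/integrableP; split.
    by apply/measurable_EFinP/measurable_funTS/measurable_funX; exact: mcount.
  under eq_integral do rewrite abse_EFin ger0_norm ?sqr_ge0//.
  by rewrite E ltey_eq (integrable_fin_num mA im).
split => //; apply: (@null_mean_eq _ _ _ _ _ (fun w => count u v w ^+ 2 - (mass u v w ^+ 2 + mass u v w))).
  by move=> w; ring.
split; first exact: (integrableB mA ic im).
by rewrite RintegralB// /Rintegral E subrr.
Qed.

Lemma cox_lin u v : a <= u -> u <= v -> v <= b ->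
  null_mean P A (fun w => count u v w - mass u v w).
Proof.
move=> au uv vb; have u0 := le_trans a0 au; have v0 := le_trans u0 uv.
have H := cox_increment_sum sA u0 uv (fun k => ler0n R k).
have E : (\int[P]_(w in A) (count u v w)%:E = \int[P]_(w in A) (mass u v w)%:E)%E.
  under eq_integral do rewrite countE//.
  rewrite H; apply: eq_integral => w _; apply: poisson_mean; exact: etaB_ge0.
have im := imass au uv vb.
have ic : P.-integrable A (EFin \o (count u v)).
  apply/integrableP; split; first by apply/measurable_EFinP/measurable_funTS; exact: mcount.
  under eq_integral => w _ do rewrite abse_EFin countE// ger0_norm// -countE//.
  by rewrite E ltey_eq (integrable_fin_num mA im).
split; first exact: (integrableB mA ic im).
by rewrite RintegralB// /Rintegral E subrr.
Qed.

Section grid.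
Variables (u : nat -> R) (n : nat).
Hypotheses (hu : {homo u : i j / (i <= j)%N >-> i <= j}) (ua : a <= u 0%N) (ub : u n <= b).

Let x i := count (u i) (u i.+1).
Let l i := mass (u i) (u i.+1).

Let uge i : a <= u i. Proof. by apply: (le_trans ua); exact: hu. Qed.
Let ule i : (i <= n)%N -> u i <= b. Proof. by move=> hi; apply: le_trans ub; exact: hu. Qed.

Let Z i j w := count (u i) (u j) w ^+ 2 - mass (u i) (u j) w ^+ 2 - mass (u i) (u j) w.

Let nZ i j : (i <= j)%N -> (j <= n)%N -> null_mean P A (Z i j).
Proof. by move=> ij jn; apply: (cox_sqr _ _ _).2; [exact: uge|exact: hu|exact: ule]. Qed.

(* polarization: the product of two increments is a combination of squares of
   increments over longer intervals *)
Let cross i j : (i < n)%N -> (j < n)%N ->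
  null_mean P A (fun w => x i w * x j w - l i w * l j w - (i == j)%:R * l i w).
Proof.
wlog : i j / (i <= j)%N => [h i1 j1|].
  have [ij|ji] := leqP i j; first exact: h.
  apply: null_mean_eq (h j i (ltnW ji) j1 i1) => w.
  by rewrite (ltn_eqF ji) (gtn_eqF ji) /=; ring.
rewrite leq_eqVlt => /predU1P[<- i1 _|ij i1 j1].
  by rewrite eqxx; apply: null_mean_eq (nZ (leqnSn i) i1) => w; rewrite /Z mul1r !expr2.
rewrite (ltn_eqF ij).
have h1 := nZ (leqW (ltnW ij)) j1; have h2 := nZ (ltnW ij) (ltnW j1).
have h3 := nZ (leqW ij) j1; have h4 := nZ ij (ltnW j1).
have := null_meanZ mA 2^-1 (null_meanD mA (null_meanD mA h1 (null_meanZ mA (-1) h2))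
  (null_meanD mA (null_meanZ mA (-1) h3) h4)).
by apply: null_mean_eq => w; rewrite /Z /x /l /count /mass /=; field.
Qed.

(** The second Campbell formula on a grid: the two squares expand into double sums matched by
    [cross], whose diagonal correction gives the linear term. *)
Lemma cox_grid_sqr (c : nat -> R) : null_mean P A (fun w =>
  (\sum_(i < n) c i * x i w) ^+ 2 - (\sum_(i < n) c i * l i w) ^+ 2 - \sum_(i < n) c i ^+ 2 * l i w).
Proof.
apply: (@null_mean_eq _ _ _ _ _ (fun w => \sum_(i < n) \sum_(j < n)
    (c i * c j) * (x i w * x j w - l i w * l j w - (i == j :> nat)%:R * l i w))).
  move=> w; rewrite !expr2 !mulr_suml -!sumrB; apply: eq_bigr => i _.
  rewrite !mulr_sumr -sumrB (bigD1 i)//= [in RHS](bigD1 i)//= eqxx.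
  rewrite [RHS]addrAC; congr (_ + _); first by rewrite /=; ring.
  apply: eq_bigr => j ji; rewrite (_ : (i == j :> nat) = false); first by rewrite /=; ring.
  by rewrite eq_sym; exact/negbTE.
apply: null_mean_sum => // i _; apply: null_mean_sum => // j _.
by apply: null_meanZ => //; exact: cross.
Qed.

Lemma cox_grid_lin (c : nat -> R) : null_mean P A (fun w =>
  \sum_(i < n) c i * x i w - \sum_(i < n) c i * l i w).
Proof.
apply: (@null_mean_eq _ _ _ _ _ (fun w => \sum_(i < n) c i * (x i w - l i w))).
  by move=> w; rewrite -sumrB; apply: eq_bigr => i _; rewrite mulrBr.
apply: null_mean_sum => // i _; apply: null_meanZ => //; apply: cox_lin.
- exact: uge.
- exact: hu.
- exact: ule.
Qed.

End grid.

End cox_increments.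

(** * Arrival times and sums over arrivals *)

Section arrivals.
Context {R : realType} d (Omega : measurableType d).
Variable N : R -> Omega -> nat.
Hypothesis cN : counting_process N.
Implicit Types (u v : R) (j : nat) (w : Omega).

Let homoN w u v : 0 <= u -> u <= v -> (N u w <= N v w)%N.
Proof. by case: cN => _ _ h _; exact: h. Qed.

(** If [N u w < j], right-continuity of an integer-valued path keeps [N] constant on some interval
    [u, u + e). All times with [j <= N v w] are then at least u + e, and so is their infimum. *)
Lemma arrival_leE u j w : 0 <= u -> (arrival N j w <= u%:E)%E = (j <= N u w)%N.
Proof.
move=> u0; apply/idP/idP => [|ju]; last first.
  by apply: ereal_inf_lbound; exists u.
rewrite leqNgt; apply: contraTN => uj; rewrite -ltNge.
have h : N v w @[v --> u^'+] --> N u w by case: cN => _ _ _; exact.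
move/discrete_cvg : h; rewrite /at_right/= => -[e /= e0 He].
apply: (@lt_le_trans _ _ (u + e)%:E); first by rewrite lte_fin ltrDl.
apply: le_ereal_inf_tmp => _ [v [v0 jv] <-].
rewrite lee_fin leNgt; apply/negP => ve.
have [vu|uv] := leP v u.
  by have := leq_trans jv (homoN w v0 vu); rewrite leqNgt uj.
have := He v; rewrite /ball/= => /(_ _ uv) H.
move: jv; rewrite H; first by rewrite leqNgt uj.
by rewrite distrC ger0_norm ?subr_ge0 ?ltrBlDl// ltW.
Qed.

Definition arrival_time j w : R := fine (arrival N j w).

Lemma arrival_ge0 j w : (0 <= arrival N j w)%E.
Proof. by apply: le_ereal_inf_tmp => _ [v [v0 _] <-]; rewrite lee_fin. Qed.

Lemma arrival_fineK u j w : 0 <= u -> (j <= N u w)%N ->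
  (arrival_time j w)%:E = arrival N j w.
Proof.
move=> u0 ju; rewrite fineK// ge0_fin_numE ?arrival_ge0//.
by apply: (@le_lt_trans _ _ u%:E); rewrite ?ltry// arrival_leE.
Qed.

Lemma arrival_time_ge0 j w : 0 <= arrival_time j w.
Proof. by rewrite fine_ge0// arrival_ge0. Qed.

(** [j <= N U w] guarantees a finite arrival; for an infinite one [fine] returns 0 and the equality
    would fail. *)
Lemma arrival_time_le U u j w : 0 <= U -> (j <= N U w)%N -> 0 <= u ->
  (arrival_time j w <= u) = (j <= N u w)%N.
Proof. by move=> U0 jU u0; rewrite -lee_fin (arrival_fineK U0 jU) arrival_leE. Qed.

(** The integral of [f] against [N] over (a, b]: by [points_itv] the indices are those of the
    arrivals in this interval, simultaneous ones included. *)
Definition points_sum (f : R -> R) (a b : R) (w : Omega) : R :=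
  \sum_((N a w).+1 <= j < (N b w).+1) f (arrival_time j w).

Lemma points_itv a b j w : 0 <= a -> 0 <= b -> ((N a w).+1 <= j < (N b w).+1)%N ->
  a < arrival_time j w <= b.
Proof.
move=> a0 b0 /andP[ja jb]; rewrite (arrival_time_le b0)// -ltnS jb andbT.
by rewrite ltNge (arrival_time_le b0)// -ltnNge.
Qed.

Lemma points_sum_indic a b u v w : 0 <= a -> a <= u -> u <= v -> v <= b ->
  points_sum \1_(`]u, v]) a b w = (N v w)%:R - (N u w)%:R.
Proof.
move=> a0 au uv vb; have u0 := le_trans a0 au; have v0 := le_trans u0 uv.
have b0 := le_trans v0 vb.
have Nau := homoN w a0 au; have Nuv := homoN w u0 uv; have Nvb := homoN w v0 vb.
rewrite /points_sum (@big_cat_nat _ _ _ (N u w).+1)//=; last by rewrite ltnS (leq_trans Nuv).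
rewrite (@big_cat_nat _ _ _ (N v w).+1 (N u w).+1)//=.
have E j : (j <= N b w)%N -> \1_(`]u, v]) (arrival_time j w) = ((N u w < j)%N && (j <= N v w)%N)%:R :> R.
  move=> jb; rewrite indicE; congr (nat_of_bool _)%:R; rewrite mem_setE/= in_itv/=.
  by rewrite (arrival_time_le b0)// ltNge (arrival_time_le b0)// ltnNge.
rewrite [X in X + _]big_nat_cond big1 ?add0r; last first.
  move=> j; rewrite andbT ltnS => /andP[_ ju]; rewrite E ?(leq_trans ju) ?(leq_trans Nuv)//.
  by rewrite ltnNge ju.
rewrite [X in _ + X]big_nat_cond [X in _ + X]big1 ?addr0; last first.
  move=> j; rewrite andbT ltnS => /andP[vj jb]; rewrite E//.
  by rewrite [(j <= N v w)%N]leqNgt vj andbF.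
rewrite (@eq_big_nat _ _ _ _ _ _ (fun=> 1)); last first.
  move=> j /andP[uj jv]; rewrite E; first by rewrite uj -ltnS jv.
  by rewrite -ltnS (leq_trans jv).
by rewrite big_const_nat subSS iter_addr_0 natrB.
Qed.

Lemma points_sum_step a b n f w : 0 <= a -> a <= b ->
  points_sum (step a b n f) a b w =
  \sum_(i < n.+1) f (gridpt a b n i) * ((N (gridpt a b n i.+1) w)%:R - (N (gridpt a b n i) w)%:R).
Proof.
move=> a0 ab; rewrite /points_sum /step exchange_big/=; apply: eq_bigr => i _.
rewrite -mulr_sumr; congr (_ * _); apply: points_sum_indic => //.
- exact: gridpt_ge.
- exact: gridpt_homo.
- exact: gridpt_le.
Qed.

Lemma points_sum_step_cvg a b f w : 0 <= a -> a <= b -> continuous f ->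
  points_sum (step a b n f) a b w @[n --> \oo] --> points_sum f a b w.
Proof.
move=> a0 ab cf; rewrite /points_sum [X in _ --> X]big_nat_cond.
under eq_fun do rewrite big_nat_cond.
apply: cvg_big => [|j]; first exact: add_continuous.
rewrite andbT => jab; apply: step_cvg => //.
exact: (points_itv a0 (le_trans a0 ab)).
Qed.

End arrivals.

Lemma cvg_sqr (T : Type) (F : set_system T) {FF : Filter F} (R : realType) (f : T -> R) (l : R) :
  f x @[x --> F] --> l -> f x ^+ 2 @[x --> F] --> l ^+ 2.
Proof. by move=> fl; rewrite expr2; under eq_fun do rewrite expr2; exact: cvgM. Qed.

Lemma norm_increment_sum_le (R : realType) (c u : nat -> R) n C :
  (forall i, (i < n)%N -> `|c i| <= C) -> {homo u : i j / (i <= j)%N >-> i <= j} ->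
  `|\sum_(i < n) c i * (u i.+1 - u i)| <= C * (u n - u 0%N).
Proof.
move=> cC hu; apply: (le_trans (ler_norm_sum _ _ _)).
rewrite -(telescope_sumr u (leq0n n)) mulr_sumr big_mkord; apply: ler_sum => i _.
have ui : 0 <= u i.+1 - u i by rewrite subr_ge0 hu.
by rewrite normrM (ger0_norm ui) ler_wpM2r// cC.
Qed.

Lemma exhaustion_mean0 d (T : measurableType d) (R : realType) (mu : {measure set T -> \bar R})
    (F : nat -> set T) (g : T -> R) : nondecreasing_seq F -> (forall n, measurable (F n)) ->
  \bigcup_n F n = setT -> mu.-integrable setT (EFin \o g) ->
  (forall n, \int[mu]_(w in F n) g w = 0) -> \int[mu]_w g w = 0.
Proof.
move=> nF mF FT ig g0; have [mg _] := integrableP _ _ _ ig.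
have [||||_ c] := @Rdominated_convergence _ _ _ mu setT measurableT
  (fun n w => g w * \1_(F n) w) g (fun w => `|g w|).
- by move=> n; apply: measurable_funM; [exact/measurable_EFinP|exact: measurable_indic].
- move=> w _; have [k _ Fk] : (\bigcup_n F n) w by rewrite FT.
  rewrite -[X in _ --> X]mulr1; apply: cvgMr; apply: cvg_near_cst.
  exists k => // n /= kn; rewrite indicE mem_set//.
  by move: (nF _ _ kn); rewrite subsetEset; apply.
- exact: integrable_norm.
- by move=> n w _; rewrite normrM indicE; case: (_ \in _); rewrite ?normr1 ?mulr1 ?normr0 ?mulr0.
suff E n : \int[mu]_w (g w * \1_(F n) w) = 0.
  rewrite (_ : (fun n => \int[mu]_x (g x * \1_(F n) x)) = (fun=> 0)) in c; last exact/funext.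
  exact: (cvg_unique _ c (cvg_cst _)).
rewrite -(g0 n) /Rintegral [in RHS]integral_mkcond; congr fine; apply: eq_integral => w _.
by rewrite patchE indicE; case: ifPn => _; rewrite ?mulr1// mulr0.
Qed.

Section campbell.
Context d (Omega : measurableType d) (R : realType) (P : probability Omega R).
Variables (eta : Omega -> cumulative R R) (rho : {measure set (R * R) -> \bar R}).
Variable N : R -> Omega -> nat.
Let etap := fun u w => eta w u.
Hypothesis addE : additive_process P etap rho.
Hypothesis coxN : cox_process P N etap.
Variables (a b : R).
Hypotheses (a0 : 0 <= a) (ab : a <= b).

Let cN : counting_process N. Proof. by case: coxN. Qed.
Let b0 : 0 <= b. Proof. exact: le_trans ab. Qed.

(** [F] is left free because the sum must be measurable also with respect to the future of [N] after
    [a]; hence only counts relative to [N a w] enter the hypothesis. *)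
Lemma measurable_points_sum (F : set (set Omega)) (f : R -> R) : continuous f ->
  (forall u, a <= u <= b ->
    measurable_fun setT ((fun w => (N u w)%:R - (N a w)%:R) : g_sigma_algebraType F -> R)) ->
  measurable_fun setT (points_sum N f a b : g_sigma_algebraType F -> R).
Proof.
move=> cf mF; apply: (@measurable_fun_cvg _ _ _ _
  (fun n => (points_sum N (step a b n f) a b : g_sigma_algebraType F -> R))); last first.
  by move=> w _; exact: points_sum_step_cvg.
move=> n; rewrite (funext (fun w => points_sum_step cN n f w a0 ab)).
apply: measurable_sum => i; apply: measurable_funM => //.
have E : (fun w => (N (gridpt a b n i.+1) w)%:R - (N (gridpt a b n i) w)%:R) =
    (fun w => ((N (gridpt a b n i.+1) w)%:R - (N a w)%:R) - ((N (gridpt a b n i) w)%:R - (N a w)%:R)) :> (_ -> R).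
  by apply/funext => w; ring.
rewrite E; apply: measurable_funB; apply: mF; rewrite gridpt_ge//= gridpt_le// ltnW// ltnS//.
Qed.

Lemma measurable_points f : continuous f -> measurable_fun setT (points_sum N f a b).
Proof.
move=> cf; have := @measurable_points_sum measurable f cf.
have s : <<s (measurable : set (set Omega)) >> `<=` measurable by apply: sigma_gen_sub.
move=> h; have m : measurable_fun setT (points_sum N f a b : g_sigma_algebraType measurable -> R).
  apply: h => u /andP[au ub] _ B mB; rewrite setTI; apply: sub_sigma_algebra.
  rewrite -(setTI (_ @^-1` _)); apply: measurable_funB => //.
    apply: (measurableT_comp (f := (fun n : nat => n%:R : R))) => //.
    exact: (measurable_cox coxN (le_trans a0 au)).
  apply: (measurableT_comp (f := (fun n : nat => n%:R : R))) => //.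
  exact: (measurable_cox coxN a0).
by move=> mT B mB; apply: s; exact: m.
Qed.

Let mass w : R := eta w b - eta w a.

Let mass_ge0 w : 0 <= mass w.
Proof. by rewrite subr_ge0; exact: cumulative_is_nondecreasing. Qed.

Section truncated.
Variables (A : set Omega) (K : R).
Hypothesis sA : sigma_gen `[0, +oo[ etap A.
Hypothesis AK : forall w, A w -> mass w <= K.
Variables (f : R -> R) (cf : continuous f).

Let mA : measurable A.
Proof.
apply: (sigma_gen_sub _ sA); apply: gen_measurable => u _.
by have [m _ _ _ _] := addE; exact: m.
Qed.

Let g n i := gridpt a b n i.
Let gh n := gridpt_homo ab n.
Let Rn n w := \sum_(i < n.+1) f (g n i) * ((N (g n i.+1) w)%:R - (N (g n i) w)%:R).
Let Jn (h : R -> R) n w := \sum_(i < n.+1) h (g n i) * (eta w (g n i.+1) - eta w (g n i)).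

Let gl n : g n 0%N = a. Proof. exact: gridpt0. Qed.
Let gr n : g n n.+1 = b. Proof. exact: gridptS. Qed.

Let count w : R := (N b w)%:R - (N a w)%:R.

Let Rn_cvg w : Rn n w @[n --> \oo] --> points_sum N f a b w.
Proof. by rewrite /Rn; under eq_fun do rewrite -(points_sum_step cN)//; exact: points_sum_step_cvg. Qed.

Let Jn_cvg h w : continuous h -> Jn h n w @[n --> \oo] --> int_eta eta h a b w.
Proof. by move=> ch; exact: int_eta_cvg. Qed.

Let grid_in n i : (i < n.+1)%N -> a <= g n i <= b.
Proof. by move=> i1; rewrite gridpt_ge//= gridpt_le// ltnW. Qed.

Let Rn_le n w C : (forall x, a <= x <= b -> `|f x| <= C) -> `|Rn n w| <= C * count w.
Proof.
move=> fC; rewrite /count -{1}(gr n) -(gl n).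
apply: (@norm_increment_sum_le _ (fun i => f (g n i)) (fun i => (N (g n i) w)%:R)).
  by move=> i i1; apply: fC; exact: grid_in.
move=> i j ij; rewrite ler_nat; apply: (cox_homo coxN); last exact: gh.
exact: le_trans (gridpt_ge _ _ _).
Qed.

Let Jn_le h n w C : (forall x, a <= x <= b -> `|h x| <= C) -> `|Jn h n w| <= C * mass w.
Proof.
move=> hC; rewrite /mass -{1}(gr n) -(gl n).
apply: (@norm_increment_sum_le _ (fun i => h (g n i)) (fun i => eta w (g n i))).
  by move=> i i1; apply: hC; exact: grid_in.
by move=> i j ij; apply: cumulative_is_nondecreasing; exact: gh.
Qed.

Let cf2 : continuous (fun x => f x ^+ 2).
Proof. by move=> x; apply: cvg_sqr; exact: cf. Qed.

Let icount2 : P.-integrable A (EFin \o (fun w => count w ^+ 2)).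
Proof. exact: (cox_sqr addE coxN sA AK a0 (lexx _) ab (lexx _)).1. Qed.

Let mcount : measurable_fun setT count.
Proof.
apply: measurable_funB; apply: (measurableT_comp (f := (fun n : nat => n%:R : R))) => //.
  exact: (measurable_cox coxN b0).
exact: (measurable_cox coxN a0).
Qed.

Let count_le w : 0 <= count w <= count w ^+ 2.
Proof.
rewrite /count -natrB; last exact: (cox_homo coxN).
by rewrite ler0n -natrX ler_nat -{1}[X in (X <= _)%N]expn1 /=; case: (_ - _)%N => // k; rewrite leq_pexp2l.
Qed.

Let icst (c : R) : P.-integrable A (EFin \o (fun=> c)).
Proof.
apply: (@bounded_integrable _ _ _ _ _ _ `|c|) => //.
by rewrite (le_lt_trans (probability_le1 _ _))// ltry.
Qed.

Let mRn n : measurable_fun setT (Rn n).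
Proof.
apply: measurable_sum => i; apply: measurable_funM => //.
apply: measurable_funB; apply: (measurableT_comp (f := (fun n : nat => n%:R : R))) => //.
  by apply: (measurable_cox coxN); exact: le_trans (gridpt_ge _ _ _).
by apply: (measurable_cox coxN); exact: le_trans (gridpt_ge _ _ _).
Qed.

Let mJn h n : measurable_fun setT (Jn h n).
Proof.
apply: measurable_sum => i; apply: measurable_funM => //.
by have [m _ _ _ _] := addE; apply: measurable_funB; exact: m.
Qed.

Let sqr_le (x y : R) : `|x| <= y -> x ^+ 2 <= y ^+ 2.
Proof.
move=> xy; rewrite -[leLHS]real_normK ?num_real//; apply: lerXn2r; rewrite ?nnegrE//.
exact: le_trans xy.
Qed.

(** [cox_grid_sqr] is exact on each grid, so the limit has zero mean once a dominating function is
    found; on [A] the count is square integrable and the mass at most [K]. *)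
Lemma campbell_truncated_sqr :
  P.-integrable A (EFin \o (fun w => points_sum N f a b w ^+ 2)) /\
  null_mean P A (fun w => points_sum N f a b w ^+ 2 - int_eta eta f a b w ^+ 2 -
                    int_eta eta (fun x => f x ^+ 2) a b w).
Proof.
have [C C0 fC] := continuous_bounded_itv a b cf.
have f2C x : a <= x <= b -> `|f x ^+ 2| <= C ^+ 2.
  by move=> /fC; rewrite normrX; apply: lerXn2r; rewrite nnegrE.
have iC2 : P.-integrable A (EFin \o (fun w => C ^+ 2 * count w ^+ 2)).
  exact: (integrableZl mA (C ^+ 2) icount2).
split.
  have [||||//] := @Rdominated_convergence _ _ _ P A mA (fun n w => Rn n w ^+ 2)
    (fun w => points_sum N f a b w ^+ 2) (fun w => C ^+ 2 * count w ^+ 2).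
  - by move=> n; apply: measurable_funTS; exact: measurable_funX.
  - by move=> w _; apply: cvg_sqr; exact: Rn_cvg.
  - exact: iC2.
  - move=> n w _; rewrite ger0_norm ?sqr_ge0// -exprMn; apply: sqr_le; exact: Rn_le.
(* The three terms of the dominating function bound the squared sum over the points, the squared
   integral of f and the integral of f^2, in this order. *)
have [||||i c] := @Rdominated_convergence _ _ _ P A mA
  (fun n w => Rn n w ^+ 2 - Jn f n w ^+ 2 - Jn (fun x => f x ^+ 2) n w)
  (fun w => points_sum N f a b w ^+ 2 - int_eta eta f a b w ^+ 2 -
                    int_eta eta (fun x => f x ^+ 2) a b w)
  (fun w => C ^+ 2 * count w ^+ 2 + ((C * K) ^+ 2 + C ^+ 2 * K)).
- move=> n; apply: measurable_funTS; apply: measurable_funB => //.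
  by apply: measurable_funB; exact: measurable_funX.
- move=> w _; apply: cvgB; last exact: Jn_cvg.
  by apply: cvgB; apply: cvg_sqr; [exact: Rn_cvg|exact: Jn_cvg].
- exact: (integrableD mA iC2 (icst _)).
- move=> n w Aw; have wK := AK Aw; have w0 := mass_ge0 w.
  apply: (le_trans (ler_normB _ _)); rewrite addrA; apply: lerD; last first.
    by apply: (le_trans (Jn_le n w f2C)); rewrite ler_wpM2l// sqr_ge0.
  apply: (le_trans (ler_normB _ _)); rewrite !ger0_norm ?sqr_ge0//; apply: lerD.
    by rewrite -exprMn; apply: sqr_le; exact: Rn_le.
  by apply: sqr_le; apply: (le_trans (Jn_le n w fC)); rewrite ler_wpM2l.
rewrite (_ : (fun n => \int[P]_(w in A)
    (Rn n w ^+ 2 - Jn f n w ^+ 2 - Jn (fun x => f x ^+ 2) n w)) = (fun=> 0)) in c.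
  by split => //; exact: (cvg_unique _ c (cvg_cst _)).
apply/funext => n.
have := (cox_grid_sqr addE coxN sA AK a0 (gh n) _ _ (fun i => f (g n i)) (n := n.+1)).2.
by apply; rewrite ?gridpt0 ?gridptS.
Qed.

Lemma campbell_truncated_lin :
  P.-integrable A (EFin \o points_sum N f a b) /\
  null_mean P A (fun w => points_sum N f a b w - int_eta eta f a b w).
Proof.
have [C C0 fC] := continuous_bounded_itv a b cf.
have icount : P.-integrable A (EFin \o count).
  apply: le_integrable icount2 => //; first exact/measurable_EFinP/measurable_funTS.
  by move=> w _ /=; have /andP[h1 h2] := count_le w; rewrite lee_fin !ger0_norm ?sqr_ge0.
have iC : P.-integrable A (EFin \o (fun w => C * count w)).
  exact: (integrableZl mA C icount).
split.
  have [||||//] := @Rdominated_convergence _ _ _ P A mA (fun n w => Rn n w)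
    (points_sum N f a b) (fun w => C * count w).
  - by move=> n; exact: measurable_funTS.
  - by move=> w _; exact: Rn_cvg.
  - exact: iC.
  - by move=> n w _; exact: Rn_le.
have [||||i c] := @Rdominated_convergence _ _ _ P A mA
  (fun n w => Rn n w - Jn f n w)
  (fun w => points_sum N f a b w - int_eta eta f a b w)
  (fun w => C * count w + C * K).
- by move=> n; apply: measurable_funTS; apply: measurable_funB.
- by move=> w _; apply: cvgB; [exact: Rn_cvg|exact: Jn_cvg].
- exact: (integrableD mA iC (icst _)).
- move=> n w Aw; have wK := AK Aw; have w0 := mass_ge0 w.
  apply: (le_trans (ler_normB _ _)); apply: lerD; first exact: Rn_le.
  by apply: (le_trans (Jn_le n w fC)); rewrite ler_wpM2l.
rewrite (_ : (fun n => \int[P]_(w in A) (Rn n w - Jn f n w)) = (fun=> 0)) in c.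
  by split => //; exact: (cvg_unique _ c (cvg_cst _)).
apply/funext => n.
have := (cox_grid_lin addE coxN sA AK a0 (gh n) _ _ (fun i => f (g n i)) (n := n.+1)).2.
by apply; rewrite ?gridpt0 ?gridptS.
Qed.

End truncated.

(** An event of [eta], as the Cox property requires, on which the mass is bounded. These events
    exhaust [Omega]. *)
Let trunc (k : nat) : set Omega := [set w | mass w <= k%:R].

Let trunc_sigma k : sigma_gen `[0, +oo[ etap (trunc k).
Proof.
have m u : 0 <= u -> measurable_fun setT (etap u : g_sigma_algebraType (gen `[0, +oo[ etap) -> R).
  by move=> u0; apply: measurable_gen => /=; rewrite in_itv/= u0.
have mm : measurable_fun setT (mass : g_sigma_algebraType (gen `[0, +oo[ etap) -> R).
  by apply: measurable_funB; exact: m.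
have := mm measurableT `]-oo, k%:R]%classic (measurable_itv _).
by rewrite setTI; congr (sigma_gen _ _ _); apply/seteqP; split => w /=; rewrite in_itv.
Qed.

Let mtrunc k : measurable (trunc k).
Proof.
apply: (sigma_gen_sub _ (trunc_sigma k)); apply: gen_measurable => u _.
by have [m _ _ _ _] := addE; exact: m.
Qed.

Let trunc_nd : nondecreasing_seq trunc.
Proof.
move=> m n mn; rewrite subsetEset => w /= h.
by apply: (le_trans h); rewrite ler_nat.
Qed.

Let trunc_cover : \bigcup_k trunc k = setT.
Proof.
apply/seteqP; split => // w _; exists (Num.truncn (mass w)).+1 => //=.
exact/ltW/truncnS_gt.
Qed.

(** Monotone convergence along the truncations gives an identity in [0, +oo], before any
    integrability is known. *)
Let exhaust (X Y : Omega -> R) : measurable_fun setT X -> measurable_fun setT Y ->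
  (forall w, 0 <= X w) -> (forall w, 0 <= Y w) ->
  (forall k, P.-integrable (trunc k) (EFin \o X) /\ null_mean P (trunc k) (fun w => X w - Y w)) ->
  (\int[P]_w (X w)%:E = \int[P]_w (Y w)%:E)%E.
Proof.
move=> mX mY X0 Y0 h.
have lim (Z : Omega -> R) : measurable_fun setT Z -> (forall w, 0 <= Z w) ->
    (\int[P]_(w in trunc k) (Z w)%:E @[k --> \oo] --> \int[P]_w (Z w)%:E)%E.
  move=> mZ Z0; rewrite -trunc_cover; apply: ge0_nondecreasing_set_cvg_integral => //.
  - by move=> k; apply/measurable_EFinP; exact: measurable_funTS.
  - by move=> k w _; rewrite lee_fin.
suff E k : (\int[P]_(w in trunc k) (X w)%:E = \int[P]_(w in trunc k) (Y w)%:E)%E.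
  have c := lim X mX X0; rewrite (eq_cvg _ _ E) in c.
  exact: (cvg_unique _ c (lim Y mY Y0)).
have [iX [iD D0]] := h k.
have iY : P.-integrable (trunc k) (EFin \o Y).
  rewrite (_ : EFin \o Y = (fun w => (X w)%:E - (X w - Y w)%:E)%E); first exact: integrableB.
  by apply/funext => w /=; rewrite -EFinB; congr EFin; ring.
rewrite RintegralB// in D0; move/eqP: D0; rewrite subr_eq0 => /eqP D0.
rewrite -[LHS]fineK ?(integrable_fin_num (mtrunc k) iX)//.
by rewrite -[RHS]fineK ?(integrable_fin_num (mtrunc k) iY)//; congr EFin.
Qed.

Let mJ h : continuous h -> measurable_fun setT (int_eta eta h a b).
Proof. by move=> ch; exact: (measurable_int_eta addE). Qed.

Let ctsX2 (f : R -> R) : continuous f -> continuous (fun x => f x ^+ 2).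
Proof. by move=> cf x; apply: cvg_sqr; exact: cf. Qed.

Let ctsN (f : R -> R) : continuous f -> continuous (fun x => `|f x|).
Proof. by move=> cf x; apply: cvg_norm; exact: cf. Qed.

Lemma campbell_ge0 (f : R -> R) : continuous f -> (forall x, 0 <= f x) ->
  (\int[P]_w (points_sum N f a b w)%:E = \int[P]_w (int_eta eta f a b w)%:E)%E.
Proof.
move=> cf f0; apply: exhaust.
- exact: measurable_points.
- exact: mJ.
- by move=> w; apply: sumr_ge0.
- by move=> w; exact: int_eta_ge0.
- by move=> k; exact: (@campbell_truncated_lin _ k%:R (trunc_sigma k)).
Qed.

(** Both sides may be infinite. Applied to |f|, this is the source of square integrability for sums
    with a signed f. *)
Lemma campbell_sqr_ge0 (f : R -> R) : continuous f -> (forall x, 0 <= f x) ->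
  (\int[P]_w (points_sum N f a b w ^+ 2)%:E =
   \int[P]_w (int_eta eta f a b w ^+ 2 + int_eta eta (fun x => f x ^+ 2) a b w)%:E)%E.
Proof.
move=> cf f0; apply: exhaust.
- by apply: measurable_funX; exact: measurable_points.
- apply: measurable_funD; last exact/mJ/ctsX2.
  by apply: measurable_funX; exact: mJ.
- by move=> w; exact: sqr_ge0.
- by move=> w; rewrite addr_ge0 ?sqr_ge0// int_eta_ge0// => x; exact: sqr_ge0.
- move=> k; have [h1 h2] := @campbell_truncated_sqr _ k%:R (trunc_sigma k) (fun w h => h) f cf.
  by split => //; apply: null_mean_eq h2 => w; ring.
Qed.

Section square_integrable.
Variables (f : R -> R) (cf : continuous f).
Hypothesis iJ2 : P.-integrable setT (EFin \o (fun w => int_eta eta (fun x => `|f x|) a b w ^+ 2)).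
Hypothesis iQ : P.-integrable setT (EFin \o int_eta eta (fun x => f x ^+ 2) a b).

Let points_le w : `|points_sum N f a b w| <= points_sum N (fun x => `|f x|) a b w.
Proof. exact: ler_norm_sum. Qed.

Lemma integrable_points_sum_sqr :
  P.-integrable setT (EFin \o (fun w => points_sum N f a b w ^+ 2)).
Proof.
have m := measurable_points (ctsN cf).
have i1 : P.-integrable setT (EFin \o (fun w => points_sum N (fun x => `|f x|) a b w ^+ 2)).
  apply/integrableP; split; first exact/measurable_EFinP/measurable_funX.
  under eq_integral do rewrite abse_EFin ger0_norm ?sqr_ge0//.
  rewrite campbell_sqr_ge0//; last exact: ctsN.
  have iS := integrableD measurableT iJ2 iQ.
  rewrite ltey_eq; apply/orP; left.
  have := integrable_fin_num measurableT iS; congr (_ \is a fin_num).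
  apply: eq_integral => w _ /=; rewrite EFinD; congr (_ + _%:E)%E.
  by congr (int_eta _ _ _ _ _); apply/funext => x; rewrite real_normK ?num_real.
apply: le_integrable i1 => //; first exact/measurable_EFinP/measurable_funX/measurable_points.
move=> w _ /=; rewrite lee_fin !ger0_norm ?sqr_ge0//.
rewrite -[leLHS]real_normK ?num_real//; apply: lerXn2r; rewrite ?nnegrE//.
by apply: sumr_ge0.
Qed.

Let iR : P.-integrable setT (EFin \o points_sum N f a b).
Proof. by apply: sqr_integrable_integrable; [exact: measurable_points|exact: integrable_points_sum_sqr]. Qed.

Let iJsqr : P.-integrable setT (EFin \o (fun w => int_eta eta f a b w ^+ 2)).
Proof.
apply: le_integrable iJ2 => //; first by apply/measurable_EFinP/measurable_funX; exact: mJ.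
move=> w _ /=; rewrite lee_fin !ger0_norm ?sqr_ge0//.
rewrite -[leLHS]real_normK ?num_real//; apply: lerXn2r; rewrite ?nnegrE ?int_eta_ge0//.
exact: int_eta_le_norm.
Qed.

Let iJ : P.-integrable setT (EFin \o int_eta eta f a b).
Proof. by apply: sqr_integrable_integrable; [exact: mJ|exact: iJsqr]. Qed.

Lemma campbell_mean :
  \int[P]_w points_sum N f a b w = \int[P]_w int_eta eta f a b w.
Proof.
apply/eqP; rewrite -subr_eq0 -RintegralB//; apply/eqP.
apply: (exhaustion_mean0 trunc_nd mtrunc trunc_cover).
  exact: (integrableB measurableT iR iJ).
by move=> k; exact: (@campbell_truncated_lin _ k%:R (trunc_sigma k) (fun w h => h) f cf).2.2.
Qed.

Lemma campbell_second_moment :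
  \int[P]_w (points_sum N f a b w ^+ 2) =
  \int[P]_w (int_eta eta f a b w ^+ 2) + \int[P]_w int_eta eta (fun x => f x ^+ 2) a b w.
Proof.
have iR2 := integrable_points_sum_sqr.
apply/eqP; rewrite -subr_eq0 opprD addrA -RintegralB// -RintegralB//; last first.
  exact: (integrableB measurableT iR2 iJsqr).
apply/eqP; apply: (exhaustion_mean0 trunc_nd mtrunc trunc_cover).
  exact: (integrableB measurableT (integrableB measurableT iR2 iJsqr) iQ).
by move=> k; exact: (@campbell_truncated_sqr _ k%:R (trunc_sigma k) (fun w h => h) f cf).2.2.
Qed.

End square_integrable.

End campbell.

(** * Past and future of a Cox process *)

Lemma measurable_nat2 d (T : measurableType d) (f : nat -> nat -> nat) (X Y : T -> nat) :
  measurable_fun setT X -> measurable_fun setT Y -> measurable_fun setT (fun w => f (X w) (Y w)).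
Proof.
move=> mX mY _ B _; rewrite setTI.
rewrite (_ : _ @^-1` B = \bigcup_j \bigcup_k (if f j k \in B then
    X @^-1` [set j] `&` Y @^-1` [set k] else set0)).
  apply: bigcup_measurable => j _; apply: bigcup_measurable => k _.
  case: ifP => // _; apply: measurableI.
    by rewrite -(setTI (_ @^-1` _)); exact: mX.
  by rewrite -(setTI (_ @^-1` _)); exact: mY.
apply/seteqP; split => [w /= Bw|w [j _ [k _]]].
  by exists (X w) => //; exists (Y w) => //; rewrite mem_set.
by case: ifP => // /set_mem fB [/= -> ->].
Qed.

Section cox_split.
Context d (Omega : measurableType d) (R : realType) (P : probability Omega R).
Variables (eta : Omega -> cumulative R R) (rho : {measure set (R * R) -> \bar R}).
Variable N : R -> Omega -> nat.
Let etap := fun u w => eta w u.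
Hypothesis addE : additive_process P etap rho.
Hypothesis coxN : cox_process P N etap.

(** The events whose conditional probabilities given the directing measure [cox_process]
    prescribes. *)
Definition count_cell (u : nat -> R) (m : nat) (k : nat -> nat) : set Omega :=
  [set w | forall i, (i < m)%N -> N (u i.+1) w = (N (u i) w + k i)%N].

Definition count_cells (u : nat -> R) (m : nat) : set (set Omega) :=
  range (count_cell u m).

Lemma count_cellE (u : nat -> R) (m : nat) (k : nat -> nat) w i :
  count_cell u m k w -> (i <= m)%N -> N (u i) w = (N (u 0%N) w + \sum_(j < i) k j)%N.
Proof.
move=> wk; elim: i => [_|i IH im]; first by rewrite big_ord0 addn0.
by rewrite wk// IH ?(ltnW im)// big_ord_recr/= addnA.
Qed.

Section one_grid.
Variables (u : nat -> R) (hu : {homo u : i j / (i <= j)%N >-> i <= j}) (u0 : 0 <= u 0%N).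

Let uge i : 0 <= u i. Proof. by apply: (le_trans u0); exact: hu. Qed.

Let mN i : measurable_fun setT (N (u i)).
Proof. exact: (measurable_cox coxN). Qed.

Lemma measurable_count_cell m k : measurable (count_cell u m k).
Proof.
rewrite (_ : count_cell u m k = \bigcap_(i in [set i | (i < m)%N])
    [set w | N (u i.+1) w = (N (u i) w + k i)%N]); last by apply/seteqP; split.
apply: bigcap_measurableType => i _.
rewrite (_ : [set w | _] = \bigcup_j (N (u i) @^-1` [set j] `&` N (u i.+1) @^-1` [set (j + k i)%N])).
  apply: bigcup_measurable => j _; apply: measurableI.
    by rewrite -(setTI (_ @^-1` _)); exact: mN.
  by rewrite -(setTI (_ @^-1` _)); exact: mN.
apply/seteqP; split => [w /= h|w [j _ [/= <- <-]]//].
by exists (N (u i) w).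
Qed.

Lemma count_cells_measurable m : count_cells u m `<=` measurable.
Proof. by move=> _ [k _ <-]; exact: measurable_count_cell. Qed.

(** Cells whose patterns differ before [m] are disjoint, so the cells form a pi-system up to the
    empty set and [setT]. *)
Lemma count_cells_finI m A : finI (count_cells u m) A -> A = set0 \/ A = setT \/ count_cells u m A.
Proof.
move=> [l lE ->] {A}; elim: l lE => [|C l IH] lE; first by rewrite big_nil; right; left.
rewrite big_cons; have [k _ kC] := lE C (mem_head _ _).
have [|->|[->|[k' _ <-]]] := IH; first by move=> B Bl; apply: lE; rewrite inE Bl orbT.
- by rewrite setI0; left.
- by rewrite setIT -kC; right; right; exists k.
- rewrite -kC.
  have [kk|/existsNP[i /not_implyP[im ki]]] := pselect (forall i, (i < m)%N -> k i = k' i).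
    right; right; exists k => //; apply/seteqP; split => [w h|w []//].
    by split => // i im; rewrite h// kk.
  left; apply/seteqP; split => // w [h h']; apply: ki.
  by have := h i im; rewrite h'// => /addnI.
Qed.

Lemma count_cells_preimage m (X : Omega -> nat) (h : (nat -> nat) -> nat) (B : set nat) :
  (forall k w, count_cell u m k w -> X w = h k) -> <<s count_cells u m >> (X @^-1` B).
Proof.
move=> Xh.
(* The patterns are uncountably many, but only their first [m] entries matter. Finite sequences,
   coded by natural numbers and padded with 0, make the union countable. *)
pose l n : seq nat := odflt [::] (unpickle n).
rewrite (_ : X @^-1` B = \bigcup_n (if h (nth 0%N (l n)) \in B then
    count_cell u m (nth 0%N (l n)) else set0)).
  apply: (@bigcup_measurable _ (g_sigma_algebraType (count_cells u m))) => n _.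
  case: ifP => _; last exact: (@measurable0 _ (g_sigma_algebraType _)).
  by apply: sub_sigma_algebra; exists (nth 0%N (l n)).
apply/seteqP; split => [w Bw|w [n _]]; last first.
  by case: ifP => // lB wl; rewrite /preimage/= (Xh _ _ wl); exact: set_mem.
pose k := mkseq (fun i => (N (u i.+1) w - N (u i) w)%N) m.
have wk : count_cell u m (nth 0%N k) w.
  move=> i im; rewrite nth_mkseq// subnKC//.
  by apply: (cox_homo coxN) => //; exact: hu.
have lk : l (pickle k) = k by rewrite /l pickleK.
by exists (pickle k) => //; rewrite lk -(Xh _ _ wk) mem_set.
Qed.

Let mass i w : R := eta w (u i.+1) - eta w (u i).

Lemma count_cell_prob m k :
  P (count_cell u m k) = (\int[P]_w (\prod_(i < m) poisson_weight (mass i w) (k i))%:E)%E.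
Proof.
have [_ /(_ m u k u0 hu)[_ _ _ _ /(_ setT)]] := coxN.
have sT : sigma_gen `[0, +oo[ etap setT.
  by apply: sigma_algebra_setT; exact: smallest_sigma_algebra.
move=> /(_ sT) E; rewrite -[count_cell u m k]setIT.
rewrite -(integral_indic P measurableT (measurable_count_cell m k)) -E.
by apply: eq_integral => w _; rewrite -prodEFin; apply: eq_bigr => i _;
  rewrite poisson_prob_set1// subr_ge0; apply: cumulative_is_nondecreasing; exact: hu.
Qed.

End one_grid.

(** A past cell meets a future cell in a single longer cell, whose probability is the mean of a
    product of Poisson weights. The weights before and after [u m] are functions of increments of
    [eta] over disjoint periods, which are independent. *)
Lemma cox_cells_independent (u : nat -> R) m n :
  {homo u : i j / (i <= j)%N >-> i <= j} -> 0 <= u 0%N ->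
  independent P <<s count_cells u m >> <<s count_cells (fun i => u (m + i)%N) n >>.
Proof.
move=> hu u0; pose v i := u (m + i)%N.
have hv : {homo v : i j / (i <= j)%N >-> i <= j} by move=> i j ij; apply: hu; rewrite leq_add2l.
have um : 0 <= u m by apply: (le_trans u0); exact: hu.
have v0 : 0 <= v 0%N by rewrite /v addn0.
apply: indep_ext; [exact: count_cells_measurable|exact: count_cells_measurable|].
move=> A B /(count_cells_finI)[->|[->|[k _ <-]]] /(count_cells_finI)[->|[->|[k' _ <-]]];
  rewrite ?set0I ?setI0 ?measure0 ?mul0e ?mule0 ?setTI ?setIT ?probability_setT ?mul1e ?mule1//.
pose K i := if (i < m)%N then k i else k' (i - m)%N.
have -> : count_cell u m k `&` count_cell v n k' = count_cell u (m + n) K.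
  apply/seteqP; split => [w [h h'] i imn|w h].
    rewrite /K; case: ltnP => im; first exact: h.
    have := h' (i - m)%N; rewrite /v addnS subnKC//; apply.
    by rewrite ltn_subLR.
  split => i im; first by rewrite h /K ?im// (leq_trans im)// leq_addr.
  by rewrite /v addnS h ?ltn_add2l// /K ltnNge leq_addr/= addKn.
rewrite !count_cell_prob//.
have meta t : measurable_fun setT (etap t) by have [h _ _ _ _] := addE; exact: h.
have [_ _ _ [inc _] _] := addE.
have ind := independent_increments_split meta inc um.
pose E := gen `[0, u m] (fun t => etap t \- etap 0).
pose F := gen `[u m, +oo[ (fun t => etap t \- etap (u m)).
pose X w := (\prod_(i < m) poisson_weight (eta w (u i.+1) - eta w (u i)) (k i))%:E.
pose Y w := (\prod_(i < n) poisson_weight (eta w (v i.+1) - eta w (v i)) (k' i))%:E.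
have w0 i w l : 0 <= poisson_weight (eta w (u i.+1) - eta w (u i)) l.
  by apply: poisson_weight_ge0; rewrite subr_ge0; apply: cumulative_is_nondecreasing; exact: hu.
rewrite (_ : (fun w => _) = (fun w => X w * Y w)%E); last first.
  apply/funext => w; rewrite /X /Y -EFinM big_split_ord/=; congr (_ * _)%:E.
    by apply: eq_bigr => i _; rewrite /K ltn_ord.
  by apply: eq_bigr => i _; rewrite /K ltnNge leq_addr/= addKn /v addnS.
have mEF : E `<=` measurable by apply: gen_measurable => t _; apply: measurable_funB; exact: meta.
have mFF : F `<=` measurable by apply: gen_measurable => t _; apply: measurable_funB; exact: meta.
apply: (indep_integralM mEF mFF ind).
- apply/measurable_EFinP; apply: measurable_prod => i _.
  have mi j : (j <= m)%N -> measurable_fun setT ((fun w => eta w (u j) - eta w 0) : g_sigma_algebraType E -> R).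
    by move=> jm; apply: (measurable_gen (X := fun t => etap t \- etap 0)) => /=;
      rewrite in_itv/= (le_trans u0) ?hu.
  apply: (measurableT_comp (measurable_poisson_weight (k i))).
  rewrite (_ : (fun w => _) = (fun w => (eta w (u i.+1) - eta w 0) - (eta w (u i) - eta w 0))); last first.
    by apply/funext => w; ring.
  by apply: measurable_funB; apply: mi => //; exact: ltnW.
- apply/measurable_EFinP; apply: measurable_prod => i _.
  have mi j : measurable_fun setT ((fun w => eta w (v j) - eta w (u m)) : g_sigma_algebraType F -> R).
    by apply: (measurable_gen (X := fun t => etap t \- etap (u m))) => /=;
      rewrite in_itv/= andbT /v hu// leq_addr.
  apply: (measurableT_comp (measurable_poisson_weight (k' i))).
  rewrite (_ : (fun w => _) = (fun w => (eta w (v i.+1) - eta w (u m)) - (eta w (v i) - eta w (u m)))); last first.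
    by apply/funext => w; ring.
  by apply: measurable_funB; exact: mi.
- by move=> w; rewrite lee_fin; apply: prodr_ge0 => i _.
- by move=> w; rewrite lee_fin; apply: prodr_ge0 => i _; rewrite /v addnS.
Qed.

(** Finitely many times suffice, and a grid through [s] expresses their events by cells. The counts
    before [s] are recovered from increments because [N] starts at 0. *)
Lemma cox_past_future (s : R) : 0 <= s ->
  independent P (sigma_gen `[0, s] N) (sigma_gen `[s, +oo[ (fun v w => (N v w - N s w)%N)).
Proof.
move=> s0; apply: indep_ext.
- by apply: gen_measurable => v /=; rewrite in_itv/= => /andP[v0 _]; exact: (measurable_cox coxN).
- apply: gen_measurable => v /=; rewrite in_itv/= andbT => sv.
  have mv := measurable_cox coxN (le_trans s0 sv); have ms := measurable_cox coxN s0.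
  exact: (measurable_nat2 subn).
move=> A B /finI_times[ts [tsD HA]] /finI_times[ts' [tsD' HB]].
have [|u [m [u0 um hu H1 H2]]] := @time_grid R s (ts ++ ts') s0.
  move=> v; rewrite mem_cat => /orP[/tsD|/tsD'] /=; rewrite in_itv/=.
    by case/andP.
  by rewrite andbT; apply: le_trans.
(* The grid is infinite while cells have finite length; [n] is taken large enough to reach all times
   in [ts']. *)
have [n Hn] : exists n, forall v, v \in ts' -> exists2 i, (i <= n)%N & u (m + i)%N = v.
  have : {subset ts' <= ts'} by [].
  elim: {1 3}ts' => [|v l IH] sub; first by exists 0%N.
  have [|n Hn] := IH; first by move=> x xl; apply: sub; rewrite inE xl orbT.
  have vts : v \in ts' by apply: sub; rewrite inE eqxx.
  have [||i im iv] := H2 v; first by rewrite mem_cat vts orbT.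
    by have := tsD' _ vts; rewrite /= in_itv/= andbT.
  exists (maxn (i - m) n) => x; rewrite inE => /predU1P[->|/Hn[j jn jx]].
    by exists (i - m)%N; rewrite ?leq_maxl// subnKC.
  by exists j => //; rewrite leq_max jn orbT.
have u00 : 0 <= u 0%N by rewrite u0.
have hv : {homo (fun i => u (m + i)%N) : i j / (i <= j)%N >-> i <= j}.
  by move=> i j ij; apply: hu; rewrite leq_add2l.
have v0 : 0 <= u (m + 0)%N by rewrite addn0 um.
have ind := @cox_cells_independent u m n hu u00; apply: ind.
- apply: (sub_gen _ HA) => v /= vts _ C mC; rewrite setTI.
  have [||i im <-] := H1 v; first by rewrite mem_cat vts.
    by have := tsD _ vts; rewrite /= in_itv/= => /andP[].
  apply: (count_cells_preimage hu u00 (h := fun k => (\sum_(j < i) k j)%N)) => k w wk.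
  rewrite (count_cellE wk im) u0; have [[_ N0 _ _] _] := coxN.
  by rewrite N0.
- apply: (sub_gen _ HB) => v /= vts _ C mC; rewrite setTI.
  have [i im <-] := Hn _ vts.
  apply: (count_cells_preimage hv v0 (h := fun k => (\sum_(j < i) k j)%N)) => k w wk.
  by rewrite (count_cellE wk im) addn0 um addKn.
Qed.

End cox_split.

(** * Freezing the arrival times *)

Lemma measurable_random_index d (T : measurableType d) d' (T' : measurableType d')
    (f : nat -> T -> T') (X : T -> nat) :
  (forall n, measurable_fun setT (f n)) -> measurable_fun setT X ->
  measurable_fun setT (fun z => f (X z) z).
Proof.
move=> mf mX _ B mB; rewrite setTI.
rewrite (_ : _ @^-1` B = \bigcup_n (X @^-1` [set n] `&` f n @^-1` B)); last first.
  by apply/seteqP; split => [z /= Bz|z [n _ [/= <-]]//]; exists (X z).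
apply: bigcup_measurable => n _; apply: measurableI.
  by rewrite -(setTI (_ @^-1` _)); exact: mX.
by rewrite -(setTI (_ @^-1` _)); exact: mf.
Qed.

Lemma measurable_truncn (R : realType) : measurable_fun setT (Num.truncn : R -> nat).
Proof.
move=> _ B _; rewrite setTI (_ : _ @^-1` B = \bigcup_(n in B) (Num.truncn @^-1` [set n] : set R)); last first.
  by apply/seteqP; split => [x /= Bx|x [n Bn /= xn]]; [exists (Num.truncn x)|rewrite /= xn].
apply: bigcup_measurable => n _.
rewrite (_ : _ @^-1` _ = if n == 0%N then `]-oo, 1[%classic else `[n%:R, n.+1%:R[%classic).
  by case: ifP.
apply/seteqP; split => x /=; case: eqVneq => [->|n0]; rewrite ?in_itv/=.
- by move=> /truncn0Pn; rewrite -ltNge.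
- move=> xn; have [x_lt0|xp] := ltP x 0; last by rewrite in_itv/= -xn truncn_itv.
  by rewrite -xn in n0; case/eqP: n0; apply/truncn0Pn; rewrite -ltNge (lt_trans x_lt0).
- by move=> x1; apply/truncn0Pn; rewrite -ltNge.
- exact: truncn_def.
Qed.

(** By right-continuity, [X] at a time v is the limit of its values at grid times strictly to the
    right of v, and on each grid only countably many times occur. *)
Lemma measurable_joint d (T : measurableType d) (R : realType) (X : R -> T -> R) :
  (forall v, measurable_fun setT (X v)) ->
  (forall w v, X x w @[x --> v^'+] --> X v w) ->
  measurable_fun setT (fun z : T * R => X z.2 z.1).
Proof.
move=> mX rX.
(* [truncn] rounds |v|(n + 1) towards 0, so negative times need a formula of their own; in both
   cases the grid time lies in (v, v + 2 / (n + 1)]. *)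
pose a n k : R := k.+1%:R / n.+1%:R.
pose b n k : R := (1 - k%:R) / n.+1%:R.
pose f n k (z : T * R) : R := if 0 <= z.2 then X (a n k) z.1 else X (b n k) z.1.
pose K n (z : T * R) := Num.truncn (`|z.2| * n.+1%:R).
apply: (@measurable_fun_cvg _ _ _ _ (fun n z => f n (K n z) z)).
  move=> n; apply: measurable_random_index.
    move=> k; apply: measurable_fun_ifT.
    - by apply: measurable_fun_ler => //; exact: measurable_snd.
    - exact: (measurableT_comp (mX _) measurable_fst).
    - exact: (measurableT_comp (mX _) measurable_fst).
  apply: (measurableT_comp (@measurable_truncn R)); apply: measurable_funM => //.
  by apply: measurableT_comp => //; exact: measurable_snd.
move=> [w v] _; rewrite /f/=.
pose c n := if 0 <= v then a n (K n (w, v)) else b n (K n (w, v)).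
rewrite (_ : (fun n => _) = (fun n => X (c n) w)); last by apply/funext => n; rewrite /c; case: ifP.
have vc n : v < c n <= v + 2 * n.+1%:R^-1.
  have n0 : 0 < n.+1%:R :> R by [].
  have := truncn_itv (mulr_ge0 (normr_ge0 v) (ltW n0)); rewrite /c /a /b /K/= => /andP[h1 h2].
  have [v0|v0] := leP 0 v.
    rewrite ger0_norm// in h1 h2 *; rewrite ltr_pdivlMr// h2/= ler_pdivrMr// mulrDl -mulrA mulVf ?gt_eqF// -natr1; lra.
  rewrite ltr0_norm// in h1 h2 *; rewrite ltr_pdivlMr// ler_pdivrMr// mulrDl -mulrA mulVf ?gt_eqF//.
  move: h1 h2; set k := Num.truncn _; rewrite -[k.+1%:R]natr1 mulNr => h1 h2.
  by apply/andP; split; lra.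
have /cvg_at_rightP := @rX w v; apply; split; first by move=> n; have /andP[] := vc n.
apply: (@squeeze_cvgr _ _ _ _ (fun=> v) (fun n => v + 2 * n.+1%:R^-1)).
- by apply: nearW => n; have /andP[/ltW-> ->] := vc n.
- exact: cvg_cst.
- rewrite -[X in _ --> X]addr0 -(mulr0 2); apply: cvgD; first exact: cvg_cst.
  by apply: cvgMr; exact: cvg_harmonic.
Qed.

(* Almost surely equal to [V], but vanishing surely at negative times. *)
Definition started (R : realType) (Omega : Type) (V : R -> Omega -> R) (v : R) (w : Omega) : R :=
  if 0 <= v then V v w - V 0 w else 0.

Section started.
Context d (Omega : measurableType d) (R : realType) (P : probability Omega R).
Variables (V : R -> Omega -> R) (rho : {measure set (R * R) -> \bar R}).
Hypothesis addV : additive_process P V rho.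

Let mV u : measurable_fun setT (V u). Proof. by case: addV. Qed.

Lemma started_right w v : started V x w @[x --> v^'+] --> started V v w.
Proof.
have [_ _ cV _ _] := addV; have rV := (cV w).1 v.
have [v0|v0] := leP 0 v.
  rewrite {2}/started v0; have c : V x w - V 0 w @[x --> v^'+] --> V v w - V 0 w.
    by apply: cvgB => //; exact: cvg_cst.
  apply: cvg_trans c; apply: near_eq_cvg; near=> x.
  by rewrite /started (le_trans v0)// ltW//; near: x; exact: nbhs_right_gt.
rewrite {2}/started leNgt v0/=; apply: cvg_near_cst; near=> x.
have x0 : x < 0 by near: x; exact: nbhs_right_lt.
by rewrite /started leNgt x0.
Unshelve. all: by end_near. Qed.

(** One null set serves all times: the negative rationals are countably many, and by
    right-continuity a nonzero value at a negative [v] would persist at some negative rational. *)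
Lemma ae_started : {ae P, forall w, forall v, V v w = started V v w}.
Proof.
have [_ V0 cV _ _] := addV.
have V0r : {ae P, forall w, forall n : nat, if (unpickle n : option rat) is Some r
    then ((ratr r : R) <= 0 -> V (ratr r) w = 0) else True}.
  apply: ae_foralln => n; case: unpickle => [r|]; last exact: aeW.
  have [r0|r0] := leP (ratr r : R) 0; last exact: aeW.
  by apply: filterS (V0 _ r0).
apply: filterS2 V0r (V0 0 (lexx _)) => w wr w0 v; rewrite /started.
have [v0|v0] := leP 0 v; first by rewrite w0 subr0.
apply/eqP; apply: contrapT => /negP Vv.
have := cvgr_neq0 _ ((cV w).1 v) Vv.
rewrite /at_right/= => -[e /= e0 He].
have vm : v < Num.min 0 (v + e) by rewrite lt_min v0 ltrDl.
have [r] := rat_in_itvoo vm; rewrite in_itv/= lt_min => /andP[vr /andP[r0 re]].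
have := He (ratr r); rewrite /ball/= distrC gtr0_norm ?subr_gt0// ltrBlDl => /(_ re vr).
by have := wr (pickle r); rewrite pickleK => -> //; [rewrite eqxx|exact: ltW].
Qed.

Lemma measurable_started (E : set (set Omega)) v :
  (forall u, 0 <= u -> measurable_fun setT (V u : g_sigma_algebraType E -> R)) ->
  measurable_fun setT (started V v : g_sigma_algebraType E -> R).
Proof.
move=> mE; rewrite /started; have [v0|_] := leP 0 v; last exact: measurable_cst.
by apply: measurable_funB; exact: mE.
Qed.

Lemma measurable_started_joint (E : set (set Omega)) :
  (forall u, 0 <= u -> measurable_fun setT (V u : g_sigma_algebraType E -> R)) ->
  measurable_fun setT ((fun z => started V z.2 z.1) : (g_sigma_algebraType E * R)%type -> R).
Proof.
move=> mE; apply: (measurable_joint (X := started V : R -> g_sigma_algebraType E -> R)).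
  by move=> v; exact: measurable_started.
by move=> w v; exact: started_right.
Qed.

(** The level [c] will be s - T_j, negative for arrivals after [s]. In that case [started V] is
    identically 0 up to [c] and its past is trivial; otherwise this is independence of
    increments. *)
Lemma started_split (c : R) :
  independent P (sigma_gen `]-oo, c] (started V))
                (sigma_gen `[c, +oo[ (fun v => started V v \- started V c)).
Proof.
have [_ _ _ [inc _] _] := addV.
have [c0|c0] := leP 0 c.
  have := independent_increments_split mV inc c0; apply: indep_sub.
    apply: sub_gen => v /= /[!in_itv]/= vc; rewrite /started; have [v0|//] := leP 0 v.
    by apply: (measurable_gen (X := fun v => V v \- V 0)) => /=; rewrite in_itv/= v0.
  apply: sub_gen => v /= /[!in_itv]/= /[!andbT] cv; rewrite /started c0 (le_trans c0 cv).
  rewrite (_ : _ \- _ = V v \- V c); last by apply/funext => w /=; ring.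
  by apply: (measurable_gen (X := fun v => V v \- V c)) => /=; rewrite in_itv/= cv.
move=> A B sA _; have : [set (set0 : set Omega); setT] A.
  apply: sA; split; first exact: trivial_sigma_algebra.
  move=> _ [v [/= /[!in_itv]/= vc [C mC ->]]].
  have -> : started V v = fun=> 0 by apply/funext => w; rewrite /started leNgt (le_lt_trans vc c0).
  have [C0|C0] := pselect (C 0); [right|left]; apply/seteqP; split => //.
case=> ->; first by rewrite set0I measure0 mul0e.
by rewrite setTI probability_setT mul1e.
Qed.

Hypothesis V2 : forall u, 0 <= u -> ('E_P[V u ^+ 2] < +oo)%E.

Lemma started_increment a b w : a <= b ->
  started V b w - started V a w = started V b w - started V (Num.max a 0) w.
Proof.
move=> ab; have [a0|a0] := leP 0 a; first by [].
by rewrite /started lexx subrr [0 <= a]leNgt a0.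
Qed.

Let jm a : jump_mean rho (Num.max a 0) = jump_mean rho a.
Proof.
have [a0|a0] := leP 0 a; first by [].
by rewrite !jump_mean_neg// ltW.
Qed.

Let js a : jump_sqr rho (Num.max a 0) = jump_sqr rho a.
Proof.
have [a0|a0] := leP 0 a; first by [].
by rewrite !jump_sqr_neg// ltW.
Qed.

(** [started V] is 0 up to time 0, so a negative [a] may be raised to 0, where the formulas for
    increments apply; [jump_mean] and [jump_sqr] also vanish up to 0. *)
Lemma started_moments a b : a <= b ->
  [/\ P.-integrable setT (fun w => ((started V b w - started V a w) ^+ 2)%:E),
      \int[P]_w (started V b w - started V a w) = jump_mean rho b - jump_mean rho a &
      \int[P]_w (started V b w - started V a w) ^+ 2 = jump_sqr rho b - jump_sqr rho a +
        (jump_mean rho b - jump_mean rho a) ^+ 2].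
Proof.
move=> ab; have a0 : 0 <= Num.max a 0 by rewrite le_max lexx orbT.
have [b0|b0] := leP 0 b; last first.
  have E : (fun w => started V b w - started V a w) = fun=> 0.
    by apply/funext => w; rewrite /started !leNgt b0 (le_lt_trans ab b0) subrr.
  rewrite E (_ : (fun w => _ ^+ 2) = fun=> 0); last first.
    by apply/funext => w; rewrite (congr1 (fun f => f w) E) expr0n.
  rewrite (_ : (fun w => (_ ^+ 2)%:E) = cst 0%:E); last first.
    by apply/funext => w; rewrite (congr1 (fun f => f w) E) expr0n.
  rewrite !Rintegral_prob_cst ?jump_mean_neg ?jump_sqr_neg ?subrr ?expr0n ?addr0 ?(ltW b0) ?(le_trans ab)// ?(ltW b0)//.
  by split => //; exact: integrable0.
have ab' : Num.max a 0 <= b by rewrite ge_max ab.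
have E : (fun w => started V b w - started V a w) = (fun w => V b w - V (Num.max a 0) w).
  by apply/funext => w; rewrite started_increment// /started b0 a0; ring.
rewrite E (_ : (fun w => _ ^+ 2) = (fun w => (V b w - V (Num.max a 0) w) ^+ 2)); last first.
  by apply/funext => w; rewrite (congr1 (fun f => f w) E).
rewrite (_ : (fun w => (_ ^+ 2)%:E) = (fun w => ((V b w - V (Num.max a 0) w) ^+ 2)%:E)); last first.
  by apply/funext => w; rewrite (congr1 (fun f => f w) E).
rewrite -(jm a) -(js a); split.
- exact: (integrable_increment_sqr addV V2).
- exact: (increment_mean addV V2).
- exact: (increment_second_moment addV V2).
Qed.

End started.

Section stopped_arrivals.
Context d (Omega : measurableType d) (R : realType).
Variable N : R -> Omega -> nat.
Hypothesis cN : counting_process N.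

(* [U + 1] is an arbitrary value exceeding [U]. *)
Definition stopped_arrival (U : R) (j : nat) (w : Omega) : R :=
  if (j <= N U w)%N then arrival_time N j w else U + 1.

Lemma measurable_stopped_arrival (F : set (set Omega)) (U : R) (j : nat) : 0 <= U ->
  (forall u, 0 <= u <= U -> measurable_fun setT (N u : g_sigma_algebraType F -> nat)) ->
  measurable_fun setT (stopped_arrival U j : g_sigma_algebraType F -> R).
Proof.
move=> U0 mN.
have mle u : 0 <= u <= U -> <<s F >> [set w | (j <= N u w)%N].
  by move=> /mN /(_ measurableT [set k | (j <= k)%N]); rewrite setTI; exact.
apply: (measurability _ (RGenOInfty.measurableE R)) => //.
move=> _ [_ [x ->] <-]; rewrite setTI.
(* For 0 <= x < U + 1 the event says that fewer than [j] points have come by time min(x, U). Outside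
   this range it is trivial, so only counts up to [U] occur. *)
have E w : stopped_arrival U j w > x =
    if x < 0 then true else if U + 1 <= x then false else ~~ (j <= N (Num.min x U) w)%N.
  rewrite /stopped_arrival; have [x0|x0] := ltP x 0.
    by apply: (lt_le_trans x0); case: ifP => _; [exact: arrival_time_ge0|exact: addr_ge0].
  have [Ux|xU] := leP (U + 1) x.
    case: ifP => jU; last by rewrite ltNge Ux.
    rewrite ltNge (arrival_time_le cN U0)// (leq_trans jU)//.
    by case: cN => _ _ h _; apply: h => //; rewrite (le_trans _ Ux)// lerDl.
  have [xU'|xU'] := leP x U.
    case: ifP => jU; first by rewrite ltNge (arrival_time_le cN U0).
    rewrite xU; apply/esym; apply: contraFN jU => jx; apply: (leq_trans jx).
    by case: cN => _ _ h _; exact: h.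
  case: ifP => jU; last by rewrite xU.
  by apply/negbTE; rewrite -leNgt (le_trans _ (ltW xU'))// (arrival_time_le cN U0).
rewrite (_ : _ @^-1` _ = [set w | stopped_arrival U j w > x]); last first.
  by apply/seteqP; split => w /=; rewrite in_itv/= andbT.
under eq_set do rewrite E.
have [x0|x0] := ltP x 0; first by rewrite (_ : mkset _ = setT)//; apply/seteqP; split.
have [Ux|xU] := leP (U + 1) x; first by rewrite (_ : mkset _ = set0)//; apply/seteqP; split.
rewrite (_ : [set w | _] = ~` [set w | (j <= N (Num.min x U) w)%N]).
  apply: measurableC; apply: mle; rewrite le_min x0 U0/=.
  by rewrite ge_min lexx orbT.
by apply/seteqP; split => w /= /negP.
Qed.

End stopped_arrivals.

Lemma mutually_independent_pair d (Omega : measurableType d) (R : realType)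
    (P : probability Omega R) (I : choiceType) (D : set I) (F : I -> set (set Omega)) i j :
  mutually_independent P D F -> D i -> D j -> i != j -> independent P (F i) (F j).
Proof.
move=> ind Di Dj ij A B FA FB.
have := ind [fset i; j]%fset (fun k => if k == i then A else B).
rewrite big_fsetU1/= ?inE// big_seq_fset1 eqxx eq_sym (negbTE ij) => <-.
- congr (P _); apply/seteqP; split => [w [Aw Bw] k /= _|w h]; first by case: ifP.
  split; first by have := h i; rewrite eqxx; apply; rewrite /= !inE eqxx.
  by have := h j; rewrite eq_sym (negbTE ij); apply; rewrite /= !inE eqxx orbT.
- by move=> k /=; rewrite !inE => /orP[/eqP->|/eqP->].
- by move=> k; rewrite !inE => /orP[/eqP->|/eqP->]; rewrite ?eqxx// eq_sym (negbTE ij).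
Qed.

(** * Mark increments over frozen time intervals *)

Section inner_moments.
Context d (Omega : measurableType d) (R : realType) (P : probability Omega R).
Variables (Ls : nat -> R -> Omega -> R) (rhoL : {measure set (R * R) -> \bar R}).
Hypothesis addL : forall j, (1 <= j)%N -> additive_process P (Ls j) rhoL.
Hypothesis L2 : forall j, (1 <= j)%N -> forall u, 0 <= u -> ('E_P[Ls j u ^+ 2] < +oo)%E.
Hypothesis indL : mutually_independent P [set j | (1 <= j)%N] (fun j => sigma_gen `[0, +oo[ (Ls j)).
Variables (a b : nat -> R).
Hypothesis ab : forall j, a j <= b j.

Definition ext_increment (j : nat) (w : Omega) : R :=
  started (Ls j) (b j) w - started (Ls j) (a j) w.
Let D := ext_increment.
Let m j := jump_mean rhoL (b j) - jump_mean rhoL (a j).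
Let v j := jump_sqr rhoL (b j) - jump_sqr rhoL (a j).

Let mL j u : (1 <= j)%N -> measurable_fun setT (Ls j u).
Proof. by move=> /addL[+ _ _ _ _]; exact. Qed.

Let mLgen j u : (1 <= j)%N -> 0 <= u ->
  measurable_fun setT (Ls j u : g_sigma_algebraType (gen `[0, +oo[ (Ls j)) -> R).
Proof. by move=> j1 u0; apply: measurable_gen => /=; rewrite in_itv/= u0. Qed.

Let mDgen j : (1 <= j)%N ->
  measurable_fun setT (D j : g_sigma_algebraType (gen `[0, +oo[ (Ls j)) -> R).
Proof.
by move=> j1; apply: measurable_funB; apply: measurable_started => u u0; exact: mLgen.
Qed.

Let gen_sub j : (1 <= j)%N -> gen `[0, +oo[ (Ls j) `<=` measurable.
Proof. by move=> j1; apply: gen_measurable => u _; exact: mL. Qed.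

Let mD j : (1 <= j)%N -> measurable_fun setT (D j).
Proof.
by move=> j1; apply: (measurableT_comp (mDgen j1)); apply: measurable_sub_id; exact: gen_sub.
Qed.

Let iD2 j : (1 <= j)%N -> P.-integrable setT (fun w => (D j w ^+ 2)%:E).
Proof. by move=> j1; have [h _ _] := started_moments (addL j1) (L2 j1) (ab j). Qed.

Let iD j : (1 <= j)%N -> P.-integrable setT (EFin \o D j).
Proof. by move=> j1; apply: sqr_integrable_integrable; [exact: mD|exact: iD2]. Qed.

Let icst (c : R) : P.-integrable setT (EFin \o (fun=> c)).
Proof. by apply: (@prob_bounded_integrable _ _ _ _ _ `|c|). Qed.

Let X j w := D j w - m j.

Let X1 j : (1 <= j)%N -> null_mean P setT (X j).
Proof.
move=> j1; split; first exact: (integrableB measurableT (iD j1) (icst _)).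
have [_ h _] := started_moments (addL j1) (L2 j1) (ab j).
by rewrite RintegralB// ?Rintegral_prob_cst ?[X in X - _]h ?subrr//; exact: iD.
Qed.

Let X2 j : (1 <= j)%N -> null_mean P setT (fun w => X j w * X j w - v j).
Proof.
move=> j1; have [_ h1 h2] := started_moments (addL j1) (L2 j1) (ab j).
have i1 : P.-integrable setT (EFin \o (fun w => 2 * m j * D j w)).
  exact: (integrableZl measurableT (2 * m j) (iD j1)).
apply: (@null_mean_eq _ _ _ _ _ (fun w => D j w ^+ 2 - 2 * m j * D j w + (m j ^+ 2 - v j))).
  by move=> w; rewrite /X; ring.
have i2 := integrableB measurableT (iD2 j1) i1.
split; first exact: (integrableD measurableT i2 (icst _)).
rewrite RintegralD// ?RintegralB// ?Rintegral_prob_cst ?RintegralZl//; try exact: iD; try exact: iD2.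
by rewrite [X in X - _]h2 [X in _ * X]h1 -/(m j) -/(v j); ring.
Qed.

Let Xij i j : (1 <= i)%N -> (1 <= j)%N -> i != j -> null_mean P setT (fun w => X i w * X j w).
Proof.
move=> i1 j1 ij; have ind := mutually_independent_pair indL i1 j1 ij.
have mX k : (1 <= k)%N -> measurable_fun setT (X k : g_sigma_algebraType (gen `[0, +oo[ (Ls k)) -> R).
  by move=> k1; apply: measurable_funB => //; exact: mDgen.
have [iX0 X0] := X1 i1; have [iX' X0'] := X1 j1.
have [h1 h2] := indep_RintegralM (gen_sub i1) (gen_sub j1) ind (mX _ i1) (mX _ j1) iX0 iX'.
by split => //; rewrite h2 X0 mul0r.
Qed.

(** Centred increments of distinct marks are orthogonal by independence, so the variances add up,
    and [y] only shifts the mean. *)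
Lemma ext_increment_sum_sqr (n : nat) (y : R) : null_mean P setT (fun w =>
  (\sum_(1 <= j < n.+1) D j w - y) ^+ 2 -
  (\sum_(1 <= j < n.+1) v j + (\sum_(1 <= j < n.+1) m j - y) ^+ 2)).
Proof.
pose c := \sum_(i < n) m i.+1 - y.
apply: (@null_mean_eq _ _ _ _ _ (fun w =>
    \sum_(i < n) \sum_(j < n) (X i.+1 w * X j.+1 w - (i == j)%:R * v i.+1) +
    2 * c * \sum_(i < n) X i.+1 w)).
  move=> w; rewrite !big_add1/= !big_mkord.
  have -> : \sum_(i < n) \sum_(j < n) (X i.+1 w * X j.+1 w - (i == j)%:R * v i.+1) =
      (\sum_(i < n) X i.+1 w) ^+ 2 - \sum_(i < n) v i.+1.
    rewrite expr2 mulr_suml -sumrB; apply: eq_bigr => i _; rewrite mulr_sumr.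
    rewrite (bigD1 i)//= [in RHS](bigD1 i)//= eqxx mul1r [RHS]addrAC; congr (_ + _).
    by apply: eq_bigr => j ji; rewrite eq_sym (negbTE ji) mul0r subr0.
  have -> : \sum_(i < n) X i.+1 w = \sum_(i < n) D i.+1 w - \sum_(i < n) m i.+1 by rewrite -sumrB.
  by rewrite /c; ring.
apply: null_meanD => //; last by apply: null_meanZ => //; apply: null_mean_sum => // i _; exact: X1.
apply: null_mean_sum => // i _; apply: null_mean_sum => // j _.
have [->|ij] := eqVneq i j; first by apply: null_mean_eq (X2 (ltn0Sn j)) => w; rewrite mul1r.
by apply: null_mean_eq (Xij (ltn0Sn i) (ltn0Sn j) ij) => w; rewrite mul0r subr0.
Qed.

(** [C] concerns the marks up to the levels [a j], and the increments start there. Each mark splits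
    into independent halves, which [independent_bigcup] joins over [j]. *)
Lemma inner_second_moment (n : nat) (y : R) (C : set Omega) :
  <<s \bigcup_(j in [set j | (1 <= j)%N]) sigma_gen `]-oo, a j] (started (Ls j)) >> C ->
  (\int[P]_w (\1_C w * (\sum_(1 <= j < n.+1) D j w - y) ^+ 2)%:E =
   P C * (\sum_(1 <= j < n.+1) v j + (\sum_(1 <= j < n.+1) m j - y) ^+ 2)%:E)%E.
Proof.
move=> sC.
pose A j := sigma_gen `]-oo, a j] (started (Ls j)).
pose B j := sigma_gen `[a j, +oo[ (fun v => started (Ls j) v \- started (Ls j) (a j)).
pose F j := sigma_gen `[0, +oo[ (Ls j).
have AF j : (1 <= j)%N -> A j `<=` F j.
  move=> j1; apply: sub_gen => u _; apply: measurable_started => r r0; exact: mLgen.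
have BF j : (1 <= j)%N -> B j `<=` F j.
  move=> j1; apply: sub_gen => u _.
  by apply: measurable_funB; apply: measurable_started => r r0; exact: mLgen.
have FM j : (1 <= j)%N -> F j `<=` measurable by move=> j1; apply/sigma_gen_sub/gen_sub.
have AB : independent P <<s \bigcup_(j in [set j | (1 <= j)%N]) A j >>
                        <<s \bigcup_(j in [set j | (1 <= j)%N]) B j >>.
  apply: (independent_bigcup (F := F)) => //.
  - by move=> j _; exact: smallest_sigma_algebra.
  - by move=> j _; exact: smallest_sigma_algebra.
  - by move=> j _; exact: smallest_sigma_algebra.
  - by move=> j j1; exact: started_split (addL j1) (a j).
have mA : \bigcup_(j in [set j | (1 <= j)%N]) A j `<=` measurable.
  by move=> E [j j1 /(AF _ j1)]; exact: FM.
have mB : \bigcup_(j in [set j | (1 <= j)%N]) B j `<=` measurable.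
  by move=> E [j j1 /(BF _ j1)]; exact: FM.
have [iS S0] := ext_increment_sum_sqr n y.
set k := _ + _ ^+ 2 in iS S0 *.
set S := fun w => (\sum_(1 <= j < n.+1) D j w - y) ^+ 2.
have iSS : P.-integrable setT (EFin \o S).
  rewrite (_ : EFin \o S = (fun w => (S w - k)%:E + k%:E)%E).
    exact: (integrableD measurableT iS (icst k)).
  by apply/funext => w /=; rewrite -EFinD subrK.
rewrite RintegralB// Rintegral_prob_cst in S0; move/eqP: S0; rewrite subr_eq0 => /eqP S0.
have -> : (\int[P]_w (\1_C w * S w)%:E = (\int[P]_w (\1_C w)%:E) * (\int[P]_w (S w)%:E))%E.
  apply: (indep_integralM mA mB AB (X := fun w => (\1_C w)%:E) (Y := fun w => (S w)%:E)).
  - apply/measurable_EFinP; apply: measurable_indic; exact: sC.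
  - apply/measurable_EFinP; apply: measurable_funX; apply: measurable_funB => //.
    (* The hypotheses concern the marks with index at least 1; the guard makes the summand at 0
       measurable as well. *)
    rewrite (_ : (fun w => _) = (fun w => \sum_(1 <= j < n.+1) if (1 <= j)%N then D j w else 0)).
      apply: measurable_sum => j; case j1 : (1 <= j)%N => //.
      move=> _ Y mY; rewrite setTI; apply: sub_sigma_algebra; exists j => //.
      apply: sub_sigma_algebra; exists (b j); split; first by rewrite /= in_itv/= andbT ab.
      by exists Y.
    apply/funext => w; rewrite big_nat_cond [RHS]big_nat_cond; apply: eq_bigr => j.
    by rewrite andbT => /andP[-> _].
  - by move=> w; rewrite lee_fin indicE.
  - by move=> w; rewrite lee_fin sqr_ge0.
rewrite integral_indic//; last exact: (sigma_gen_sub mA sC).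
by rewrite setIT; congr (_ * _)%E; rewrite -S0 /Rintegral fineK// (integrable_fin_num measurableT iSS).
Qed.

End inner_moments.

(** * Representation of past events *)

Section past_representation.
Context d (Omega : measurableType d) (R : realType) (P : probability Omega R).
Variables (eta : Omega -> cumulative R R) (N : R -> Omega -> nat).
Variables (Ls : nat -> R -> Omega -> R) (rhoL : {measure set (R * R) -> \bar R}).
Variables (s t : R).
Let etap := fun u w => eta w u.
Hypothesis coxN : cox_process P N etap.
Hypothesis addL : forall j, (1 <= j)%N -> additive_process P (Ls j) rhoL.
Hypotheses (s0 : 0 < s) (t0 : 0 < t).

Let cN : counting_process N. Proof. by case: coxN. Qed.
Let U0 : 0 <= s + t. Proof. by rewrite addr_ge0 ?ltW. Qed.
Let sU : s <= s + t. Proof. by rewrite lerDl ltW. Qed.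

Definition marks_gen : set (set Omega) :=
  \bigcup_(j in [set j | (1 <= j)%N]) sigma_gen `[0, +oo[ (Ls j).

(** The generating class inside [past_sigma], named so that it can serve as argument of
    [g_sigma_algebraType]. *)
Definition past_gen : set (set Omega) :=
  [set A | exists n, A = [set w | N s w = n]]
      `|` [set A | exists j, (1 <= j)%N /\
             exists2 B : set (\bar R), measurable B &
               A = [set w | (arrival N j w <= s%:E)%E /\ B (arrival N j w)]]
      `|` [set A | exists j u, [/\ (1 <= j)%N, u <= s &
             exists2 B : set R, measurable B &
               A = [set w | (arrival N j w <= s%:E)%E /\
                            B (Ls j (u - fine (arrival N j w)) w)]]].

Let mL j u : (1 <= j)%N -> measurable_fun setT (Ls j u).
Proof. by move=> /addL[+ _ _ _ _]; exact. Qed.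

Lemma marks_gen_measurable : marks_gen `<=` measurable.
Proof. by move=> A [j j1]; apply: sigma_gen_sub; apply: gen_measurable => u _; exact: mL. Qed.

Lemma measurable_marks j u : (1 <= j)%N -> 0 <= u ->
  measurable_fun setT (Ls j u : g_sigma_algebraType marks_gen -> R).
Proof.
move=> j1 u0 _ B mB; rewrite setTI; apply: sub_sigma_algebra; exists j => //.
by apply: sub_sigma_algebra; exists u; split; [rewrite /= in_itv/= u0|exists B].
Qed.

Let mstop u j : 0 <= u -> measurable_fun setT (stopped_arrival N u j).
Proof.
move=> u0; have sub : <<s (measurable : set (set Omega)) >> `<=` measurable by apply: sigma_gen_sub.
have h : measurable_fun setT (stopped_arrival N u j : g_sigma_algebraType measurable -> R).
  apply: measurable_stopped_arrival => // v /andP[v0 _] _ B mB.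
  by apply: sub_sigma_algebra; exact: (measurable_cox coxN).
by move=> mT B mB; apply: sub; exact: h.
Qed.

Let mmark u v j : (1 <= j)%N -> 0 <= u ->
  measurable_fun setT (fun w => Ls j (v - stopped_arrival N u j w) w).
Proof.
move=> j1 u0; have [_ _ cL _ _] := addL j1.
have m := measurable_joint (fun u => mL u j1) (fun w => (cL w).1).
apply: (measurableT_comp m (g := fun w => (w, v - stopped_arrival N u j w))).
by apply: measurable_fun_pair => //; apply: measurable_funB => //; exact: mstop.
Qed.

Let stoppedE u j w : 0 <= u -> (j <= N u w)%N -> stopped_arrival N u j w = fine (arrival N j w).
Proof. by move=> u0 ju; rewrite /stopped_arrival ju. Qed.

Lemma measurable_cluster u : 0 <= u -> measurable_fun setT (cluster_process N Ls u).
Proof.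
move=> u0; pose f n w := \sum_(1 <= j < n.+1) if (1 <= j)%N then Ls j (u - stopped_arrival N u j w) w else 0.
rewrite (_ : cluster_process N Ls u = (fun w => f (N u w) w)).
  apply: measurable_random_index; last exact: (measurable_cox coxN).
  by move=> n; apply: measurable_sum => j; case j1 : (1 <= j)%N => //; exact: mmark.
apply/funext => w; rewrite /cluster_process /f big_nat_cond [RHS]big_nat_cond.
by apply: eq_bigr => j; rewrite andbT ltnS => /andP[j1 ju]; rewrite j1 stoppedE.
Qed.

Lemma past_gen_measurable : past_gen `<=` measurable.
Proof.
have mle j : measurable [set w | (arrival N j w <= s%:E)%E].
  under eq_set do rewrite (arrival_leE cN _ _ (ltW s0)).
  rewrite (_ : [set w | _] = N s @^-1` [set k | (j <= k)%N])//.
  by rewrite -(setTI (_ @^-1` _)); apply: (measurable_cox coxN) => //; exact: ltW.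
have s0' := ltW s0.
move=> A [[[n ->]|[j [j1 [B mB ->]]]]|[j [u [j1 us [B mB ->]]]]].
- rewrite (_ : [set w | _] = N s @^-1` [set n])// -(setTI (_ @^-1` _)).
  exact: (measurable_cox coxN).
- rewrite (_ : [set w | _] = [set w | (arrival N j w <= s%:E)%E] `&`
      (EFin \o stopped_arrival N s j) @^-1` B).
    apply: measurableI => //; rewrite -(setTI (_ @^-1` _)).
    by apply: (measurableT_comp (@EFin_measurable R setT) (mstop j s0')).
  apply/seteqP; split => w /= -[js Bw]; split => //; move: (js); rewrite arrival_leE// => h;
    by move: Bw; rewrite /= stoppedE// -/(arrival_time N j w) (arrival_fineK cN s0' h).
- rewrite (_ : [set w | _] = [set w | (arrival N j w <= s%:E)%E] `&`
      (fun w => Ls j (u - stopped_arrival N s j w) w) @^-1` B).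
    by apply: measurableI => //; rewrite -(setTI (_ @^-1` _)); exact: mmark.
  by apply/seteqP; split => w /= -[js Bw]; split => //; move: (js); rewrite arrival_leE// => h;
    move: Bw; rewrite stoppedE.
Qed.

(** For [u <= s] and k >= 1 the event [k <= N u w] is {T_k <= u}, an event of the past; for k = 0 it
    is the whole space. *)
Lemma past_gen_counts u : 0 <= u <= s -> measurable_fun setT (N u : g_sigma_algebraType past_gen -> nat).
Proof.
move=> /andP[u0 us]; have sF := smallest_sigma_algebra setT past_gen.
have le k : <<s past_gen >> [set w | (k <= N u w)%N].
  case: k => [|k]; first by rewrite (_ : mkset _ = setT); [exact: sigma_algebra_setT|apply/seteqP; split].
  apply: sub_sigma_algebra; left; right; exists k.+1; split => //.
  exists [set x | (x <= u%:E)%E].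
    by rewrite -[X in measurable X]setTI; apply: emeasurable_fun_infty_c.
  apply/seteqP; split => w /=; rewrite !(arrival_leE cN) ?(ltW s0)//; last by case.
  by move=> h; split => //; apply: (leq_trans h); case: cN => _ _ hh _; exact: hh.
move=> _ B _; rewrite setTI.
rewrite (_ : _ @^-1` B = \bigcup_(k in B) ([set w | (k <= N u w)%N] `\` [set w | (k.+1 <= N u w)%N])).
  apply: (@bigcup_measurable _ (g_sigma_algebraType past_gen)) => k _.
  by apply: measurableD; exact: le.
apply/seteqP; split => [w /= Bw|w [k Bk /= [h1 h2]]].
  by exists (N u w) => //=; rewrite ltnn.
by rewrite (_ : N u w = k)//; apply/eqP; rewrite eqn_leq h1 andbT leqNgt; exact/negP.
Qed.

Lemma counts_sub_past : <<s gen `[0, s] N >> `<=` <<s past_gen >>.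
Proof. by apply: sub_gen => u /=; rewrite in_itv/=; exact: past_gen_counts. Qed.

Let T j w := stopped_arrival N (s + t) j w.

Let S j w := stopped_arrival N s j w.

Let TE j w : (j <= N s w)%N -> T j w = S j w.
Proof.
move=> js; rewrite /T /S !stoppedE// ?(ltW s0)// (leq_trans js)//.
by case: cN => _ _ h _; apply: h => //; exact: ltW.
Qed.

(** The marks up to their elapsed times at [s], with arrival times read off [w2]. Since these are
    stopped at s + t and not at s, a mark that arrives after [s] has a negative level and a trivial
    past. *)
Definition past_section (w2 : Omega) : set (set Omega) :=
  <<s \bigcup_(j in [set j | (1 <= j)%N])
        sigma_gen `]-oo, s - stopped_arrival N (s + t) j w2] (started (Ls j)) >>.

(* Up to a null set, events of the past split into marks and arrival times:
   when the latter are frozen, only the marks up to the elapsed times matter. *)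
Definition representable (A : set Omega) : Prop :=
  exists H : set (Omega * Omega),
  [/\ measurable (H : set (g_sigma_algebraType marks_gen * g_sigma_algebraType (gen `[0, s] N))%type),
      forall w2, past_section w2 [set w1 | H (w1, w2)] &
      {ae P, forall w, A w <-> H (w, w)}].

Lemma representable_sigma_algebra : sigma_algebra setT representable.
Proof.
have sP w2 : sigma_algebra setT (past_section w2) by exact: smallest_sigma_algebra.
split.
- exists set0; split => //; first by move=> w2; case: (sP w2).
  exact: aeW.
- move=> A [H [mH sH aeH]]; exists (~` H); split.
  + exact: measurableC.
  + move=> w2; have [_ /(_ _ (sH w2)) h _] := sP w2.
    by move: h; rewrite setTD.
  + by apply: filterS aeH => w AH; rewrite setTD; split => h /AH.
- move=> F /choice[H hH]; exists (\bigcup_n H n); split.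
  + by apply: bigcup_measurable => n _; have [h _ _] := hH n.
  + move=> w2; have [_ _ h] := sP w2.
    rewrite (_ : mkset _ = \bigcup_n [set w1 | H n (w1, w2)]).
      by apply: h => n; have [_ h _] := hH n; exact: h.
    by apply/seteqP; split => w [n _ Hn]; exists n.
  + have : {ae P, forall w, forall n, F n w <-> H n (w, w)}.
      by apply: ae_foralln => n; have [_ _] := hH n.
    by apply: filterS => w h; split => -[n _ /h hn]; exists n.
Qed.

(** The representable events form a sigma-field, so generators suffice. Counts and arrival times
    give events of the second coordinate; an event of a mark has a section of level u - T_j <= s -
    T_j. *)
Lemma past_representable : past_sigma N Ls s `<=` representable.
Proof.
have s0' := ltW s0.
apply: smallest_sub; first exact: representable_sigma_algebra.
have mcount u : 0 <= u <= s ->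
    measurable_fun setT (N u : g_sigma_algebraType (gen `[0, s] N) -> nat).
  by move=> us; apply: measurable_gen => /=; rewrite in_itv.
have mS j : measurable_fun setT (S j : g_sigma_algebraType (gen `[0, s] N) -> R).
  exact: measurable_stopped_arrival.
have sP w2 : sigma_algebra setT (past_section w2) by exact: smallest_sigma_algebra.
have mle j : measurable ([set w | (j <= N s w)%N] : set (g_sigma_algebraType (gen `[0, s] N))).
  have := mcount s; rewrite s0' lexx => /(_ isT) /(_ measurableT [set k | (j <= k)%N]).
  by rewrite setTI; exact.
(* An event of the counts alone: its sections are empty or everything. *)
have base (A : set Omega) : measurable (A : set (g_sigma_algebraType (gen `[0, s] N))) -> representable A.
  move=> mA; exists (setT `*` A); split.
  - exact: measurableX.
  - move=> w2; have [Aw|Aw] := pselect (A w2).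
      rewrite (_ : mkset _ = setT); first exact: sigma_algebra_setT.
      by apply/seteqP; split.
    rewrite (_ : mkset _ = set0); first by case: (sP w2).
    by apply/seteqP; split => w // [].
  - by apply: aeW => w; split => // -[].
move=> A [[[n ->]|[j [j1 [B mB ->]]]]|[j [u [j1 us [B mB ->]]]]].
- apply: base; have := mcount s; rewrite s0' lexx => /(_ isT) /(_ measurableT [set n]).
  by rewrite setTI; exact.
- apply: base; rewrite (_ : [set w | _] = [set w | (j <= N s w)%N] `&` (EFin \o S j) @^-1` B).
    apply: measurableI => //; rewrite -(setTI (_ @^-1` _)).
    by apply: (measurableT_comp (@EFin_measurable R setT) (mS j)).
  apply/seteqP; split => w /=; rewrite (arrival_leE cN)// => -[h Bw]; split => //;
    by move: Bw; rewrite /= /S stoppedE// -/(arrival_time N j w) (arrival_fineK cN s0' h).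
(* [started (Ls j)] stands in for [Ls j]: it is surely 0 at negative times, so its past is trivial
   there. The exceptional null set of [representable] absorbs the difference. *)
- exists [set z | (j <= N s z.2)%N /\ B (started (Ls j) (u - S j z.2) z.1)]; split.
  + have mst := measurable_started_joint (addL j1) (fun v v0 => measurable_marks j1 v0).
    have mh : measurable_fun setT ((fun z => started (Ls j) (u - S j z.2) z.1) :
        (g_sigma_algebraType marks_gen * g_sigma_algebraType (gen `[0%R, s] N))%type -> R).
      apply: (measurableT_comp mst (g := fun z : (g_sigma_algebraType marks_gen *
        g_sigma_algebraType (gen `[0%R, s] N))%type => (z.1, u - S j z.2))).
      apply: measurable_fun_pair; first exact: measurable_fst.
      by apply: measurable_funB => //; exact: (measurableT_comp (mS j) measurable_snd).
    rewrite (_ : mkset _ = (setT `*` [set w | (j <= N s w)%N]) `&`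
        (fun z => started (Ls j) (u - S j z.2) z.1) @^-1` B); last first.
      by apply/seteqP; split => z [] // [].
    apply: measurableI; first exact: measurableX.
    by have := mh measurableT B mB; rewrite setTI.
  + move=> w2; have [js|js] := boolP (j <= N s w2)%N; last first.
      rewrite (_ : mkset _ = set0); first by case: (sP w2).
      by apply/seteqP; split => w //= -[h _]; rewrite h in js.
    rewrite (_ : mkset _ = started (Ls j) (u - S j w2) @^-1` B); last first.
      by apply/seteqP; split => w //= -[].
    apply: sub_sigma_algebra; exists j => //; apply: sub_sigma_algebra.
    exists (u - S j w2); split; last by exists B.
    by rewrite /= in_itv/= -/(T j w2) TE// lerD2r.
  + apply: filterS (ae_started (addL j1)) => w wE /=.
    rewrite (arrival_leE cN)//; split => -[h Bw]; split => //; move: Bw.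
      by rewrite /S stoppedE// wE.
    by rewrite /S stoppedE// wE.
Qed.

End past_representation.

Lemma fine_integral_eq d (T : measurableType d) (R : realType) (mu : {measure set T -> \bar R})
    (X Y : T -> R) :
  (\int[mu]_w (X w)%:E = \int[mu]_w (Y w)%:E)%E -> \int[mu]_w X w = \int[mu]_w Y w.
Proof. by move=> h; rewrite /Rintegral h. Qed.

(** * The second moment identity on past events *)

Section past_identity.
Context d (Omega : measurableType d) (R : realType) (P : probability Omega R).
Variables (eta : Omega -> cumulative R R) (rho : {measure set (R * R) -> \bar R}).
Variables (N : R -> Omega -> nat).
Variables (Ls : nat -> R -> Omega -> R) (rhoL : {measure set (R * R) -> \bar R}).
Variables (s t : R).
Let etap := fun u w => eta w u.
Hypothesis addE : additive_process P etap rho.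
Hypothesis coxN : cox_process P N etap.
Hypothesis addL : forall j, (1 <= j)%N -> additive_process P (Ls j) rhoL.
Hypothesis L2 : forall j, (1 <= j)%N -> forall u, 0 <= u -> ('E_P[Ls j u ^+ 2] < +oo)%E.
Hypothesis indL : mutually_independent P [set j | (1 <= j)%N] (fun j => sigma_gen `[0, +oo[ (Ls j)).
Let E2 := sigma_gen `[0, +oo[ N `|` sigma_gen `[0, +oo[ etap.
Hypothesis indF : independent P <<s marks_gen Ls >> <<s E2 >>.
Hypotheses (s0 : 0 < s) (t0 : 0 < t).

Let U := s + t.
Let m := jump_mean rhoL.
Let q := jump_sqr rhoL.
Let f x := m (U - x).
Let g x := q (U - x).

Hypothesis iJ2 : P.-integrable setT (EFin \o (fun w => int_eta eta (fun x => `|f x|) s U w ^+ 2)).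
Hypothesis iQ : P.-integrable setT (EFin \o int_eta eta (fun x => f x ^+ 2) s U).
Hypothesis ig : P.-integrable setT (EFin \o int_eta eta g s U).

Let cN : counting_process N. Proof. by case: coxN. Qed.
Let s0' : 0 <= s. Proof. exact: ltW. Qed.
Let U0 : 0 <= U. Proof. by rewrite addr_ge0 ?ltW. Qed.
Let sU : s <= U. Proof. by rewrite lerDl ltW. Qed.

Let cshift (h : R -> R) : continuous h -> continuous (fun x => h (U - x)).
Proof.
move=> ch x; apply: continuous_comp; last exact: ch.
by apply: cvgB; [exact: cvg_cst|exact: cvg_id].
Qed.

Let cf : continuous f.
Proof. by apply: cshift; apply: (continuous_jump_mean (addL (leqnn 1)) (L2 (leqnn 1))). Qed.
Let cg : continuous g.
Proof. by apply: cshift; apply: (continuous_jump_sqr (addL (leqnn 1)) (L2 (leqnn 1))). Qed.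

Let q_ge0 u : 0 <= q u.
Proof. by apply: Rintegral_ge0 => z _; exact: sqr_ge0. Qed.

(** With [h] equal to [jump_mean rhoL] or [jump_sqr rhoL], this is the contribution of the arrivals
    up to [s] to the conditional mean or variance. *)
Definition marks_sum (h : R -> R) (w : Omega) : R :=
  \sum_(1 <= j < (N s w).+1) (h (s + t - arrival_time N j w) - h (s - arrival_time N j w)).

Let EJ := \int[P]_w int_eta eta f s U w.
(** The variance of the integral of mu plus the mean of the integral of mu^2 + sigma^2: the
    contribution of the arrivals after [s] to the conditional variance. *)
Definition future_var : R :=
  \int[P]_w (int_eta eta f s U w ^+ 2) - EJ ^+ 2 + \int[P]_w int_eta eta (fun x => f x ^+ 2) s U w +
  \int[P]_w int_eta eta g s U w.
Let V0 := future_var.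

Let Rm := points_sum N f s U.
Let Rq := points_sum N g s U.

Let icst (c : R) : P.-integrable setT (EFin \o (fun=> c)).
Proof. by apply: (@prob_bounded_integrable _ _ _ _ _ `|c|). Qed.

Let Efut := gen `[s, +oo[ (fun v w => (N v w - N s w)%N).

Let mfut : Efut `<=` measurable.
Proof.
apply: gen_measurable => v /=; rewrite in_itv/= andbT => sv.
have mv := measurable_cox coxN (le_trans s0' sv); have ms := measurable_cox coxN s0'.
exact: (measurable_nat2 subn).
Qed.

Let mpoints_fut h : continuous h ->
  measurable_fun setT (points_sum N h s U : g_sigma_algebraType Efut -> R).
Proof.
move=> ch; apply: (measurable_points_sum coxN) => // u /andP[su _].
rewrite (_ : (fun w => _) = (fun w => (N u w - N s w)%N%:R)); last first.
  by apply/funext => w; rewrite natrB//; exact: (cox_homo coxN).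
apply: (measurableT_comp (f := (fun n : nat => n%:R : R))) => //.
by apply: (measurable_gen (X := fun v w => (N v w - N s w)%N)); rewrite /= in_itv/= su.
Qed.

Let mpoints h : continuous h -> measurable_fun setT (points_sum N h s U).
Proof. by move=> ch; apply: (measurableT_comp (mpoints_fut ch)); exact: measurable_sub_id. Qed.

Let iRq : P.-integrable setT (EFin \o Rq).
Proof.
have Rq0 w : 0 <= Rq w by apply: sumr_ge0 => j _; exact: q_ge0.
apply/integrableP; split; first by apply/measurable_EFinP; exact: mpoints.
under eq_integral do rewrite abse_EFin ger0_norm//.
rewrite (campbell_ge0 addE coxN s0' sU cg (fun x => q_ge0 _)) ltey_eq.
by rewrite (integrable_fin_num measurableT ig).
Qed.

Let iRm2 : P.-integrable setT (EFin \o (fun w => Rm w ^+ 2)).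
Proof. exact: (integrable_points_sum_sqr addE coxN s0' sU cf iJ2 iQ). Qed.

Let iRm : P.-integrable setT (EFin \o Rm).
Proof. by apply: sqr_integrable_integrable; [exact: mpoints|exact: iRm2]. Qed.

(** What the squared deviation leaves, besides [marks_sum q], once the marks are integrated out; it
    depends on the counts after [s] only. *)
Let W (k : R) w := Rq w + (Rm w - EJ + k) ^+ 2.

Let W_ge0 k w : 0 <= W k w.
Proof. by rewrite addr_ge0 ?sqr_ge0//; apply: sumr_ge0 => j _; exact: q_ge0. Qed.

(** Campbell's formulas for [Rm] and [Rq]; since [Rm] has mean [EJ], no term linear in [k]
    remains. *)
Let integral_W k : (\int[P]_w (W k w)%:E = (V0 + k ^+ 2)%:E)%E.
Proof.
pose c := 2 * (k - EJ).
have i1 : P.-integrable setT (EFin \o (fun w => c * Rm w)) := integrableZl measurableT c iRm.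
have i2 := integrableD measurableT iRm2 i1.
have i3 := integrableD measurableT iRq i2.
have E w : W k w = (Rq w + (Rm w ^+ 2 + c * Rm w)) + (k - EJ) ^+ 2 by rewrite /W /c; ring.
have iW : P.-integrable setT (EFin \o W k).
  by rewrite (funext E); exact: (integrableD measurableT i3 (icst _)).
rewrite -[LHS]fineK; last exact: (integrable_fin_num measurableT iW).
congr EFin; transitivity (\int[P]_w (Rq w + (Rm w ^+ 2 + c * Rm w) + (k - EJ) ^+ 2)).
  by congr fine; apply: eq_integral => w _; rewrite E.
rewrite !RintegralD//; try exact: (icst _); rewrite Rintegral_prob_cst RintegralZl//.
have e1 : \int[P]_w Rm w = EJ by exact: (campbell_mean addE coxN s0' sU cf iJ2 iQ).
have e2 : \int[P]_w (Rm w ^+ 2) = \int[P]_w (int_eta eta f s U w ^+ 2) +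
    \int[P]_w int_eta eta (fun x => f x ^+ 2) s U w.
  exact: (campbell_second_moment addE coxN s0' sU cf iJ2 iQ).
have e3 : \int[P]_w Rq w = \int[P]_w int_eta eta g s U w.
  have g0 x : 0 <= g x by exact: q_ge0.
  have e := campbell_ge0 addE coxN s0' sU cg g0.
  by apply: fine_integral_eq; exact: e.
have key x y z A B C : x = EJ -> y = A + B -> z = C ->
    z + (y + c * x) + (k - EJ) ^+ 2 = A - EJ ^+ 2 + B + C + k ^+ 2.
  by move=> -> -> ->; rewrite /c; ring.
exact: (key _ _ _ _ _ _ e1 e2 e3).
Qed.

Let E2s := gen `[0, s] N.

Let mcount_past u : 0 <= u <= s -> measurable_fun setT (N u : g_sigma_algebraType E2s -> nat).
Proof. by move=> us; apply: measurable_gen => /=; rewrite in_itv. Qed.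

Lemma measurable_marks_sum h : continuous h ->
  measurable_fun setT (marks_sum h : g_sigma_algebraType E2s -> R).
Proof.
move=> ch; pose S j w := stopped_arrival N s j w.
have mS j : measurable_fun setT (S j : g_sigma_algebraType E2s -> R).
  exact: measurable_stopped_arrival.
pose F n w := \sum_(1 <= j < n.+1) (h (s + t - S j w) - h (s - S j w)).
rewrite (_ : marks_sum h = (fun w => F (N s w) w)).
  apply: measurable_random_index; last by apply: mcount_past; rewrite s0' lexx.
  move=> n; apply: measurable_sum => j.
  by apply: measurable_funB; apply: (measurableT_comp (continuous_measurable_fun ch));
    exact: measurable_funB.
apply/funext => w; rewrite /marks_sum /F big_nat_cond [RHS]big_nat_cond.
by apply: eq_bigr => j; rewrite andbT ltnS => /andP[j1 js]; rewrite /S /stopped_arrival js.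
Qed.

Let cm : continuous m.
Proof. exact: (continuous_jump_mean (addL (leqnn 1)) (L2 (leqnn 1))). Qed.
Let cq : continuous q.
Proof. exact: (continuous_jump_sqr (addL (leqnn 1)) (L2 (leqnn 1))). Qed.

Let arrival_le_s j w : (j <= N s w)%N -> arrival_time N j w <= s.
Proof. by move=> js; rewrite (arrival_time_le cN s0'). Qed.

Lemma marks_sum_var_ge0 w : 0 <= marks_sum q w.
Proof.
rewrite /marks_sum big_nat_cond; apply: sumr_ge0 => j; rewrite andbT ltnS => /andP[_ js].
rewrite subr_ge0; apply: (jump_sqr_homo (addL (leqnn 1)) (L2 (leqnn 1))).
  by rewrite subr_ge0; exact: arrival_le_s.
by rewrite lerD2r lerDl ltW.
Qed.

Let T j w := stopped_arrival N U j w.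

(** Split at [s]: an arrival after [s] has s - T_j < 0 and contributes h(U - T_j) alone. *)
Let total h w : (forall u, u <= 0 -> h u = 0) ->
  \sum_(1 <= j < (N U w).+1) (h (U - T j w) - h (s - T j w)) =
  marks_sum h w + points_sum N (fun x => h (U - x)) s U w.
Proof.
move=> h0; have NsU : (N s w <= N U w)%N by exact: (cox_homo coxN).
rewrite (@big_cat_nat _ _ _ (N s w).+1)//=; congr (_ + _).
  rewrite /marks_sum big_nat_cond [RHS]big_nat_cond; apply: eq_bigr => j.
  by rewrite andbT ltnS => /andP[_ js]; rewrite /T /stopped_arrival (leq_trans js).
rewrite /points_sum big_nat_cond [RHS]big_nat_cond; apply: eq_bigr => j.
rewrite andbT ltnS => /andP[js jU]; rewrite /T /stopped_arrival jU [h (s - _)]h0 ?subr0//.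
rewrite subr_le0; apply: ltW; rewrite ltNge (arrival_time_le cN U0)//.
by rewrite -ltnNge.
Qed.

Let E2_measurable : E2 `<=` measurable.
Proof.
move=> A [|]; apply: sigma_gen_sub; apply: gen_measurable => u.
  by rewrite /= in_itv/= andbT; exact: (measurable_cox coxN).
by move=> _; have [h _ _ _ _] := addE; exact: h.
Qed.

Let mcount u : 0 <= u -> measurable_fun setT (N u : g_sigma_algebraType E2 -> nat).
Proof.
move=> u0 _ B mB; rewrite setTI; apply: sub_sigma_algebra; left.
by apply: sub_sigma_algebra; exists u; split; [rewrite /= in_itv/= u0|exists B].
Qed.

Let E2s_sub : <<s E2s >> `<=` <<s E2 >>.
Proof. by apply: sub_gen => u /=; rewrite in_itv/= => /andP[u0 _]; exact: mcount. Qed.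

Let M u := cluster_process N Ls u.
Let Y w := marks_sum m w + EJ.

Let E1 := marks_gen Ls.
Let mE1 : E1 `<=` measurable. Proof. exact: (marks_gen_measurable addL). Qed.

Let D j (z : Omega * Omega) : R :=
  started (Ls j) (U - T j z.2) z.1 - started (Ls j) (s - T j z.2) z.1.

Let mD j : (1 <= j)%N ->
  measurable_fun setT (D j : (g_sigma_algebraType E1 * g_sigma_algebraType E2)%type -> R).
Proof.
move=> j1; have mst := measurable_started_joint (addL j1) (fun v v0 => measurable_marks j1 v0).
have mT : measurable_fun setT (T j : g_sigma_algebraType E2 -> R).
  by apply: measurable_stopped_arrival => // u /andP[u0 _]; exact: mcount.
have h c : measurable_fun setT ((fun z => started (Ls j) (c - T j z.2) z.1) :
    (g_sigma_algebraType E1 * g_sigma_algebraType E2)%type -> R).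
  apply: (measurableT_comp mst (g := fun z : (g_sigma_algebraType E1 *
        g_sigma_algebraType E2)%type => (z.1, c - T j z.2))).
  apply: measurable_fun_pair; first exact: measurable_fst.
  by apply: measurable_funB => //; exact: (measurableT_comp mT measurable_snd).
by apply: measurable_funB; exact: h.
Qed.

(** The equality holds off the null set where some mark differs from its [started] version. As the
    marks are evaluated at random times, one null set must serve all marks and all times. *)
Let ae_increment : {ae P, forall w, M U w - M s w = \sum_(1 <= j < (N U w).+1) D j (w, w)}.
Proof.
have : {ae P, forall w, forall n, forall v, Ls n.+1 v w = started (Ls n.+1) v w}.
  by apply: ae_foralln => n; exact: (ae_started (addL (ltn0Sn n))).
apply: filterS => w hw; have NsU : (N s w <= N U w)%N by exact: (cox_homo coxN).
have hw' j v : (1 <= j)%N -> Ls j v w = started (Ls j) v w by case: j => // j _; exact: hw.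
rewrite (@big_cat_nat _ _ _ (N s w).+1)//= /M /cluster_process.
rewrite (@big_cat_nat _ _ _ (N s w).+1 1 (N U w).+1)//= addrAC -sumrB; congr (_ + _).
  apply: eq_big_nat => j; rewrite ltnS => /andP[j1 js].
  by rewrite /D /T/= /stopped_arrival (leq_trans js)// !hw'.
apply: eq_big_nat => j; rewrite ltnS => /andP[js jU].
rewrite /D /T/= /stopped_arrival jU hw'; last exact: leq_trans js.
rewrite [in X in _ = _ - X]/started leNgt subr_lt0 ltNge (arrival_time_le cN U0)//.
by rewrite -ltnNge js/= subr0.
Qed.

(** Three layers. With the path of [N] frozen, the marks are integrated out by
    [inner_second_moment]. The section probability of the past event depends on the counts up to [s]
    and [W k] on those after [s], which are independent. Finally [integral_W] evaluates the mean of
    [W k]. All integrands are nonnegative, so no moment of [M] is presupposed. *)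
Lemma past_second_moment (A : set Omega) (k : R) : past_sigma N Ls s A ->
  (\int[P]_w (\1_A w * (M U w - M s w - Y w + k) ^+ 2)%:E =
   \int[P]_w (\1_A w * (marks_sum q w + V0 + k ^+ 2))%:E)%E.
Proof.
move=> pA; have mA : measurable A by apply: (sigma_gen_sub _ pA); exact: (past_gen_measurable coxN addL s0).
have [H [mH sH aeH]] := past_representable coxN addL s0 t0 pA.
have m1Y : measurable_fun setT (marks_sum m : g_sigma_algebraType E2s -> R) by exact: measurable_marks_sum.
have m1q : measurable_fun setT (marks_sum q : g_sigma_algebraType E2s -> R) by exact: measurable_marks_sum.
have E2sm : E2s `<=` measurable by move=> B hB; apply: (sigma_gen_sub E2_measurable); apply: E2s_sub; exact: sub_sigma_algebra.
have mYq h : measurable_fun setT (h : g_sigma_algebraType E2s -> R) -> measurable_fun setT (h : Omega -> R).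
  by move=> mh; apply: (measurableT_comp mh); exact: measurable_sub_id.
have indS : independent P <<s E1 >> <<s E2s >> by apply: indep_sub indF.
(* [h1] involves the counts up to [U], [h2] only those up to [s]; they are frozen with respect to
   [E2] and [E2s] respectively. *)
pose h1 (z : Omega * Omega) := (\1_H z * (\sum_(1 <= j < (N U z.2).+1) D j z - (Y z.2 - k)) ^+ 2)%:E.
pose h2 (z : Omega * Omega) := (\1_H z * (marks_sum q z.2 + V0 + k ^+ 2))%:E.
have mH1 : measurable (H : set (g_sigma_algebraType E1 * g_sigma_algebraType E2)%type).
  pose i (z : (g_sigma_algebraType E1 * g_sigma_algebraType E2)%type) :
    (g_sigma_algebraType E1 * g_sigma_algebraType E2s)%type := z.
  have mi : measurable_fun setT i.
    apply/measurable_fun_pairP; split; first exact: measurable_fst.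
    have mid : measurable_fun setT ((fun w => w) : g_sigma_algebraType E2 -> g_sigma_algebraType E2s).
      by move=> _ B mB; rewrite setTI; exact: E2s_sub.
    exact: (measurableT_comp mid measurable_snd).
  by have := mi measurableT H mH; rewrite setTI.
(* The sign is not evident from the definition of [future_var]; it comes from the nonnegative [W k],
   whose mean this is. *)
have V00 : 0 <= V0 + k ^+ 2.
  rewrite -lee_fin -integral_W; apply: integral_ge0 => w _; rewrite lee_fin; exact: W_ge0.
have mh1 : measurable_fun setT (h1 : (g_sigma_algebraType E1 * g_sigma_algebraType E2)%type -> \bar R).
  apply/measurable_EFinP; apply: measurable_funM; first exact: measurable_indic.
  apply: measurable_funX; apply: measurable_funB.
    apply: (@measurable_random_index _ (g_sigma_algebraType E1 * g_sigma_algebraType E2)%type _ R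
      (fun n z => \sum_(1 <= j < n.+1) D j z) (fun z => N U z.2)).
      move=> n; rewrite (_ : (fun z => _) = (fun z => \sum_(1 <= j < n.+1) if (1 <= j)%N then D j z else 0)).
        by apply: measurable_sum => j; case j1 : (1 <= j)%N => //; exact: mD.
      apply/funext => z; rewrite big_nat_cond [RHS]big_nat_cond; apply: eq_bigr => j.
      by rewrite andbT => /andP[-> _].
    exact: (measurableT_comp (mcount U0) measurable_snd).
  apply: (measurableT_comp (f := (fun w => Y w - k) : g_sigma_algebraType E2 -> R)); last exact: measurable_snd.
  apply: measurable_funB => //; apply: measurable_funD => //.
  exact: (measurable_sub_mono E2s_sub).
have mh2 : measurable_fun setT (h2 : (g_sigma_algebraType E1 * g_sigma_algebraType E2s)%type -> \bar R).
  apply/measurable_EFinP; apply: measurable_funM; first exact: measurable_indic.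
  apply: (measurableT_comp (f := (fun w => marks_sum q w + V0 + k ^+ 2) : g_sigma_algebraType E2s -> R)); last exact: measurable_snd.
  by apply: measurable_funD => //; apply: measurable_funD.
have h10 z : (0 <= h1 z)%E by rewrite lee_fin mulr_ge0 ?sqr_ge0// indicE.
have q0 w := marks_sum_var_ge0 w.
have h20 z : (0 <= h2 z)%E by rewrite lee_fin mulr_ge0 ?indicE// -addrA addr_ge0.
have [mh1' _ e1] := frozen_integral mE1 E2_measurable indF mh1 h10.
have [mh2' _ e2] := frozen_integral mE1 E2sm indS mh2 h20.
(* The probability of the past event when the path of [N] is frozen at [v]. *)
pose p v := P [set w | H (w, v)].
have mC v : measurable [set w | H (w, v)].
  apply: (sigma_gen_sub mE1); have := @measurable_ysection _ _ (g_sigma_algebraType E1) (g_sigma_algebraType E2s) H v mH.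
  by congr (_ _); apply/seteqP; split => w; rewrite /ysection/= inE.
have p0 v : (0 <= p v)%E by exact: measure_ge0.
have indE w v : \1_H (w, v) = \1_[set w | H (w, v)] w :> R.
  by rewrite !indicE; congr (nat_of_bool _)%:R; apply/idP/idP; rewrite !inE.
have pE v : (\int[P]_w (\1_H (w, v))%:E = p v)%E.
  under eq_integral do rewrite indE.
  by rewrite integral_indic// setIT.
have mp : measurable_fun setT (p : g_sigma_algebraType E2s -> \bar R).
  have [||_ h _] := @frozen_integral _ _ _ P _ _ mE1 E2sm indS (fun z => (\1_H z)%:E).
  - exact/measurable_EFinP/measurable_indic.
  - by move=> z; rewrite lee_fin indicE.
  by rewrite (_ : p = (fun v => (\int[P]_w (\1_H (w, v))%:E)%E))//; apply/funext => v; rewrite pE.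
have mpO : measurable_fun setT (p : Omega -> \bar R).
  by apply: (measurableT_comp mp); exact: measurable_sub_id.
have mqO : measurable_fun setT (marks_sum q : Omega -> R) by exact: mYq.
have mW : measurable_fun setT (W k : g_sigma_algebraType Efut -> R).
  apply: measurable_funD; first exact: mpoints_fut.
  apply: measurable_funX; apply: measurable_funD => //; apply: measurable_funB => //.
  exact: mpoints_fut.
have mWO : measurable_fun setT (W k : Omega -> R).
  by apply: (measurableT_comp mW); exact: measurable_sub_id.
have i1 v : (\int[P]_w h1 (w, v) = p v * (marks_sum q v + W k v)%:E)%E.
  have ab j : s - T j v <= U - T j v by rewrite lerD2r.
  have := inner_second_moment addL L2 indL ab (N U v) (Y v - k) (sH v).
  rewrite (total v (fun u => @jump_mean_neg _ rhoL u)) (total v (fun u => @jump_sqr_neg _ rhoL u)).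
  have -> : marks_sum m v + Rm v - (Y v - k) = Rm v - EJ + k by rewrite /Y; ring.
  move=> E; rewrite /W addrA; apply: etrans E; apply: eq_integral => w _.
  by rewrite /h1 indE.
have i2 v : (\int[P]_w h2 (w, v) = p v * (marks_sum q v + V0 + k ^+ 2)%:E)%E.
  rewrite -pE; transitivity (\int[P]_w ((\1_H (w, v))%:E * (marks_sum q v + V0 + k ^+ 2)%:E))%E.
    by apply: eq_integral => w _; rewrite /h2 EFinM.
  rewrite ge0_integralZr//.
  - by apply/measurable_EFinP; under eq_fun do rewrite indE; exact: measurable_indic.
  - by rewrite lee_fin -addrA addr_ge0.
have mAf (F : Omega -> R) : measurable_fun setT F ->
    measurable_fun setT (fun w => (\1_A w * F w)%:E).
  by move=> mF; apply/measurable_EFinP; apply: measurable_funM.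
have -> : (\int[P]_w (\1_A w * (M U w - M s w - Y w + k) ^+ 2)%:E = \int[P]_w h1 (w, w))%E.
  apply: ae_eq_integral => //.
    apply: mAf; apply: measurable_funX; apply: measurable_funD => //; apply: measurable_funB.
      by apply: measurable_funB; exact: (measurable_cluster coxN addL).
    by apply: measurable_funD => //; exact: mYq.
  apply: filterS2 aeH ae_increment => w AH MD _; rewrite /h1 MD.
  rewrite (_ : \1_A w = \1_H (w, w)); last first.
    by rewrite !indicE; congr (nat_of_bool _)%:R; apply/idP/idP; rewrite !inE => /AH.
  by congr (_ * _ ^+ 2)%:E; ring.
have -> : (\int[P]_w (\1_A w * (marks_sum q w + V0 + k ^+ 2))%:E = \int[P]_w h2 (w, w))%E.
  apply: ae_eq_integral; [exact: measurableT| |exact: mh2'|].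
    by apply: mAf; apply: measurable_funD => //; exact: measurable_funD.
  apply: filterS aeH => w AH _; rewrite /h2 (_ : \1_A w = \1_H (w, w))//.
  by rewrite !indicE; congr (nat_of_bool _)%:R; apply/idP/idP; rewrite !inE => /AH.
rewrite e1 e2; under eq_integral do rewrite i1 EFinD ge0_muleDr ?lee_fin//.
under [RHS]eq_integral do rewrite i2 -addrA EFinD ge0_muleDr ?lee_fin//.
have mpq : measurable_fun setT (fun w => p w * (marks_sum q w)%:E)%E.
  by apply: emeasurable_funM => //; exact/measurable_EFinP.
rewrite ge0_integralD//; first last.
- by apply: emeasurable_funM => //; exact/measurable_EFinP.
- by move=> w _; rewrite mule_ge0// lee_fin.
- by move=> w _; rewrite mule_ge0// lee_fin.
rewrite ge0_integralD//; first last.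
- exact: emeasurable_funM.
- by move=> w _; rewrite mule_ge0// lee_fin.
- by move=> w _; rewrite mule_ge0// lee_fin.
congr (_ + _)%E; rewrite ge0_integralZr//.
(* [p] is a function of the past counts and [W k] of the future ones, so the integral of their
   product factors. *)
have ind := cox_past_future addE coxN s0'.
rewrite (indep_integralM E2sm mfut ind (X := p) (Y := fun w => (W k w)%:E)) ?integral_W//.
- exact/measurable_EFinP.
- by move=> w; rewrite lee_fin.
Qed.

Hypothesis iSm : P.-integrable setT (EFin \o marks_sum m).
Hypothesis iSq : P.-integrable setT (EFin \o marks_sum q).

Let Z w := M U w - M s w - Y w.

Let iY : P.-integrable setT (EFin \o Y).
Proof. exact: (integrableD measurableT iSm (icst EJ)). Qed.

Let iV : P.-integrable setT (EFin \o (fun w => marks_sum q w + V0)).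
Proof. exact: (integrableD measurableT iSq (icst V0)). Qed.

Let mY : measurable_fun setT Y.
Proof. by have [/measurable_EFinP] := integrableP _ _ _ iY. Qed.

Let mZ : measurable_fun setT Z.
Proof. by apply: measurable_funB => //; apply: measurable_funB; exact: (measurable_cluster coxN addL). Qed.

Let past_measurable : past_sigma N Ls s `<=` measurable.
Proof. by apply: sigma_gen_sub; exact: (past_gen_measurable coxN addL s0). Qed.

Let past_setT : past_sigma N Ls s setT.
Proof. by apply: sigma_algebra_setT; exact: smallest_sigma_algebra. Qed.

(** The identity holds in [0, +oo]; on the whole space with k = 0 its right side is finite. *)
Let iZ2 : P.-integrable setT (EFin \o (fun w => Z w ^+ 2)).
Proof.
apply/integrableP; split; first by apply/measurable_EFinP; exact: measurable_funX.
have e := past_second_moment 0 past_setT.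
rewrite (_ : \int[P]_x _ = \int[P]_w (\1_[set: Omega] w * (M U w - M s w - Y w + 0) ^+ 2)%:E)%E; last first.
  by apply: eq_integral => w _; rewrite indicT mul1r addr0 abse_EFin ger0_norm ?sqr_ge0.
rewrite e ltey_eq; apply/orP; left.
rewrite (_ : \int[P]_w _ = \int[P]_w (marks_sum q w + V0)%:E)%E.
  exact: (integrable_fin_num measurableT iV).
by apply: eq_integral => w _; rewrite indicT mul1r expr0n addr0.
Qed.

Let iZ : P.-integrable setT (EFin \o Z).
Proof. exact: sqr_integrable_integrable. Qed.

Let integrable_indicM (A : set Omega) (X : Omega -> R) : measurable A ->
  P.-integrable setT (EFin \o X) -> P.-integrable setT (EFin \o (fun w => \1_A w * X w)).
Proof.
move=> mA iX; have [/measurable_EFinP mX _] := integrableP _ _ _ iX.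
apply: le_integrable iX => //; first by apply/measurable_EFinP; exact: measurable_funM.
move=> w _ /=; rewrite lee_fin normrM indicE.
by case: (_ \in _); rewrite ?normr1 ?mul1r// normr0 mul0r.
Qed.

Let integral_indicM (A : set Omega) (X : Omega -> R) :
  (\int[P]_(w in A) (X w)%:E = \int[P]_w (\1_A w * X w)%:E)%E.
Proof.
rewrite integral_mkcond; apply: eq_integral => w _; rewrite patchE indicE.
by case: ifPn => _; rewrite ?mul1r// mul0r.
Qed.

Let integral_Z (A : set Omega) : past_sigma N Ls s A -> \int[P]_w (\1_A w * Z w) = 0.
Proof.
move=> pA; have mA := past_measurable pA.
have i1 : P.-integrable setT (EFin \o (fun w => \1_A w * 1)) := integrable_indicM mA (icst 1).
have i2 := integrable_indicM mA iZ2; have i3 := integrable_indicM mA iZ.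
have i4 := integrable_indicM mA iV.
have i5 : P.-integrable setT (EFin \o (fun w => 2 * (\1_A w * Z w))) := integrableZl measurableT 2 i3.
have e0 : \int[P]_w (\1_A w * Z w ^+ 2) = \int[P]_w (\1_A w * (marks_sum q w + V0)).
  have := past_second_moment 0 pA.
  have -> : (fun w => (\1_A w * (M U w - M s w - Y w + 0) ^+ 2)%:E) = (fun w => (\1_A w * Z w ^+ 2)%:E).
    by apply/funext => w; rewrite addr0.
  have -> : (fun w => (\1_A w * (marks_sum q w + V0 + 0 ^+ 2))%:E) = (fun w => (\1_A w * (marks_sum q w + V0))%:E).
    by apply/funext => w; rewrite expr0n addr0.
  exact: fine_integral_eq.
have e1 : \int[P]_w (\1_A w * Z w ^+ 2 + (2 * (\1_A w * Z w) + \1_A w * 1)) =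
    \int[P]_w (\1_A w * (marks_sum q w + V0) + \1_A w * 1).
  have := past_second_moment 1 pA.
  have -> : (fun w => (\1_A w * (M U w - M s w - Y w + 1) ^+ 2)%:E) =
      (fun w => (\1_A w * Z w ^+ 2 + (2 * (\1_A w * Z w) + \1_A w * 1))%:E).
    by apply/funext => w; congr EFin; rewrite -/(Z w); ring.
  have -> : (fun w => (\1_A w * (marks_sum q w + V0 + 1 ^+ 2))%:E) =
      (fun w => (\1_A w * (marks_sum q w + V0) + \1_A w * 1)%:E).
    by apply/funext => w; congr EFin; ring.
  exact: fine_integral_eq.
move: e1; rewrite RintegralD//; last exact: (integrableD measurableT i5 i1).
rewrite [X in _ + X]RintegralD// RintegralZl// [in RHS]RintegralD// e0.
by lra.
Qed.

Let past_sub h : continuous h -> measurable_fun setT (marks_sum h : g_sigma_algebraType (past_gen N Ls s) -> R).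
Proof.
move=> ch; apply: measurable_sub_mono (measurable_marks_sum ch).
exact: (counts_sub_past coxN s0).
Qed.

Lemma past_cond_expectation : is_cond_expectation P (past_sigma N Ls s)
  (fun w => (M U w - M s w)%:E) (fun w => (Y w)%:E).
Proof.
have iM : P.-integrable setT (EFin \o (fun w => M U w - M s w)).
  have -> : (fun w => M U w - M s w) = (fun w => Z w + Y w) by apply/funext => w; rewrite /Z subrK.
  exact: (integrableD measurableT iZ iY).
split => //.
- by split => //; exact: smallest_sigma_algebra.
- move=> B mB.
  have mYp : measurable_fun setT (Y : g_sigma_algebraType (past_gen N Ls s) -> R).
    by apply: measurable_funD; [exact: past_sub cm|exact: measurable_cst].
  have /measurable_EFinP := mYp.
  by move=> /(_ measurableT B mB); rewrite setTI.
move=> A pA; have mA := past_measurable pA; rewrite !(integral_indicM A).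
have i1 := integrable_indicM mA iZ; have i2 := integrable_indicM mA iY.
have -> : (fun w => (\1_A w * (M U w - M s w))%:E) = (fun w => (\1_A w * Y w)%:E + (\1_A w * Z w)%:E)%E.
  by apply/funext => w; rewrite -EFinD; congr EFin; rewrite /Z; ring.
rewrite [RHS]integralD// -[in X in (_ + X)%E](fineK (integrable_fin_num measurableT i1)).
by rewrite [X in (_ + X%:E)%E](integral_Z pA) adde0.
Qed.

Lemma past_cond_variance : is_cond_expectation P (past_sigma N Ls s)
  (fun w => ((M U w - M s w - Y w) ^+ 2)%:E) (fun w => (marks_sum q w + V0)%:E).
Proof.
split => //.
- by split => //; exact: smallest_sigma_algebra.
- move=> B mB.
  have mVp : measurable_fun setT ((fun w => marks_sum q w + V0) : g_sigma_algebraType (past_gen N Ls s) -> R).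
    by apply: measurable_funD; [exact: past_sub cq|exact: measurable_cst].
  have /measurable_EFinP := mVp.
  by move=> /(_ measurableT B mB); rewrite setTI.
move=> A pA; rewrite !(integral_indicM A); have := past_second_moment 0 pA.
have -> : (fun w => (\1_A w * (M U w - M s w - Y w + 0) ^+ 2)%:E) =
    (fun w => (\1_A w * (M U w - M s w - Y w) ^+ 2)%:E) by apply/funext => w; rewrite addr0.
have -> : (fun w => (\1_A w * (marks_sum q w + V0 + 0 ^+ 2))%:E) =
    (fun w => (\1_A w * (marks_sum q w + V0))%:E) by apply/funext => w; rewrite expr0n addr0.
by move->.
Qed.

End past_identity.

(** * The conditional moments *)

Lemma integral_LetaE d (Omega : measurableType d) (R : realType) (eta : Omega -> cumulative R R) (h : R -> R) a b w :
  continuous h ->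
  (\int[Leta eta w]_(x in `]a, b]%classic) (h x)%:E)%E = (int_eta eta h a b w)%:E.
Proof.
move=> ch; rewrite /int_eta /Rintegral fineK//.
by apply: integrable_fin_num; [exact: measurable_itv|exact: integrable_Leta].
Qed.

Lemma int_eta_widen d (Omega : measurableType d) (R : realType) (eta : Omega -> cumulative R R) (h : R -> R) a c b w :
  a <= c -> c <= b -> continuous h -> (forall x, 0 <= h x) ->
  int_eta eta h c b w <= int_eta eta h a b w.
Proof.
move=> ac cb ch h0.
have := @Rintegral_slice_cat _ _ _ (Leta eta w) (@idfun (measurableTypeR R) : measurableTypeR R -> R)
  (@measurable_id _ _ setT) a c b h ac cb.
rewrite /slice preimage_id => E; rewrite /int_eta E; last exact: integrable_Leta.
by rewrite lerDr; exact: int_eta_ge0.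
Qed.

Lemma le_integrable_ge0 d (T : measurableType d) (R : realType) (mu : {measure set T -> \bar R})
    (X Y : T -> R) : measurable_fun setT X -> mu.-integrable setT (EFin \o Y) ->
  (forall w, 0 <= X w <= Y w) -> mu.-integrable setT (EFin \o X).
Proof.
move=> mX iY XY; apply: le_integrable iY => //; first exact/measurable_EFinP.
by move=> w _ /=; have /andP[X0 le] := XY w; rewrite lee_fin !ger0_norm// (le_trans X0).
Qed.

Lemma variance_integrable d (Omega : measurableType d) (R : realType) (P : probability Omega R)
    (X : Omega -> R) : measurable_fun setT X ->
  P.-integrable setT (EFin \o (fun w => X w ^+ 2)) ->
  ('V_P[X])%E = (\int[P]_w (X w ^+ 2) - (\int[P]_w X w) ^+ 2)%:E.
Proof.
move=> mX iX2; have iX : P.-integrable setT (EFin \o X) by exact: sqr_integrable_integrable.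
have XX : X * X = (fun w => X w ^+ 2) by apply/funext => w; rewrite expr2.
rewrite /variance covarianceE ?XX; try exact/Lfun1_integrable.
rewrite unlock EFinB expr2 EFinM /Rintegral !fineK//.
- exact: (integrable_fin_num measurableT iX).
- exact: (integrable_fin_num measurableT iX2).
Qed.

Lemma integrable_points_sum d (Omega : measurableType d) (R : realType) (P : probability Omega R)
    (eta : Omega -> cumulative R R) (rho : {measure set (R * R) -> \bar R}) (N : R -> Omega -> nat)
    (a b : R) (h : R -> R) :
  additive_process P (fun u w => eta w u) rho -> cox_process P N (fun u w => eta w u) ->
  0 <= a -> a <= b -> continuous h -> (forall x, 0 <= h x) ->
  P.-integrable setT (EFin \o int_eta eta h a b) ->
  P.-integrable setT (EFin \o points_sum N h a b).
Proof.
move=> addE coxN a0 ab ch h0 ih; apply/integrableP; split.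
  apply/measurable_EFinP; exact: (measurable_points coxN).
under eq_integral => w _ do rewrite abse_EFin ger0_norm ?sumr_ge0//.
by rewrite (campbell_ge0 addE coxN a0 ab ch h0) ltey_eq (integrable_fin_num measurableT ih).
Qed.

Theorem theorem3p2 (R : realType)
  (d : measure_display) (Omega : measurableType d) (P : probability Omega R)
  (d' : measure_display) (Omega' : measurableType d') (Q : probability Omega' R)
  (* the directing process, with nondecreasing right-continuous paths *)
  (eta : Omega -> cumulative R R) (rho : {measure set (R * R) -> \bar R})
  (N : R -> Omega -> nat)
  (L : R -> Omega' -> R) (rhoL : {measure set (R * R) -> \bar R})
  (Ls : nat -> R -> Omega -> R)
  (s t : R) :
  let etap := fun u w => eta w u in
  let mu := mean_incr Q L in
  let sigma2 := var_incr Q L in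
  let Leta : Omega -> {measure set (measurableTypeR R) -> \bar R} :=
    fun w => lebesgue_stieltjes_measure (eta w) in
  let M := cluster_process N Ls in
  let T := fun j w => fine (arrival N j w) in
  let G := past_sigma N Ls s in
  additive_process P etap rho ->
  cox_process P N etap ->
  additive_process Q L rhoL ->
  (* the L_j, j >= 1, are iid copies of L, independent of (N, eta) *)
  (forall j, (1 <= j)%N -> additive_process P (Ls j) rhoL) ->
  (forall j, (1 <= j)%N -> same_law P Q (Ls j) L) ->
  mutually_independent P [set j | (1 <= j)%N]
    (fun j => sigma_gen `[0, +oo[ (Ls j)) ->
  independent P
    <<s \bigcup_(j in [set j | (1 <= j)%N]) sigma_gen `[0, +oo[ (Ls j) >>
    <<s sigma_gen `[0, +oo[ N `|` sigma_gen `[0, +oo[ etap >> ->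
  (* standing moment assumptions *)
  (forall u, 0 <= u -> ('E_Q[L u ^+ 2] < +oo)%E) ->
  (forall u, 0 < u -> {ae P, forall w, (Leta w).-integrable `]0, u]
     (fun x => (Num.max (mu 0 (u - x)) (mu 0 (u - x) ^+ 2))%:E)}) ->
  (forall u, 0 < u -> {ae P, forall w, (Leta w).-integrable `]0, u]
     (fun x => (sigma2 0 (u - x))%:E)}) ->
  (forall u, 0 < u ->
     (\int[P]_w \int[Leta w]_(x in `]0%R, u])
        (mu 0 (u - x) ^+ 2 + sigma2 0 (u - x))%R%:E < +oo)%E) ->
  (forall u, 0 < u ->
     (\int[P]_w (\int[Leta w]_(x in `]0%R, u]) `|mu 0 (u - x)|%R%:E) ^+ 2
        < +oo)%E) ->
  0 < s -> 0 < t ->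
  let J := fun w => \int[Leta w]_(x in `]s, s + t]) mu 0 (s + t - x) in
  let K := fun w =>
    \int[Leta w]_(x in `]s, s + t]) (mu 0 (s + t - x) ^+ 2
                                     + sigma2 0 (s + t - x)) in
  let D := `]s, s + t] `*` `[0, +oo[ in
  [/\ is_cond_expectation P G (fun w => (M (s + t) w - M s w)%:E)
        (fun w => (\sum_(1 <= j < (N s w).+1)
                     mu (s - T j w) (s + t - T j w))%:E + 'E_P[J])%E,
      ('E_P[J] = \int[rho]_(z in D) (mu 0 (s + t - z.1) * z.2)%R%:E)%E,
      is_cond_variance P G (fun w => M (s + t) w - M s w)
        (fun w => (\sum_(1 <= j < (N s w).+1)
                     sigma2 (s - T j w) (s + t - T j w))%:E
                  + 'V_P[J] + 'E_P[K])%E &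
      ('V_P[J] + 'E_P[K] =
         \int[rho]_(z in D) (mu 0 (s + t - z.1) ^+ 2 * z.2 ^+ 2)%R%:E
         + \int[rho]_(z in D)
             ((mu 0 (s + t - z.1) ^+ 2 + sigma2 0 (s + t - z.1)) * z.2)%R%:E)%E].
Proof.
move=> etap mu sigma2 Leta' M T G addE coxN addQ addL lawL indL indF L2Q _ _ HK HM s0 t0 J K D.
have L2 j : (1 <= j)%N -> forall u, 0 <= u -> ('E_P[Ls j u ^+ 2] < +oo)%E.
  move=> j1 u u0; apply: (same_law_sqr_lty (W := L) _ _ u0 (lawL j j1) (L2Q u u0)).
    by have [h _ _ _ _] := addL j j1; exact: h.
  by have [h _ _ _ _] := addQ; exact: h.
pose U := s + t; pose m := jump_mean rhoL; pose q := jump_sqr rhoL.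
pose f x := m (U - x); pose g x := q (U - x).
have s0' := ltW s0; have U0 : 0 < U by exact: addr_gt0.
have U0' := ltW U0; have sU : s <= U by rewrite lerDl ltW.
have cm : continuous m by exact: (continuous_jump_mean addQ L2Q).
have cq : continuous q by exact: (continuous_jump_sqr addQ L2Q).
have cshift (h : R -> R) c : continuous h -> continuous (fun x => h (c - x)).
  move=> ch x; apply: continuous_comp; last exact: ch.
  by apply: cvgB; [exact: cvg_cst|exact: cvg_id].
have cnorm (h : R -> R) : continuous h -> continuous (fun x => `|h x|).
  by move=> ch x; apply: cvg_norm; exact: ch.
have csqr (h : R -> R) : continuous h -> continuous (fun x => h x ^+ 2).
  by move=> ch x; apply: cvg_sqr; exact: ch.
have cf : continuous f by exact: cshift.
have cg : continuous g by exact: cshift.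
have q0 u : 0 <= q u by apply: Rintegral_ge0 => z _; exact: sqr_ge0.
have muE : mu 0 = m by apply/funext => u; exact: (mean_incr0 addQ L2Q).
have sigE : sigma2 0 = q by apply/funext => u; exact: (var_incr0 addQ L2Q).
have cf2g : continuous (fun x => f x ^+ 2 + g x).
  by move=> x; apply: cvgD; [exact: (csqr _ cf)|exact: cg].
have f2g0 x : 0 <= f x ^+ 2 + g x by rewrite addr_ge0 ?sqr_ge0// q0.
have mI h a b : 0 <= a -> a <= b -> continuous h -> measurable_fun setT (int_eta eta h a b).
  by move=> a0 ab ch; exact: (measurable_int_eta addE).
(* Both u = s + t and u = s will be used: they are the two ends of the increments in [marks_sum]. *)
have iM0 u : 0 < u -> P.-integrable setT
    (EFin \o (fun w => int_eta eta (fun x => `|m (u - x)|) 0 u w ^+ 2)).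
  move=> u0; have ch : continuous (fun x => `|m (u - x)|) by exact: (cnorm _ (cshift _ _ cm)).
  apply/integrableP; split.
    by apply/measurable_EFinP/measurable_funX; apply: mI => //; exact: ltW.
  have := HM u u0; rewrite muE; congr (_ < _)%E; apply: eq_integral => w _.
  by rewrite abse_EFin ger0_norm ?sqr_ge0// (integral_LetaE _ _ _ _ ch) -EFin_expe.
have iK0 : P.-integrable setT (EFin \o int_eta eta (fun x => f x ^+ 2 + g x) 0 U).
  apply/integrableP; split; first by apply/measurable_EFinP; exact: mI.
  have := HK U U0; rewrite muE sigE; congr (_ < _)%E; apply: eq_integral => w _.
  by rewrite abse_EFin ger0_norm ?int_eta_ge0// (integral_LetaE _ _ _ _ cf2g).
have iKs : P.-integrable setT (EFin \o int_eta eta (fun x => f x ^+ 2 + g x) s U).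
  apply: (le_integrable_ge0 _ iK0) => [|w]; first exact: mI.
  by rewrite int_eta_ge0//=; exact: int_eta_widen.
have int_le h h' a b w : continuous h -> continuous h' -> (forall x, h x <= h' x) ->
    int_eta eta h a b w <= int_eta eta h' a b w.
  by move=> ch ch' hh; apply: le_Rintegral => //; exact: integrable_Leta.
have iQ : P.-integrable setT (EFin \o int_eta eta (fun x => f x ^+ 2) s U).
  apply: (le_integrable_ge0 _ iKs) => [|w]; first by apply: mI => //; exact: csqr.
  rewrite int_eta_ge0/=; last by move=> x; exact: sqr_ge0.
  by apply: int_le => // [|x]; [exact: csqr|rewrite lerDl q0].
have ig0 : P.-integrable setT (EFin \o int_eta eta g 0 U).
  apply: (le_integrable_ge0 _ iK0) => [|w]; first exact: mI.
  rewrite int_eta_ge0/=; last by move=> x; exact: q0.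
  by apply: int_le => // x; rewrite lerDr sqr_ge0.
have ig : P.-integrable setT (EFin \o int_eta eta g s U).
  apply: (le_integrable_ge0 _ ig0) => [|w]; first exact: mI.
  by rewrite int_eta_ge0//=; [apply: int_eta_widen => // x; exact: q0|move=> x; exact: q0].
have cnf : continuous (fun x => `|f x|) by exact: cnorm.
have iJ2 : P.-integrable setT (EFin \o (fun w => int_eta eta (fun x => `|f x|) s U w ^+ 2)).
  apply: (le_integrable_ge0 _ (iM0 U U0)) => [|w]; first by apply: measurable_funX; exact: mI.
  rewrite sqr_ge0/=; apply: lerXn2r; rewrite ?nnegrE ?int_eta_ge0//.
  exact: int_eta_widen.
have iabs u : 0 < u -> P.-integrable setT (EFin \o points_sum N (fun x => `|m (u - x)|) 0 u).
  move=> u0; have ch : continuous (fun x => `|m (u - x)|) by exact: (cnorm _ (cshift _ _ cm)).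
  apply: (integrable_points_sum addE coxN) => //; first exact: ltW.
  apply: sqr_integrable_integrable; last exact: iM0.
  by apply: mI => //; exact: ltW.
have cN : counting_process N by case: coxN.
have N0 w : N 0 w = 0%N by case: cN => _ h _ _; exact: h.
have NsU w : (N s w <= N U w)%N by case: cN => _ _ h _; exact: h.
have msum h : continuous h -> measurable_fun setT (marks_sum N s t h).
  move=> ch; apply: (measurableT_comp (measurable_marks_sum t coxN s0 ch)).
  apply: measurable_sub_id; apply: gen_measurable => u /=; rewrite in_itv/= => /andP[u0 _].
  exact: (measurable_cox coxN).
(* Arrivals up to [s] are among those up to [U], so for nonnegative [h] a full sum over (0, U] is a
   bound, and Campbell's formula makes it integrable. [N 0 w = 0] lets that sum start at index 1. *)
have pre_le h w : (forall x, 0 <= h x) ->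
    \sum_(1 <= j < (N s w).+1) h (U - arrival_time N j w) <= points_sum N (fun x => h (U - x)) 0 U w.
  move=> h0; have -> : points_sum N (fun x => h (U - x)) 0 U w =
      \sum_(1 <= j < (N s w).+1) h (U - arrival_time N j w) +
      \sum_((N s w).+1 <= j < (N U w).+1) h (U - arrival_time N j w).
    by have NsUw := NsU w; rewrite /points_sum N0 (@big_cat_nat _ _ _ (N s w).+1).
  by rewrite lerDl; apply: sumr_ge0 => j _; exact: h0.
have iSm : P.-integrable setT (EFin \o marks_sum N s t m).
  apply: le_integrable (integrableD measurableT (iabs U U0) (iabs s s0)) => //.
    exact/measurable_EFinP/msum.
  move=> w _ /=; rewrite lee_fin [leRHS]ger0_norm ?addr_ge0 ?sumr_ge0//.
  rewrite /marks_sum sumrB; apply: (le_trans (ler_normB _ _)); apply: lerD.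
    by apply: (le_trans (ler_norm_sum _ _ _)); exact: (pre_le (fun x => `|m x|)).
  by apply: (le_trans (ler_norm_sum _ _ _)); rewrite /points_sum N0.
(* Since q >= 0, each difference is at most its first term q(U - T_j). *)
have iSq : P.-integrable setT (EFin \o marks_sum N s t q).
  apply: (le_integrable_ge0 _ (integrable_points_sum addE coxN (lexx 0) U0' cg (fun x => q0 _) ig0)).
    exact: msum.
  move=> w; rewrite (marks_sum_var_ge0 coxN addL L2 s0 t0)/=.
  apply: le_trans (pre_le q w q0); apply: ler_sum => j _.
  by rewrite lerBlDr lerDl q0.
have := past_cond_expectation addE coxN addL L2 indL indF s0 t0 iJ2 iQ ig iSm iSq.
have := past_cond_variance addE coxN addL L2 indL indF s0 t0 iJ2 iQ ig iSm iSq.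
have JE : J = int_eta eta f s U by rewrite /J muE.
have KE : K = int_eta eta (fun x => f x ^+ 2 + g x) s U by rewrite /K muE sigE.
have iJ1 : P.-integrable setT (EFin \o int_eta eta (fun x => `|f x|) s U).
  by apply: sqr_integrable_integrable => //; exact: mI.
have iJ := integrable_int_eta addE sU cf iJ1.
have iJsq : P.-integrable setT (EFin \o (fun w => int_eta eta f s U w ^+ 2)).
  apply: le_integrable iJ2 => //; first by apply/measurable_EFinP/measurable_funX; exact: mI.
  move=> w _ /=; rewrite lee_fin !ger0_norm ?sqr_ge0//.
  rewrite -[leLHS]real_normK ?num_real//; apply: lerXn2r; rewrite ?nnegrE ?int_eta_ge0//.
  exact: int_eta_le_norm.
have EJE : ('E_P[J])%E = (\int[P]_w int_eta eta f s U w)%:E.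
  by rewrite JE unlock /Rintegral fineK// (integrable_fin_num measurableT iJ).
have VJE : ('V_P[J])%E = (\int[P]_w (int_eta eta f s U w ^+ 2) - (\int[P]_w int_eta eta f s U w) ^+ 2)%:E.
  by rewrite JE variance_integrable//; exact: mI.
have EKE : ('E_P[K])%E = (\int[P]_w int_eta eta (fun x => f x ^+ 2) s U w + \int[P]_w int_eta eta g s U w)%:E.
  rewrite KE unlock -[LHS]fineK; last exact: (integrable_fin_num measurableT iKs).
  congr EFin; rewrite -RintegralD//; apply: eq_Rintegral => w _.
  rewrite /int_eta RintegralD//; first by apply: integrable_Leta; exact: csqr.
  exact: integrable_Leta.
have mincr j w : (1 <= j)%N -> (j <= N s w)%N ->
    0 <= s - T j w /\ s - T j w <= s + t - T j w.
  move=> j1 js; split; last by rewrite lerD2r.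
  by rewrite subr_ge0 (arrival_time_le cN s0').
have Ymean w : \sum_(1 <= j < (N s w).+1) mu (s - T j w) (s + t - T j w) = marks_sum N s t m w.
  apply: eq_big_nat => j; rewrite ltnS => /andP[j1 js]; have [h1 h2] := mincr j w j1 js.
  exact: (mean_incrE addQ L2Q).
have Yvar w : \sum_(1 <= j < (N s w).+1) sigma2 (s - T j w) (s + t - T j w) = marks_sum N s t q w.
  apply: eq_big_nat => j; rewrite ltnS => /andP[j1 js]; have [h1 h2] := mincr j w j1 js.
  exact: (var_incrE addQ L2Q).
move=> cvar cexp; split.
- rewrite (_ : (fun w => _ + 'E_P[J])%E = (fun w => (marks_sum N s t m w +
    \int[P]_w int_eta eta f s U w)%:E)%E)//.
  by apply/funext => w; rewrite EFinD -EJE -Ymean.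
- rewrite JE unlock (int_eta_mean_jumps addE s0' sU cf iJ1).
  by apply: eq_integral => z _; rewrite muE.
- exists (fun w => marks_sum N s t m w + \int[P]_w int_eta eta f s U w); split => //.
  rewrite (_ : (fun w => _ + _ + 'E_P[K])%E = (fun w => (marks_sum N s t q w +
    future_var P eta rhoL s t)%:E)%E)//.
  apply/funext => w; rewrite Yvar VJE EKE -!EFinD; congr EFin.
  by rewrite /future_var -!addrA.
(* [int_eta_mean_jumps] asks for the absolute value of the weight, which here is nonnegative
   already. *)
- have ikn : P.-integrable setT (EFin \o int_eta eta (fun x => `|f x ^+ 2 + g x|) s U).
    rewrite (_ : (fun x => `|_|) = (fun x => f x ^+ 2 + g x))//.
    by apply/funext => x; rewrite ger0_norm.
  rewrite KE unlock (int_eta_mean_jumps addE s0' sU cf2g ikn).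
  rewrite (_ : (\int[rho]_(z in D) ((mu 0 _ ^+ 2 + _) * _)%:E)%E =
    (\int[rho]_(z in D) ((f z.1 ^+ 2 + g z.1) * z.2)%:E)%E); last by rewrite muE sigE.
  congr (_ + _)%E.
  (* The squared mean in the second moment cancels against the one in the variance, which leaves the
     integral of f^2 v^2. *)
  have := int_eta_second_moment_jumps addE s0' sU cf iJ1 iJsq.
  rewrite muE -/f VJE EFinB => E.
  have -> : (\int[P]_w (int_eta eta f s U w ^+ 2))%:E = (\int[P]_w (int_eta eta f s U w ^+ 2)%:E)%E.
    by rewrite /Rintegral fineK// (integrable_fin_num measurableT iJsq).
  by rewrite E addeK.
Qed.
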